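(* Let $p$ be a prime. Then there exists a constant $\gamma(p)$, depending only on $p$, such that for all positive integers $n$ \[|\mathrm{Sub}_{\mathcal{N}_p}(\mathrm{S}_n)| \le p^{n^2/(4p^2)}\,2^{\gamma(p)\, n \log n}.\] In particular, the number of nilpotent subgroups of $\mathrm{S}_n$ satisfies \[|\mathrm{Sub}_{\mathrm{nilp}}(\mathrm{S}_n)| \le 2^{n^2/16 + \gamma(2)\, n \log n}.\]
   Context: $\mathrm{S}_n$ is the symmetric group on $n$ points. For a prime $p$, $\mathcal{N}_p$ is the property of being nilpotent and of order divisible by no prime less than $p$. For a group-theoretic property $\mathcal{P}$, $\mathrm{Sub}_{\mathcal{P}}(G)$ is the set of subgroups of $G$ satisfying $\mathcal{P}$; $\mathrm{Sub}_{\mathrm{nilp}}(G)$ is the set of nilpotent subgroups. Logarithms are to the base $2$. *)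

(* Defs.v *)
From HB Require Import structures.
From mathcomp Require Import all_boot all_order all_fingroup all_solvable.
From mathcomp Require Import all_algebra all_classical all_reals all_analysis.

Set Implicit Arguments.
Unset Strict Implicit.
Unset Printing Implicit Defensive.

Import Order.TTheory GRing.Theory Num.Theory.

Definition SubWith (gT : finGroupType) (P : {group gT} -> bool)
    (G : {group gT}) : {set {group gT}} :=
  [set H in subgroups G | P H].

Definition nilpotent_grp (gT : finGroupType) (H : {group gT}) : bool :=
  nilpotent H.

(* The trivial group satisfies this for every p. *)
Definition nilpotent_geq (p : nat) (gT : finGroupType) (H : {group gT}) : bool :=
  nilpotent H && [forall q : 'I_p, prime q ==> ~~ (q %| #|H|)%N].

Local Open Scope ring_scope.

Definition logb2 (R : realType) (x : R) : R := ln x / ln 2.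

(* Main.v *)
(* A p-subgroup of S_n is built up orbit by orbit. If P acts on the remaining
   points with Frattini rank d, then passing to one more orbit of size p * mu
   leaves about p ^ (mu * d) choices, and the moments of p ^ d over all P are
   themselves counted by p-subgroups of a product with an elementary abelian
   group E. So one bounds the number of p-subgroups of Sym(A) x E, |E| = p^j, by
   p ^ ((|A| / p + j)^2 / 4) up to the error term; the induction closes because
   (|A| / p + j) is unchanged when p * mu points are traded for rank mu in E. Two
   estimates make this work: a p-group all of whose orbits are large has rank
   o(n), so that such groups contribute little; and, for p = 2, only few subgroups
   of index two can have a much larger rank than the group.

   For a nilpotent group G, let X be its Sylow q-subgroup for the smallest prime
   q and Y the complement. Each orbit moved by X is a product of an X-orbit and a
   Y-orbit, so X acts faithfully on a set A and Y on a set S with |A| + |S| <= n;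
   since x^2 + y^2 <= (x + y)^2, the bounds for X and Y combine. *)

Require Import Defs.
From HB Require Import structures.
From mathcomp Require Import all_boot all_order all_fingroup all_solvable.
From mathcomp Require Import all_algebra all_character zify ring lra reals exp.

Set Implicit Arguments.
Unset Strict Implicit.
Unset Printing Implicit Defensive.

Import Order.TTheory GRing.Theory Num.Theory.

(** A subgroup of a product is determined by its fibres over generators of its first projection G1.
    For an orbit of p * mu points, with t the p-adic valuation of mu!, the step costs p^(t (p - 1)
    d) for each of the at most p^d subgroups B of index p in G1; Legendre's formula t (p - 1) + 1 =
    mu turns this into p^(mu d). The obstacle is that B may have larger rank than (p - 1) d. A rank
    above (1/2 + delta) m, with m = |A|/p + j, makes B, hence G1, rare by the moment bound. Smaller
    jumps are harmless for p > 2. For p = 2 the excess is read off quadratic forms on G1 that vanish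
    on B; too many such B would give Phi(G1) more characters than G1 has elements. In the rank
    estimate, dimensions of permutation modules over F_p only give O(n); counting module generators
    along a chief series leads to a walk killed at 0 and gives o(n). Finally the error constants
    depend on the prime, but sharp bounds are needed for finitely many primes only: for large q the
    crude Sylow count is small enough. *)

(** * A weighted count of walks *)

(* Bound for the number of generators contributed by one orbit. Fusing
   suborbits in classes of p turns a chain of q modules into chains of lengths
   q + 1, q - 1 and p - 2 times q; see [chain_rank_split]. For p = 2 this
   counts walks on the half line, whence [walks p 1 i = o(p ^ i)]. *)
Fixpoint walks (p q i : nat) {struct i} : nat :=
  if i is i'.+1 then if q is q'.+1 then walks p q.+1 i' + walks p q' i' + (p - 2) * walks p q i' else 0
  else (0 < q)%N.

Lemma walks0 p i : walks p 0 i = 0. Proof. by case: i. Qed.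

Lemma walks_le p q i : 1 < p -> walks p q i <= p ^ i.
Proof.
move=> p1; elim: i q => [|i IH] [|q] //=.
have := IH q.+2; have := IH q; have := IH q.+1; rewrite expnS; move: (p ^ i) => P.
move: (walks p q.+2 i) (walks p q i) (walks p q.+1 i) => a b c; nia.
Qed.

(* The right-hand side over [K * (i + p * K ^ 2)] is a supersolution of the
   recursion, because it is concave in q on [0, 2K]. *)
Lemma walks_barrier p K i q : 1 < p -> 0 < K -> q <= 2 * K ->
  K * (i + p * K ^ 2) * walks p q i <=
    p ^ i * (q * (i + p * K ^ 2) + K * (p * K ^ 2) * (q * (2 * K - q))).
Proof.
move=> p1 K0; set c := p * K ^ 2; have c0 : 0 < c by rewrite muln_gt0 expn_gt0 K0; lia.
(* From [K] on the linear term alone exceeds the trivial bound p^j, so the recursion has to be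
   checked only below [K]. *)
have big j x : K <= x -> K * (j + c) * walks p x j <= p ^ j * (x * (j + c) + K * c * (x * (2 * K - x))).
  move=> Kx; apply: (@leq_trans (p ^ j * (x * (j + c)))); last by rewrite leq_mul2l leq_addr orbT.
  by rewrite [X in _ <= X]mulnC leq_mul ?walks_le // leq_mul2r Kx orbT.
elim: i q => [|i IH] q q2K.
  case: (leqP K q) => [/big //|qK]; case: q q2K qK => [|q] q2K qK; first by rewrite walks0 muln0.
  rewrite expn0 mul1n add0n /= muln1; apply: leq_trans (leq_addl _ _); apply: leq_pmulr.
  by rewrite muln_gt0 /=; lia.
case: (leqP K q) => [/big //|qK]; case: q q2K qK => [|q] q2K qK; first by rewrite walks0 muln0.
rewrite [walks _ _ _]/=.
have h1 : q.+2 <= 2 * K by lia.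
have h2 : q <= 2 * K by lia.
have := IH _ h1; have := IH _ h2; have := IH _ q2K.
move: (walks p q.+2 i) (walks p q i) (walks p q.+1 i) => a b d.
rewrite expnS; move: (p ^ i) => P.
have [m defm] : exists m, 2 * K = q.+1 + m.+1 by exists (2 * K - q.+2); lia.
have -> : 2 * K - q.+1 = m.+1 by lia.
have -> : 2 * K - q.+2 = m by lia.
have -> : 2 * K - q = m.+2 by lia.
set A := i + c; have -> : i.+1 + c = A.+1 by rewrite /A addSn.
have A0 : 0 < A by rewrite /A; lia.
move=> e1 e2 e3.
(* By AM-GM q (2K - q) is at most K^2; this is why c is p K^2. *)
have phi : p * (q.+1 * m.+1) <= c.
  rewrite /c leq_mul2l; apply/orP; right; have : (2 * K) ^ 2 = (q.+1 + m.+1) ^ 2 by rewrite defm.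
  rewrite !expnS !expn0 !muln1; nia.
have cA : c <= A by rewrite /A; lia.
have [p' defp] : exists p', p = p' + 2 by exists (p - 2); lia.
have -> : p - 2 = p' by lia.
rewrite defp in phi *.
set f := q.+1 * m.+1 in e1 phi *; set Q := K * c in e1 e2 e3 *.
(* The second difference of q (2K - q) is -2, so the recursion replaces p f by p f - 2. This loss
   pays for the growth of i + c by one, because p f <= c. *)
have [X defX] : exists X, q.+2 * m + q * m.+2 + p' * f = X /\ X + 2 = (p' + 2) * f.
  by exists (q.+2 * m + q * m.+2 + p' * f); split=> //; rewrite /f; nia.
case: defX => defX X2.
have sum : K * A * (a + b + p' * d) <= P * ((p' + 2) * q.+1 * A + Q * X).
  have -> : K * A * (a + b + p' * d) = K * A * a + K * A * b + p' * (K * A * d) by ring.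
  apply: leq_trans (leq_add (leq_add e3 e2) (leq_mul (leqnn p') e1)) _; apply/eq_leq.
  rewrite -defX; ring.
rewrite -(leq_pmul2l A0); apply: (@leq_trans (A.+1 * (K * A * (a + b + p' * d)))).
  by apply/eq_leq; ring.
apply: leq_trans (leq_mul (leqnn A.+1) sum) _.
have -> : A.+1 * (P * ((p' + 2) * q.+1 * A + Q * X)) = P * (A.+1 * ((p' + 2) * q.+1 * A) + Q * (A.+1 * X)) by ring.
have -> : A * ((p' + 2) * P * (q.+1 * A.+1 + Q * f)) = P * (A.+1 * ((p' + 2) * q.+1 * A) + Q * (A * ((p' + 2) * f))) by ring.
rewrite leq_mul2l leq_add2l leq_mul2l -X2; apply/orP; right; apply/orP; right; nia.
Qed.

Lemma walks_small p k : 1 < p -> exists i0, forall i, i0 <= i -> k * walks p 1 i <= p ^ i.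
Proof.
move=> p1; pose K := k.+1 * 2; have K0 : 0 < K by [].
(* At q = 1 the barrier is p^i (1/K + c (2K - 1) / (i + c)); from this threshold on the second term
   is also at most 1/K, and K = 2 (k + 1). *)
pose c := p * K ^ 2; exists (K * c * (2 * K)) => i ile.
have c0 : 0 < c by rewrite muln_gt0 expn_gt0 K0; lia.
have := walks_barrier i p1 K0 (_ : 1 <= 2 * K); rewrite -/c => /(_ isT).
have A0 : 0 < i + c by lia.
move: (walks _ _ _) (p ^ i) => w P H.
have H2 : K * (i + c) * w <= P * (2 * (i + c)).
  apply: (leq_trans H); rewrite leq_mul2l !mul1n; apply/orP; right.
  have : K * c * (2 * K - 1) <= K * c * (2 * K) by rewrite leq_mul2l leq_subr orbT.
  by move: ile; move: (K * c * _) (K * c * _) => x y; lia.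
have : K * w <= P * 2 by rewrite -(leq_pmul2l A0) mulnA (mulnC _ K) (leq_trans H2) // mulnA mulnC.
rewrite /K; nia.
Qed.

Lemma sum_expn_le p e : 1 < p -> \sum_(i < e) p ^ i <= p ^ e.
Proof.
move=> p1; elim: e => [|e IH]; first by rewrite big_ord0.
by rewrite big_ord_recr /= expnS; apply: leq_trans (leq_add IH (leqnn _)) _; rewrite addnn -mul2n leq_mul2r p1 orbT.
Qed.

Lemma sum_walks_small p k : 1 < p ->
  exists e0, forall e, e0 <= e -> k * \sum_(i < e) walks p 1 i <= p ^ e.
Proof.
move=> p1; have [i0 Hi0] := walks_small (2 * k) p1.
(* The terms below i0 add up to at most p^i0, and 2k p^i0 <= p^e from here on since 2k <= p^(2k). *)
exists (i0 + 2 * k) => e ee.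
have [e' defe] : exists e', e = i0 + e' by exists (e - i0); lia.
suff : 2 * k * \sum_(i < e) walks p 1 i <= 2 * k * p ^ i0 + p ^ e.
  have : 2 * k * p ^ i0 <= p ^ e.
    apply: (@leq_trans (p ^ (2 * k) * p ^ i0)); first by rewrite leq_mul2r (ltnW (ltn_expl _ p1)) orbT.
    by rewrite -expnD leq_pexp2l //; lia.
  by move: (\sum_(i < e) _) (p ^ e) (2 * k * p ^ i0) => x y z; nia.
rewrite defe big_split_ord /= mulnDr -defe leq_add //.
  rewrite leq_mul2l; apply/orP; right; apply: leq_trans (sum_expn_le i0 p1).
  by apply: leq_sum => i _; apply: walks_le.
rewrite big_distrr /= (leq_trans _ (sum_expn_le e p1)) //.
rewrite defe big_split_ord /= (leq_trans _ (leq_addl _ _)) //; apply: leq_sum => i _.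
by apply: Hi0; rewrite leq_addr.
Qed.

Local Open Scope group_scope.

(** * The Frattini rank *)

Lemma card_le_imset_fibers (T1 T2 : finType) (A : {set T1}) (f : T1 -> T2) (k : nat) :
  (forall y, y \in f @: A -> #|[set x in A | f x == y]| <= k) ->
  #|A| <= #|f @: A| * k.
Proof.
move=> fib_le; rewrite -sum1_card (partition_big_imset f) /=.
rewrite -sum_nat_const; apply: leq_sum => y yfA.
by rewrite sum1_card (leq_trans _ (fib_le y yfA)) // cardsE.
Qed.

Lemma leq_card_in (T1 T2 : finType) (A : {set T1}) (B : {set T2}) (f : T1 -> T2) :
  {in A &, injective f} -> (forall x, x \in A -> f x \in B) -> #|A| <= #|B|.
Proof.
move=> injf fAB; rewrite -(card_in_imset injf); apply/subset_leq_card/subsetP=> _ /imsetP[x xA ->].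
exact: fAB.
Qed.

Lemma leq_expn2l m n e : m <= n -> m ^ e <= n ^ e.
Proof. by move=> mn; case: e => // e; rewrite leq_exp2r. Qed.

(** For a p-group this is the minimal number of generators, by the Burnside basis theorem. *)
Definition frank (p : nat) (gT : finGroupType) (G : {set gT}) := logn p #|G : 'Phi(G)|.

Section Frank.
Variables (p : nat) (gT : finGroupType).
Implicit Types G H B : {group gT}.

Lemma card_quo_Phi G : prime p -> p.-group G -> #|G / 'Phi(G)| = (p ^ frank p G)%N.
Proof.
move=> pr pG; rewrite /frank card_quotient; last exact: normal_norm (Phi_normal G).
have /p_natP[m ->] : p.-nat #|G : 'Phi(G)| by apply: pnat_dvd pG; apply: dvdn_indexg.
by rewrite pfactorK.
Qed.

Lemma frank_gen G : prime p -> p.-group G ->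
  exists2 X : {set gT}, <<X>> = G & #|X| <= frank p G.
Proof.
move=> pr pG; have abG := Phi_quotient_abelem pG.
have [B genB cardB] := grank_witness (G / 'Phi(G))%G.
have rB : #|B| = frank p G.
  rewrite cardB grank_abelian ?(abelem_abelian abG) // (rank_abelem abG).
  by rewrite card_quo_Phi // pfactorK.
pose X := [set repr (set_of_coset b) | b in B].
exists X; last by rewrite -rB leq_imset_card.
have sBG : B \subset G / 'Phi(G) by rewrite -genB subset_gen.
have nPhi : G \subset 'N('Phi(G)) := normal_norm (Phi_normal G).
have sXG : X \subset G.
  apply/subsetP=> _ /imsetP[b bB ->].
  have /morphimP[g gN gG ->] := subsetP sBG b bB.
  have : repr (coset 'Phi(G) g) \in 'Phi(G) :* g.
    by rewrite -val_coset //; exact: mem_repr_coset.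
  by case/rcosetP=> x xP ->; rewrite groupM // (subsetP (Phi_sub G)).
apply: Phi_nongen; apply/eqP; rewrite eqEsubset join_subG Phi_sub sXG /=.
rewrite -(quotientSGK nPhi) ?joing_subl // -genB gen_subG; apply/subsetP=> b bB.
have /morphimP[g gN gG def_b] := subsetP sBG b bB.
rewrite -(coset_reprK b) mem_quotient // mem_gen // inE; apply/orP; right.
by apply/imsetP; exists b.
Qed.

Lemma frank_card G : prime p -> p.-group G -> p ^ frank p G <= #|G|.
Proof.
move=> pr pG; rewrite -card_quo_Phi // card_quotient ?normal_norm ?Phi_normal //.
by rewrite dvdn_leq ?cardG_gt0 // dvdn_indexg.
Qed.

Lemma index_p_normal G B : prime p -> p.-group G -> B \subset G -> #|G : B| = p -> B <| G.
Proof.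
by move=> pr pG sBG iB; apply: (p_maximal_normal pG); apply: p_index_maximal; rewrite // iB.
Qed.

Lemma index_p_expn G B x k : prime p -> p.-group G -> B \subset G -> #|G : B| = p ->
  x \in G -> x \notin B -> (x ^+ k \in B) = (p %| k).
Proof.
move=> pr pG sBG iB xG xB; have nB := index_p_normal pr pG sBG iB.
have xN : x \in 'N(B) by rewrite (subsetP (normal_norm nB)).
have cQ : #|G / B| = p by rewrite card_quotient ?normal_norm.
have ord : #[coset B x] = p.
  apply/eqP; have : #[coset B x] %| p by rewrite -cQ order_dvdG // mem_quotient.
  case/primeP: pr => _ H /H /orP[|] //; rewrite order_eq1 => /eqP/coset_idr.
  by move/(_ xN)=> xB'; rewrite xB' in xB.
rewrite -[X in X %| k]ord order_dvdn -morphX //; apply/idP/eqP=> [|/coset_idr->//].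
  exact: coset_id.
exact: groupX.
Qed.

Lemma index_p_rcoset G B x g : prime p -> p.-group G -> B \subset G -> #|G : B| = p ->
  x \in G -> x \notin B -> g \in G -> exists k : 'I_p, g \in B :* (x ^+ k).
Proof.
move=> pr pG sBG iB xG xB gG.
pose f (k : 'I_p) := B :* (x ^+ k).
have injf : injective f.
  move=> k l /= /eqP eq_kl; apply/val_inj => /=; move: k l eq_kl.
  suff H (k l : 'I_p) : f k = f l -> k <= l -> k = l :> nat.
    by move=> k l /eqP E; case: (leqP k l) => [|/ltnW] kl; [apply: H | symmetry; apply: H].
  move=> E kl; have : x ^+ l \in B :* x ^+ k by rewrite -/(f k) E rcoset_refl.
  rewrite mem_rcoset -[in x ^+ l](subnK kl) expgD mulgK.
  rewrite (index_p_expn _ pr pG sBG iB) // => pkl.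
  by case: (posnP (l - k)) => [|/dvdn_leq/(_ pkl)]; have := ltn_ord l; lia.
have /subsetP sub : [set f k | k : 'I_p] \subset rcosets B G.
  by apply/subsetP=> _ /imsetP[k _ ->]; apply/rcosetsP; exists (x ^+ k); rewrite ?groupX.
have E : [set f k | k : 'I_p] = rcosets B G.
  apply/eqP; rewrite eqEcard; apply/andP; split; first exact/subsetP.
  by rewrite (card_imset _ injf) card_ord -[#|rcosets _ _|]/(#|G : B|) iB.
have : B :* g \in rcosets B G by apply/rcosetsP; exists g.
by rewrite -E => /imsetP[k _ defg]; exists k; rewrite -/(f k) -defg rcoset_refl.
Qed.

(** B is the kernel of a homomorphism [e B] to Z/p, normalised to be 1 at a chosen element [x0 B]
    outside B. Two such homomorphisms agree on a subgroup, so they are determined by their values on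
    generators of G. *)
Lemma card_index_p_subgroups G : prime p -> p.-group G ->
  #|[set B : {group gT} | (B \subset G) && (#|G : B| == p)]| <= p ^ frank p G.
Proof.
move=> pr pG; have [X genX cardX] := frank_gen pr pG.
have p0 := prime_gt0 pr; have p1 := prime_gt1 pr.
have sXG : X \subset G by rewrite -genX subset_gen.
pose x0 (B : {group gT}) := odflt 1 [pick x in G :\: B].
have x0P B : B \subset G -> #|G : B| = p -> x0 B \in G :\: B.
  move=> sBG iB; rewrite /x0; case: pickP => //= nox.
  have : G \subset B by apply/subsetP=> x xG; apply/idPn=> xB; have:= nox x; rewrite !inE xG xB.
  by rewrite -indexg_eq1 iB => /eqP p_1; rewrite p_1 in p1.
pose e (B : {group gT}) x : 'I_p := odflt (Ordinal p0) [pick k : 'I_p | x \in B :* x0 B ^+ k].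
have eP (B : {group gT}) x : B \subset G -> #|G : B| = p -> x \in G -> x \in B :* x0 B ^+ e B x.
  move=> sBG iB xG; rewrite /e; case: pickP => //= nok.
  have /setDP[x0G x0B] := x0P B sBG iB.
  by have [k] := index_p_rcoset pr pG sBG iB x0G x0B xG; rewrite nok.
pose code (B : {group gT}) := [ffun x => if x \in X then e B x else Ordinal p0].
apply: (@leq_trans #|[set f : {ffun gT -> 'I_p} | f \in pffun_on (Ordinal p0) X [set: 'I_p]]|).
  apply: (@leq_card_in _ _ _ _ code) => [B B' | B].
    rewrite !inE => /andP[sBG /eqP iB] /andP[sB'G /eqP iB'] eq_code.
    suff sub : B \subset B'.
      apply/val_inj/eqP; rewrite /= eqEcard sub /= -(@leq_pmul2r p) //.
      by rewrite -[X in _ * X <= _]iB' -[X in _ <= _ * X]iB !Lagrange.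
    have [nB nB'] := (index_p_normal pr pG sBG iB, index_p_normal pr pG sB'G iB').
    have /setDP[x0G x0B] := x0P B sBG iB; have /setDP[x0G' x0B'] := x0P B' sB'G iB'.
    have eU (A : {group gT}) g k : A \subset G -> #|G : A| = p -> g \in G ->
        g \in A :* x0 A ^+ k -> e A g = k %% p :> nat.
      move=> sAG iA gG; have /setDP[xG xA] := x0P A sAG iA; have := eP A g sAG iA gG.
      rewrite !mem_rcoset => gl gk.
      have H a b : g * x0 A ^- a \in A -> g * x0 A ^- b \in A -> a <= b -> a = b %[mod p].
        move=> ga gb ab; apply/esym/eqP; rewrite eqn_mod_dvd //.
        rewrite -(index_p_expn _ pr pG sAG iA xG xA).
        have -> : x0 A ^+ (b - a) = (g * x0 A ^- b)^-1 * (g * x0 A ^- a).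
          by rewrite invMg invgK mulgA mulgKV -{2}(subnK ab) expgD mulgK.
        by rewrite groupM ?groupV.
      have [le|/ltnW le] := leqP (e A g) k.
        by rewrite -(H _ _ gl gk le) modn_small.
      by rewrite (H _ _ gk gl le) modn_small.
    pose C := [set g in G | e B g == e B' g].
    have gC : group_set C.
      apply/group_setP; split=> [|g h].
        rewrite inE group1; apply/eqP/val_inj; rewrite /= (eU _ 1 0) ?(eU _ 1 0) //;
        by rewrite expg0 rcoset1 group1.
      rewrite !inE => /andP[gG /eqP eg] /andP[hG /eqP eh]; rewrite groupM //=.
      have M (A : {group gT}) : A \subset G -> #|G : A| = p -> e A (g * h) = (e A g + e A h) %% p :> nat.
        move=> sAG iA; apply: eU; rewrite ?groupM //.
        have /setDP[xG xA] := x0P A sAG iA; have nA := index_p_normal pr pG sAG iA.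
        have xN : x0 A ^+ e A g \in 'N(A) by rewrite groupX // (subsetP (normal_norm nA)).
        by rewrite expgD -rcoset_mul // mem_mulg // eP.
      by apply/eqP/val_inj; rewrite /= !M // eg eh.
    have sGC : G \subset Group gC.
      rewrite -genX gen_subG; apply/subsetP=> x xX; rewrite inE (subsetP sXG) //=.
      by have /ffunP/(_ x) := eq_code; rewrite !ffunE xX => ->.
    apply/subsetP=> g gB; have gG := subsetP sBG g gB.
    have := subsetP sGC g gG; rewrite inE => /andP[_ /eqP eg].
    have := eU B g 0 sBG iB gG; rewrite expg0 rcoset1 mod0n => /(_ gB) e0.
    by have := eP B' g sB'G iB' gG; rewrite -eg e0 expg0 rcoset1.
  by move=> _; rewrite inE; apply/pffun_onP; split=> [|k _]; [apply/supportP=> x xX; rewrite ffunE (negPf xX) | rewrite inE].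
rewrite cardsE card_pffun_on cardsT card_ord.
by rewrite leq_exp2l.
Qed.
End Frank.

(** * Subgroups of a direct product *)

Section Fibers.
Variables gT sT : finGroupType.
Implicit Types G : {group gT * sT}.

(** G is read as a correspondence between the two factors: [fib G 1] is a subgroup, and every
    nonempty fibre is one of its cosets. *)
Definition fib (G : {set gT * sT}) (h : gT) : {set sT} := [set s | (h, s) \in G].

Lemma fib_group_set G : group_set (fib G 1).
Proof.
apply/group_setP; split=> [|x y]; rewrite !inE; first exact: (group1 G).
by move=> xG yG; rewrite -[1]mulg1; exact: (groupM xG yG).
Qed.
Canonical fib_group G := Group (fib_group_set G).

Lemma fib_mul G h k s t : s \in fib G h -> t \in fib G k -> s * t \in fib G (h * k).
Proof. by rewrite !inE => sG tG; apply: (groupM sG tG). Qed.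

Lemma fib_inv G h s : s \in fib G h -> s^-1 \in fib G h^-1.
Proof. by rewrite !inE => sG; apply: (groupVr sG). Qed.

Lemma fib_conj G h k s t : s \in fib G h -> t \in fib G k -> s ^ t \in fib G (h ^ k).
Proof. by move=> sG tG; rewrite !conjgE !fib_mul ?fib_inv. Qed.

Lemma fib_exp G h s n : s \in fib G h -> s ^+ n \in fib G (h ^+ n).
Proof.
move=> sG; elim: n => [|n IHn]; first by rewrite !expg0 group1.
by rewrite !expgS fib_mul.
Qed.

Lemma fib_ldiv G h s t : s \in fib G h -> (s^-1 * t \in fib G 1) = (t \in fib G h).
Proof.
move=> sG; apply/idP/idP=> [H|tG]; last by rewrite -(mulVg h) fib_mul ?fib_inv.
by rewrite -(mulKVg s t) -(mulg1 h) fib_mul.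
Qed.

Lemma fib_lcoset G h s : s \in fib G h -> fib G h = s *: fib G 1.
Proof. by move=> sG; apply/setP=> t; rewrite mem_lcoset (fib_ldiv _ sG). Qed.

Lemma fibP G h : reflect (exists s, s \in fib G h) (h \in fst @: G).
Proof.
apply: (iffP imsetP) => [[[k s] /= ksG ->] | [s]]; first by exists s; rewrite inE.
by rewrite inE => hsG; exists (h, s).
Qed.

Lemma fib_sub G (Q : {set sT}) h : snd @: G \subset Q -> fib G h \subset Q.
Proof.
by move=> /subsetP sGQ; apply/subsetP=> s; rewrite inE => hs; apply: sGQ; apply/imsetP; exists (h, s).
Qed.

Lemma card_fst G : #|G| = (#|fst @: G| * #|fib G 1|)%N.
Proof.
rewrite -sum1_card (partition_big_imset fst) /= -sum_nat_const.
apply: eq_bigr => h /fibP[s sG].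
rewrite -(card_lcoset (fib G 1) s) -(fib_lcoset sG) sum1_card.
rewrite -(card_imset (mem (fib G h)) (f := pair h)) => [|x y [] //].
rewrite -cardsE; apply: eq_card => -[k t]; rewrite !inE.
apply/andP/imsetP=> [[ktG /eqP /= kh] | [t']]; first by exists t; rewrite ?inE -kh.
by rewrite inE => tG [-> ->].
Qed.

(** Fibres are multiplicative, so the elements of G1 with equal fibres in both groups form a
    subgroup. *)
Lemma eq_fib_gen G G' (G1 : {group gT}) (X : {set gT}) :
  fst @: G = G1 -> fst @: G' = G1 -> <<X>> = G1 -> fib G 1 = fib G' 1 ->
  {in X, fib G =1 fib G'} -> G = G'.
Proof.
move=> pG pG' genX eqN eqX.
suff sub : G \subset G'.
  by apply/val_inj/eqP; rewrite eqEcard sub !card_fst pG pG' eqN /=.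
have sG1 : G1 \subset [set h | (h \in G1) && (fib G h == fib G' h)].
  have gH : group_set [set h | (h \in G1) && (fib G h == fib G' h)].
    apply/group_setP; split=> [|h k]; rewrite !inE ?group1 ?eqN ?eqxx //.
    case/andP=> hG /eqP eh /andP[kG /eqP ek]; rewrite groupM //=.
    have /fibP[s sh] : h \in fst @: G by rewrite pG.
    have /fibP[t tk] : k \in fst @: G by rewrite pG.
    have st : s * t \in fib G' (h * k) by apply: fib_mul; rewrite -?eh -?ek.
    by rewrite (fib_lcoset (fib_mul sh tk)) eqN -(fib_lcoset st).
  suff : <<X>> \subset Group gH by rewrite genX.
  by rewrite gen_subG; apply/subsetP=> x xX; rewrite inE -genX mem_gen //= eqX.
apply/subsetP=> -[h s] hs; have := subsetP sG1 h; rewrite -pG.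
have -> : h \in fst @: G by apply/imsetP; exists (h, s).
move/(_ isT); rewrite inE => /andP[_ /eqP/setP/(_ s)].
by rewrite !inE hs => <-.
Qed.

(* G in F is known from the fibres over [frank p G1] generators of G1, and each
   fibre is a coset of N inside a fixed coset of M. *)
Lemma card_over p (G1 : {group gT}) (N M : {group sT}) (F : {set {group gT * sT}}) :
  prime p -> p.-group G1 -> N \subset M ->
  (forall G, G \in F -> fst @: G = G1 /\ fib G 1 = N) ->
  (forall G G' h s s', G \in F -> G' \in F -> h \in G1 ->
     s \in fib G h -> s' \in fib G' h -> s^-1 * s' \in M) ->
  #|F| <= #|M : N| ^ frank p G1.
Proof.
move=> pr pG1 sNM FP coh; have [->|[G0 G0F]] := set_0Vmem F; first by rewrite cards0.
have [X genX cardX] := frank_gen pr pG1.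
(* Dividing by elements of the fibres of one member [G0] moves all the fibres into M, where they are
   cosets of N. *)
pose code (G : {group gT * sT}) := [ffun h => if h \in X then (repr (fib G0 h))^-1 *: fib G h else set0].
apply: (@leq_trans #|[set f : {ffun gT -> {set sT}} | f \in pffun_on set0 X (lcosets N M)]|).
  apply: (@leq_card_in _ _ _ _ code) => [G G' GF G'F eq_code | G GF].
    have [[pG nG] [pG' nG']] := (FP G GF, FP G' G'F).
    apply: (eq_fib_gen pG pG' genX); first by rewrite nG nG'.
    by move=> x xX; have /ffunP/(_ x) := eq_code; rewrite !ffunE xX => /lcoset_inj.
  have [pG nG] := FP G GF; rewrite inE; apply/pffun_onP; split=> [|y].
    by apply/supportP=> x xX; rewrite ffunE (negPf xX).
  case/imageP=> h hX ->; rewrite ffunE; move: hX; rewrite -topredE /= => hX; rewrite hX.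
  have hG1 : h \in G1 by rewrite -genX mem_gen.
  have /fibP[s sh] : h \in fst @: G by rewrite pG.
  have /fibP[s0 s0h] : h \in fst @: G0 by rewrite (FP _ G0F).1.
  have r0 : repr (fib G0 h) \in fib G0 h by exact: mem_repr s0h.
  rewrite (fib_lcoset sh) nG -lcosetM; apply/lcosetsP.
  by exists ((repr (fib G0 h))^-1 * s) => //; apply: (coh G0 G h).
rewrite cardsE card_pffun_on card_lcosets.
case: (posnP #|M : N|) => [i0|i0]; first by have := indexg_gt0 M N; rewrite i0.
by rewrite leq_pexp2l.
Qed.

End Fibers.

Definition psubs (p : nat) (gT : finGroupType) (H : {set gT}) : {set {group gT}} :=
  [set G : {group gT} | p.-group G && (G \subset H)].

Lemma sum_card_fibers (T1 T2 : finType) (A : {set T1}) (B : {set T2}) (f : T1 -> T2) :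
  \sum_(y in B) #|[set x in A | f x == y]| <= #|A|.
Proof.
apply: (@leq_trans #|[set x in A | f x \in B]|).
  rewrite -[X in _ <= X]sum1_card (partition_big f (mem B)) => [|x]; last by rewrite inE => /andP[].
  apply/eq_leq/eq_bigr => y yB; rewrite -sum1_card; apply: eq_bigl => x; rewrite !inE.
  by case: eqP => [->|]; rewrite ?andbF // [y \in B]yB !andbT.
by apply/subset_leq_card/subsetP=> x; rewrite inE => /andP[].
Qed.

Lemma abelem_quo_rV p (gT : finGroupType) (G N : {group gT}) :
  prime p -> N <| G -> p.-abelem (G / N) ->
  exists r : gT -> 'rV['F_p]_(logn p #|G : N|),
    [/\ {in G &, {morph r : x y / x * y >-> (x + y)%R}},
        forall v, exists2 g, g \in G & r g = v & {in N, forall x, r x = 0%R}].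
Proof.
move=> pr nsN abG; have nNG := normal_norm nsN.
have cQ : #|G / N| = (p ^ logn p #|G : N|)%N.
  have /p_natP[m cm] := abelem_pgroup abG.
  by rewrite -card_quotient // cm pfactorK.
have [triv|ntriv] := eqVneq (G / N) 1.
  have -> : logn p #|G : N| = 0 by rewrite -card_quotient // triv cards1 logn1.
  exists (fun=> 0%R); split=> [x y _ _|v|//]; first by rewrite GRing.addr0.
  by exists 1; rewrite ?group1 // thinmx0.
have dimE : 'dim (G / N) = logn p #|G : N|.
  by rewrite (dim_abelemE abG ntriv) cQ pfactorK.
pose r g := abelem_rV abG ntriv (coset N g).
have rM : {in G &, {morph r : x y / x * y >-> (x + y)%R}}.
  move=> x y xG yG; rewrite /r morphM ?(subsetP nNG) //.
  by rewrite abelem_rV_M ?mem_quotient.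
have rS v : exists2 g, g \in G & r g = v.
  have := mem_im_abelem_rV abG ntriv v => /morphimP[_ _ /morphimP[g gN gG ->] ->].
  by exists g.
have r0 : {in N, forall x, r x = 0%R}.
  by move=> x xN; rewrite /r coset_id // abelem_rV_1.
by case: _ / dimE; exists r.
Qed.

(* The graphs of the [p ^ (i * frank p G)] homomorphisms from G to an
   elementary abelian group of rank i are p-subgroups of the product lying over
   G. *)
Lemma psubs_moment p i (gT : finGroupType) (H : {group gT}) : prime p ->
  \sum_(G in psubs p H) p ^ (i * frank p G) <=
    #|psubs p (setX H [set: 'rV['F_p]_i])|.
Proof.
move=> pr; pose f (K : {group gT * 'rV['F_p]_i}) := generated_group (fst @: K).
apply: leq_trans (sum_card_fibers _ (psubs p H) f); apply: leq_sum => G.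
rewrite inE => /andP[pG sGH]; have [r [rM rS _]] := abelem_quo_rV pr (Phi_normal G) (Phi_quotient_abelem pG).
pose gr (M : 'M['F_p]_(frank p G, i)) := [set (g, (r g *m M)%R) | g in G].
have grG M : group_set (gr M).
  apply/group_setP; split=> [|_ _ /imsetP[g gG ->] /imsetP[h hG ->]].
    have r1 : r 1 = 0%R.
      have := rM 1 1 (group1 G) (group1 G); rewrite mulg1 => /eqP.
      by rewrite -{1}(GRing.addr0 (r 1)) (inj_eq (GRing.addrI _)) eq_sym => /eqP.
    by apply/imsetP; exists 1; rewrite ?group1 // r1 mul0mx.
  by apply/imsetP; exists (g * h); rewrite ?groupM // rM // mulmxDl.
pose K M := Group (grG M).
have fK M : fst @: gr M = G.
  rewrite /gr -imset_comp; apply/setP=> g; apply/imsetP/idP => [[h hG ->] //|gG]; by exists g.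
have injK : injective K.
  move=> M M' /(congr1 val) /= eqM; apply/row_matrixP=> j.
  have [g gG rg] := rS (delta_mx 0%R j).
  have : (g, (r g *m M)%R) \in gr M' by rewrite -eqM; apply/imsetP; exists g.
  by case/imsetP=> h hG [<-]; rewrite rg -!rowE.
have -> : (p ^ (i * frank p G))%N = #|[set K M | M in [set: 'M['F_p]_(frank p G, i)]]|.
  by rewrite card_imset // cardsT card_mx card_Fp // mulnC.
apply/subset_leq_card/subsetP=> _ /imsetP[M _ ->]; rewrite !inE; apply/andP; split; last first.
  by apply/eqP/val_inj; rewrite /= fK genGid.
apply/andP; split.
  have -> : K M = gr M :> {set _} by [].
  by rewrite /pgroup card_imset => [|x y []].
by apply/subsetP=> _ /imsetP[g gG ->]; rewrite !inE (subsetP sGH).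
Qed.

(** * Fibre counts over an imprimitive p-group *)

Section Top.
Variables (p : nat) (sT : finGroupType).
Implicit Types Q N K M S : {group sT}.

(* In a transitive p-group Q of degree > 1, take for Q0 the stabiliser of one
   of p blocks and for K the pointwise stabiliser of this block. *)
Definition imprimitive_top (t : nat) (Q Q0 K : {set sT}) : Prop :=
  [/\ p.-group Q, Q0 \subset Q /\ #|Q : Q0| = p, K \subset Q0 /\ Q0 \subset 'N(K),
      gcore K Q = 1 & #|Q0 : K| <= p ^ t].

Variables (t : nat) (Q Q0 K N : {group sT}).
Hypotheses (pr : prime p) (top : imprimitive_top t Q Q0 K) (nsNQ : N <| Q).

Let pQ : p.-group Q. Proof. by case: top. Qed.
Let sQ0Q : Q0 \subset Q. Proof. by case: top => _ []. Qed.
Let iQ0 : #|Q : Q0| = p. Proof. by case: top => _ []. Qed.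
Let sKQ0 : K \subset Q0. Proof. by case: top => _ _ []. Qed.
Let nKQ0 : Q0 \subset 'N(K). Proof. by case: top => _ _ []. Qed.
Let coreK : gcore K Q = 1. Proof. by case: top. Qed.
Let iK : #|Q0 : K| <= p ^ t. Proof. by case: top. Qed.
Let nQ0 : Q0 <| Q. Proof. exact: index_p_normal pr pQ sQ0Q iQ0. Qed.
Let sNQ : N \subset Q. Proof. exact: normal_sub nsNQ. Qed.
Let nNQ : Q \subset 'N(N). Proof. exact: normal_norm nsNQ. Qed.

Lemma top_split n x : n \in Q -> n \notin Q0 -> x \in Q ->
  exists2 k : 'I_p, x * n ^- k \in Q0 & x = (x * n ^- k) * n ^+ k.
Proof.
move=> nQ nQ0' xQ; have [k] := index_p_rcoset pr pQ sQ0Q iQ0 nQ nQ0' xQ.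
by rewrite mem_rcoset => xk; exists k; rewrite ?mulgKV.
Qed.

(** Q0 normalises K and the powers of n represent Q / Q0, so these p conjugates of K are all of
    them, and they meet in the trivial core. *)
Lemma top_mem_core n (q : sT) : n \in Q -> n \notin Q0 ->
  (forall k, k < p -> q \in K :^ (n ^+ k)) -> q = 1.
Proof.
move=> nQ nQ0' qK; apply/set1gP; rewrite -coreK; apply/bigcapP=> x xQ.
have [k xk ->] := top_split nQ nQ0' xQ.
by rewrite conjsgM (normsP nKQ0) // qK.
Qed.

(* For n in N outside Q0 the commutators with n lie in N, and ['C_Q0[n]] meets
   K trivially since n permutes the conjugates of K transitively. *)
Lemma top_index_large : ~~ (N \subset Q0) -> #|Q : N| <= p ^ t.
Proof.
case/subsetPn=> n nN nQ0'; have nQ := subsetP sNQ n nN.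
have CK : 'C_Q0[n] :&: K = 1.
  apply/trivgP/subsetP=> q /setIP[/setIP[qQ0 /cent1P nq] qK]; apply/set1gP.
  apply: (top_mem_core nQ nQ0') => k _; rewrite mem_conjg.
  suff -> : q ^ (n ^+ k)^-1 = q by [].
  by apply/conjg_fixP/commgP; apply/commuteV/commuteX.
have cC : #|'C_Q0[n]| <= p ^ t.
  apply: leq_trans iK; rewrite -(@leq_pmul2r #|K|) ?cardG_gt0 //.
  rewrite mul_cardG CK cards1 muln1 [X in _ <= X]mulnC Lagrange //.
  by apply: subset_leq_card; rewrite mul_subG // subsetIl.
have cN : #|Q0| <= #|N :&: Q0| * #|'C_Q0[n]|.
  rewrite -(Lagrange (subsetIl Q0 'C[n])) mulnC leq_pmul2r ?cardG_gt0 //.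
  rewrite index_cent1 -(card_lcoset _ n^-1); apply/subset_leq_card/subsetP=> x.
  rewrite mem_lcoset invgK => /imsetP[q qQ0 defx].
  have -> : x = [~ n, q] by rewrite commgEl -defx mulKg.
  have qQ := subsetP sQ0Q q qQ0; rewrite inE; apply/andP; split.
    by rewrite commgEl groupM ?groupV // memJ_norm // (subsetP nNQ).
  by rewrite commgEr groupM ?groupV ?memJ_norm ?groupV // (subsetP (normal_norm nQ0)) ?groupV.
have iNQ0 : p <= #|N : N :&: Q0|.
  have := dvdn_indexg N (N :&: Q0).
  have pN : p.-group N := pgroupS sNQ pQ.
  have /p_natP[m im] : p.-nat #|N : N :&: Q0| by apply: pnat_dvd pN; apply: dvdn_indexg.
  rewrite im => _; case: m im => [/eqP|m _]; last by rewrite expnS leq_pmulr ?expn_gt0 ?prime_gt0.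
  by rewrite indexg_eq1 => /subsetP/(_ n nN); rewrite inE (negPf nQ0') andbF.
rewrite -(@leq_pmul2l #|N|) ?cardG_gt0 // Lagrange // -(Lagrange sQ0Q) iQ0.
rewrite -(Lagrange (subsetIl N Q0)) -mulnA (mulnC _ p).
apply: (@leq_trans (p * (#|N :&: Q0| * p ^ t))).
  by rewrite leq_pmul2l ?prime_gt0 // (leq_trans cN) // leq_pmul2l ?cardG_gt0.
by rewrite mulnCA leq_pmul2l ?cardG_gt0 // leq_mul2r iNQ0 orbT.
Qed.

Hypothesis sNQ0 : N \subset Q0.

Let NKE : N <*> K = N * K.
Proof. by rewrite norm_joinEr // (subset_trans sKQ0) // (subset_trans sQ0Q). Qed.

Let M : {group sT} := gcore_group (N <*> K) Q.

(** M lies in every conjugate of [N <*> K], so intersecting it in turn with the p conjugates of K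
    loses at most a factor v each time and ends at 1. Thus |M| <= v^p, while |N| >= v. *)
Lemma top_core_index n : n \in Q -> n \notin Q0 ->
  #|M : N| <= #|N <*> K : K| ^ p.-1.
Proof.
move=> nQ nQ0'; set v := #|N <*> K : K|.
have sNM : N \subset M by rewrite sub_gcore // joing_subl.
have v0 : 0 < v by exact: indexg_gt0.
have cNK : #|N <*> K| = (v * #|K|)%N by rewrite mulnC Lagrange // joing_subr.
have Aj j : exists2 A : {group sT}, #|M| <= v ^ j * #|A| &
    A \subset M /\ forall k, k < j -> A \subset K :^ (n ^+ k).
  elim: j => [|j [A cA [sAM AK]]]; first by exists M; rewrite ?mul1n.
  exists (A :&: K :^ (n ^+ j))%G; last first.
    split=> [|k]; first by rewrite subIset ?sAM.
    rewrite ltnS leq_eqVlt => /predU1P[->|kj]; first exact: subsetIr.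
    by rewrite subIset ?AK.
  apply: (leq_trans cA); rewrite expnSr -mulnA leq_pmul2l ?expn_gt0 ?v0 //=.
  rewrite -(@leq_pmul2r #|K|) ?cardG_gt0 // -{1}(cardJg K (n ^+ j)).
  rewrite mul_cardG mulnAC -cNK leq_mul2r; apply/orP; right.
  rewrite -(cardJg (N <*> K) (n ^+ j)); apply: subset_leq_card.
  rewrite mul_subG //= ?conjSg ?joing_subr //.
  by apply: (subset_trans sAM); apply: (bigcap_inf (n ^+ j)); rewrite groupX.
have [A cA [_ AK]] := Aj p.
have A1 : A :=: 1.
  apply/trivgP/subsetP=> a aA; apply/set1gP; apply: (top_mem_core nQ nQ0') => k kp.
  exact: subsetP (AK k kp) a aA.
rewrite A1 cards1 muln1 in cA.
rewrite -(@leq_pmul2l #|N|) ?cardG_gt0 // Lagrange // (leq_trans cA) //.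
rewrite -[in X in X <= _](prednK (prime_gt0 pr)) expnS leq_mul2r; apply/orP; right.
rewrite -(@leq_pmul2r #|K|) ?cardG_gt0 // -cNK NKE mul_cardG.
by rewrite leq_pmulr ?cardG_gt0.
Qed.

Variables (gT : finGroupType) (G1 B : {group gT}).
Hypotheses (pG1 : p.-group G1) (sBG1 : B \subset G1) (iB : #|G1 : B| = p).

Let F : {set {group gT * sT}} :=
  [set G : {group gT * sT} | [&& fst @: G == G1, snd @: G == Q, fib G 1 == N
     & [set h in G1 | fib G h \subset Q0] == B]].

Let FP G : G \in F -> [/\ fst @: G = G1, snd @: G = Q, fib G 1 = N
     & forall h, h \in G1 -> (fib G h \subset Q0) = (h \in B)].
Proof.
rewrite inE => /and4P[/eqP-> /eqP-> /eqP-> /eqP defB]; split=> // h hG1.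
by rewrite -defB inE hG1.
Qed.

Lemma fib_mulg (G : {group gT * sT}) h k : fst @: G = G1 -> h \in G1 -> k \in G1 ->
  fib G (h * k) = fib G h * fib G k.
Proof.
move=> pG hG kG; have /fibP[s sh] : h \in fst @: G by rewrite pG.
have /fibP[r rk] : k \in fst @: G by rewrite pG.
apply/eqP; rewrite eqEsubset; apply/andP; split; apply/subsetP=> x.
  move=> xhk; apply/mulsgP; exists s (s^-1 * x) => //; last by rewrite mulKVg.
  by rewrite -(mulKg h k) fib_mul ?fib_inv.
by case/mulsgP=> a b ah bk ->; exact: fib_mul.
Qed.

(** Groups with the same fibre over x0 share a pair (x0, sg) with sg outside Q0. Conjugation by its
    powers turns agreement modulo [N <*> K] over B into agreement modulo all conjugates of
    [N <*> K], that is, modulo the core M. *)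
Lemma card_top_family x0 X (Sg : {set sT}) : x0 \in G1 -> x0 \notin B -> <<X>> = B ->
  #|[set G in F | fib G x0 == Sg]| <=
    #|Q0 : N <*> K| ^ #|X| * (#|N <*> K : K| ^ p.-1) ^ frank p G1.
Proof.
move=> x0G x0B genX; set FS := [set G in F | _].
have sXB : X \subset B by rewrite -genX subset_gen.
have [->|[Gs]] := set_0Vmem FS; first by rewrite cards0.
case/setIdP=> GsF /eqP GsS.
have sgP s : s \in Sg -> s \in Q /\ s \notin Q0.
  rewrite -GsS => sx; have [pG qG nG bG] := FP GsF; split.
    by apply: subsetP sx; apply: fib_sub; rewrite qG.
  apply: contra x0B => sQ0; rewrite -(bG _ x0G) (fib_lcoset sx) nG.
  apply/subsetP=> y /lcosetP[z zN ->]; by rewrite groupM // (subsetP sNQ0).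
have [sg sgS] : exists sg, sg \in Sg.
  have [pG _ _ _] := FP GsF; rewrite -GsS.
  by apply/fibP; rewrite pG.
have [sgQ sgQ0] := sgP sg sgS.
pose code (G : {group gT * sT}) := [ffun x => if x \in X then fib G x * K else set0].
have cohB G G' : G \in FS -> G' \in FS -> code G = code G' ->
    {in B, forall b, fib G b * K = fib G' b * K}.
  case/setIdP=> GF _ /setIdP[G'F _] eq_code.
  have [[pG qG nG bG] [pG' qG' nG' bG']] := (FP GF, FP G'F).
  have nK H (HF : H \in F) b : b \in B -> commute (fib H b) K.
    move=> bB; apply: normC; apply: subset_trans nKQ0.
    by have [_ _ _ bH] := FP HF; rewrite bH ?(subsetP sBG1).
  pose C := [set b in B | fib G b * K == fib G' b * K].
  have gC : group_set C.
    apply/group_setP; split=> [|b c]; first by rewrite inE group1 nG nG' eqxx.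
    rewrite !inE => /andP[bB /eqP eb] /andP[cB /eqP ec]; rewrite groupM //=; apply/eqP.
    have [bG1 cG1] := (subsetP sBG1 b bB, subsetP sBG1 c cB).
    rewrite !fib_mulg // -mulgA ec (nK _ G'F) // mulgA eb -!mulgA.
    by rewrite (nK _ G'F).
  have sub : <<X>> \subset Group gC.
    rewrite gen_subG; apply/subsetP=> x xX; rewrite inE (subsetP sXB) //=.
    by have /ffunP/(_ x) := eq_code; rewrite !ffunE xX => ->.
  by move=> b bB; rewrite genX in sub; have := subsetP sub b bB; rewrite inE => /andP[_ /eqP].
have nMQ : Q \subset 'N(M) by exact: gcore_norm.
apply: leq_trans (card_le_imset_fibers (f := code) (k := (#|N <*> K : K| ^ p.-1) ^ frank p G1) _) _.
  move=> y _; set FSy := [set G in FS | _].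
  apply: leq_trans (_ : #|M : N| ^ frank p G1 <= _); last by rewrite leq_expn2l ?(top_core_index sgQ sgQ0).
  have sNM : N \subset M by rewrite sub_gcore // joing_subl.
  apply: (card_over pr pG1 sNM) => [G|G G' h s s'].
    by case/setIdP=> /setIdP[/FP[-> _ -> _] _] _.
  case/setIdP=> GFS /eqP cG /setIdP[G'FS /eqP cG'] hG1 sh s'h.
  have eqB : {in B, forall b, fib G b * K = fib G' b * K}.
    by apply: cohB; rewrite // cG cG'.
  have [/setIdP[GF /eqP GS] /setIdP[G'F /eqP G'S]] := (GFS, G'FS).
  have [[pG qG nG bG] [pG' qG' nG' bG']] := (FP GF, FP G'F).
  have sgG : sg \in fib G x0 by rewrite GS.
  have sgG' : sg \in fib G' x0 by rewrite G'S.
  have cohM b u u' : b \in B -> u \in fib G b -> u' \in fib G' b -> u^-1 * u' \in M.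
    move=> bB uG uG'; apply/bigcapP=> x xQ; have [k xk ->] := top_split sgQ sgQ0 xQ.
    have nNKQ0 : Q0 \subset 'N(N <*> K) by rewrite normsY // (subset_trans sQ0Q).
    rewrite conjsgM (normsP nNKQ0) // mem_conjg conjMg conjVg.
    have cB : b ^ (x0 ^+ k)^-1 \in B.
      by rewrite memJ_norm // groupV groupX // (subsetP (normal_norm (index_p_normal pr pG1 sBG1 iB))).
    set c := b ^ _ in cB; set w := u ^ _; set w' := u' ^ _.
    have wG : w \in fib G c by rewrite fib_conj // fib_inv // fib_exp.
    have : w' \in fib G' c * K.
      by rewrite -[w']mulg1 mem_mulg // fib_conj // fib_inv // fib_exp.
    rewrite -eqB // => /mulsgP[z r zG rK ->]; rewrite mulgA NKE mem_mulg //.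
    by rewrite -nG (fib_ldiv _ wG).
  (* A power of x0 moves h into B, and the same power of sg moves the fibres along. *)
  have [k] := index_p_rcoset pr pG1 sBG1 iB x0G x0B hG1; rewrite mem_rcoset => bB.
  have H1 : s * sg ^- k \in fib G (h * x0 ^- k) by rewrite fib_mul ?fib_inv ?fib_exp.
  have H2 : s' * sg ^- k \in fib G' (h * x0 ^- k) by rewrite fib_mul ?fib_inv ?fib_exp.
  have := cohM _ _ _ bB H1 H2.
  have -> : (s * sg ^- k)^-1 * (s' * sg ^- k) = (s^-1 * s') ^ (sg ^- k).
    by rewrite conjgE invMg !invgK !mulgA.
  by rewrite memJ_norm // groupV groupX // (subsetP nMQ).
apply: leq_mul => //.
apply: (@leq_trans #|[set f : {ffun gT -> {set sT}} | f \in pffun_on set0 X (lcosets (N <*> K) Q0)]|); last first.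
  by rewrite cardsE card_pffun_on card_lcosets.
apply/subset_leq_card/subsetP=> _ /imsetP[G GFS ->]; rewrite inE.
case/setIdP: GFS => GF _; have [pG qG nG bG] := FP GF.
apply/pffun_onP; split=> [|y]; first by apply/supportP=> x xX; rewrite ffunE (negPf xX).
case/imageP=> h hX ->; rewrite ffunE; move: hX; rewrite -topredE /= => hX; rewrite hX.
have hB := subsetP sXB h hX; have hG1 := subsetP sBG1 h hB.
have /fibP[s sh] : h \in fst @: G by rewrite pG.
apply/lcosetsP; exists s; first by apply: subsetP sh; rewrite bG.
by rewrite (fib_lcoset sh) nG NKE mulgA.
Qed.
End Top.

Lemma card_bigcup_le (T I : finType) (P : pred I) (A : {set T}) (F : I -> {set T}) :
  (forall x, x \in A -> exists2 i, P i & x \in F i) -> #|A| <= \sum_(i | P i) #|F i|.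
Proof.
move=> cov; apply: (@leq_trans #|\bigcup_(i | P i) F i|).
  by apply/subset_leq_card/subsetP=> x /cov[i Pi xF]; apply/bigcupP; exists i.
elim/big_rec2: _ => [|i n U _ IH]; first by rewrite cards0.
by rewrite (leq_trans (leq_card_setU _ _)) // leq_add2l.
Qed.

Lemma card_subgroups_le (sT : finGroupType) (S : {set sT}) :
  #|[set N : {group sT} | N \subset S]| <= 2 ^ #|S|.
Proof.
rewrite -card_powerset; apply: (@leq_card_in _ _ _ _ (fun N : {group sT} => N : {set sT})) => [N M _ _ /val_inj //|N].
by rewrite !inE.
Qed.

Section Step.
Variables (p : nat) (gT sT : finGroupType).
Hypothesis pr : prime p.
Implicit Type G : {group gT * sT}.

Lemma card_snd G : #|G| = (#|snd @: G| * #|[set h | (h, 1%g) \in G]|)%N.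
Proof.
pose sw (x : gT * sT) := (x.2, x.1).
have gG : group_set (sw @: G).
  apply/group_setP; split=> [|_ _ /imsetP[x xG ->] /imsetP[y yG ->]].
    by apply/imsetP; exists 1; rewrite ?group1.
  by apply/imsetP; exists (x * y); rewrite ?groupM.
have := card_fst (Group gG); rewrite /= card_imset => [->|[x y] [u v] [-> ->] //].
congr (_ * _)%N; last first.
  apply: eq_card => h; rewrite !inE; apply/imsetP/idP => [[[x y] xG [-> ->]] // | hG].
  by exists (h, 1).
by rewrite -imset_comp.
Qed.

Lemma fib_normal G (Q : {group sT}) : snd @: G = Q -> fib_group G <| Q.
Proof.
move=> qG; apply/andP; split.
  by apply: (fib_sub (Q := Q)); rewrite qG.
apply/normsP=> x; rewrite -qG => /imsetP[[h q] /= hq ->].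
apply/eqP; rewrite eqEcard cardJg leqnn andbT; apply/subsetP=> _ /imsetP[s sN ->].
have hq' : q \in fib G h by rewrite inE.
by rewrite -(conj1g h) fib_conj.
Qed.

(** The preimage L of Q0 in G has index |Q : Q0|. The kernel N of the first projection lies in L, so
    the projections of G and L to the first factor have the same index. *)
Lemma fib_preim_index G (G1 : {group gT}) (Q Q0 N : {group sT}) :
  fst @: G = G1 -> snd @: G = Q -> fib G 1 = N -> N \subset Q0 -> Q0 <| Q ->
  exists B : {group gT}, [/\ B \subset G1, #|G1 : B| = #|Q : Q0| & [set h in G1 | fib G h \subset Q0] = B].
Proof.
move=> pG qG nG sNQ0 nQ0.
pose L := [set g in G | g.2 \in Q0].
have gL : group_set L.
  apply/group_setP; split=> [|x y]; rewrite !inE ?group1 //.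
  by case/andP=> xG xQ /andP[yG yQ]; rewrite !groupM.
have fibL h : h \in G1 -> (fib G h \subset Q0) = (h \in fst @: L).
  rewrite -pG => /fibP[s sh]; apply/idP/imsetP=> [sub|[[k t]]].
    by exists (h, s) => //; move: (sh) (subsetP sub s sh); rewrite !inE /= => -> ->.
  rewrite inE /= => /andP[kt tQ0] hk.
  have th : t \in fib G h by rewrite inE hk.
  rewrite (fib_lcoset th) nG; apply/subsetP=> _ /lcosetP[n nN ->].
  by rewrite groupM // (subsetP sNQ0).
have sLG : L \subset G by apply/subsetP=> x; rewrite inE => /andP[].
have gB : group_set (fst @: L).
  apply/group_setP; split=> [|_ _ /imsetP[x xG ->] /imsetP[y yG ->]].
    by apply/imsetP; exists 1; rewrite // (group1 (Group gL)).
  by apply/imsetP; exists (x * y); rewrite // (groupM (_ : x \in Group gL)).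
have sB : Group gB \subset G1 by rewrite -pG imsetS.
exists (Group gB); split=> //; last first.
  apply/setP=> h; rewrite inE; apply/andP/idP => [[hG1]|hB]; first by rewrite fibL.
  by have hG1 := subsetP sB h hB; rewrite fibL.
have sLQ : snd @: L = Q0.
  apply/setP=> q; apply/imsetP/idP => [[x]|qQ0]; first by rewrite inE => /andP[_ ?] ->.
  have : q \in snd @: G by rewrite qG (subsetP (normal_sub nQ0)).
  by case/imsetP=> x xG dq; exists x; rewrite // inE xG -dq.
have c1 := card_snd G; have c2 := card_snd (Group gL).
have c3 := card_fst G; have c4 := card_fst (Group gL).
rewrite /= in c2 c4; rewrite qG in c1; rewrite sLQ in c2; rewrite pG nG in c3.
have e1 : [set h | (h, 1) \in L] = [set h | (h, 1) \in G].
  by apply/setP=> h; rewrite !inE /= group1 andbT.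
have e2 : fib L 1 = N.
  rewrite -nG; apply/setP=> s; rewrite !inE /=; case: (boolP (_ \in _)) => //= s1.
  by rewrite (subsetP sNQ0) // -nG inE.
rewrite e1 in c2; rewrite e2 in c4.
set m := #|[set h | _]| in c1 c2; have m0 : 0 < m by rewrite lt0n; apply: contraTneq (cardG_gt0 G) => m0; rewrite c1 m0 muln0.
have := Lagrange sB; have := Lagrange (normal_sub nQ0); rewrite /=.
set i := #|Q : Q0|; set j := #|G1 : _| => l1 l2.
apply/eqP; rewrite -(@eqn_pmul2l (#|fst @: L| * #|N|)) ?muln_gt0 ?cardG_gt0 ?(cardG_gt0 (Group gB)) //.
by rewrite mulnAC l2 -c3 c1 -l1 mulnAC -c2 c4.
Qed.

(* Either N is not inside Q0 and then has index at most [p ^ t] in Q, or the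
   elements of G1 whose fibre is in Q0 form a subgroup B of index p. In the
   second case the fibres are determined first modulo K, over generators of B,
   and then modulo the core, over generators of G1. *)
Lemma card_step_fixed t (S Q N : {group sT}) (G1 : {group gT}) :
  p.-group G1 -> Q \subset S -> (exists Q0 K : {group sT}, imprimitive_top p t Q Q0 K) ->
  #|[set G : {group gT * sT} | [&& fst @: G == G1, snd @: G == Q & fib G 1 == N]]| <=
   2 ^ #|S| * (p ^ (t * frank p G1) +
     \sum_(B : {group gT} | (B \subset G1) && (#|G1 : B| == p))
        p ^ (t * maxn (p.-1 * frank p G1) (frank p B))).
Proof.
move=> pG1 sQS [Q0 [K top]]; set F := [set G | _].
have [->|[Gs]] := set_0Vmem F; first by rewrite cards0.
rewrite inE => /and3P[_ /eqP qGs /eqP nGs].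
have nsNQ : N <| Q.
  have := fib_normal qGs; have -> // : fib_group Gs = N by apply/val_inj.
have [pQ [sQ0Q iQ0] [sKQ0 nKQ0] coreK iK] := top.
have [sNQ0|nNQ0] := boolP (N \subset Q0); last first.
  apply: (@leq_trans (p ^ (t * frank p G1))); last first.
    by rewrite (leq_trans _ (leq_pmull _ _)) ?leq_addr ?expn_gt0.
  apply: (@leq_trans (#|Q : N| ^ frank p G1)); last first.
    by rewrite expnM leq_expn2l // (top_index_large pr top).
  apply: (card_over pr pG1 (normal_sub nsNQ)) => [G|G G' h s s'].
    by rewrite inE => /and3P[/eqP-> _ /eqP->].
  rewrite !inE => /and3P[_ /eqP qG _] /and3P[_ /eqP qG' _] _ sh s'h.
  have sQ : s \in Q by rewrite -qG; apply/imsetP; exists (h, s).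
  have s'Q : s' \in Q by rewrite -qG'; apply/imsetP; exists (h, s').
  by rewrite groupM ?groupV.
suff : #|F| <= 2 ^ #|S| * \sum_(B : {group gT} | (B \subset G1) && (#|G1 : B| == p))
      p ^ (t * maxn (p.-1 * frank p G1) (frank p B)).
  by move/leq_trans; apply; rewrite leq_mul2l leq_addl orbT.
rewrite big_distrr /=.
pose FB (B : {group gT}) := [set G in F | [set h in G1 | fib G h \subset Q0] == B].
apply: (@leq_trans (\sum_(B : {group gT} | (B \subset G1) && (#|G1 : B| == p)) #|FB B|)).
  apply: card_bigcup_le => G GF; have := GF; rewrite inE => /and3P[/eqP pG /eqP qG /eqP nG].
  have [B [sB iB eB]] := fib_preim_index pG qG nG sNQ0 (index_p_normal pr pQ sQ0Q iQ0).
  by exists B; rewrite ?sB ?iB ?iQ0 ?eqxx // inE GF eB /=.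
apply: leq_sum => B /andP[sBG1 /eqP iB].
have pB : p.-group B := pgroupS sBG1 pG1.
have [X genX cX] := frank_gen pr pB.
have [x0 x0G x0B] : exists2 x, x \in G1 & x \notin B.
  by apply/subsetPn; rewrite -indexg_eq1 iB; case: p pr => [|[]].
(* The fibre over x0 is picked blindly among the subsets of Q, at the price of a factor 2^|S|. *)
apply: (@leq_trans (\sum_(Sg in powerset Q) #|[set G in FB B | fib G x0 == Sg]|)).
  apply: card_bigcup_le => G GFB; exists (fib G x0); last by rewrite inE GFB eqxx.
  rewrite inE; apply: fib_sub; have := GFB.
  by case/setIdP; rewrite inE => /and3P[_ /eqP-> _] _.
apply: (@leq_trans (\sum_(Sg in powerset Q) p ^ (t * maxn (p.-1 * frank p G1) (frank p B)))); last first.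
  by rewrite sum_nat_const card_powerset leq_mul2r leq_pexp2l ?orbT // subset_leq_card.
apply: leq_sum => Sg _.
have := card_top_family pr top nsNQ sNQ0 pG1 sBG1 iB Sg x0G x0B genX.
move=> H; apply: leq_trans (leq_trans _ H) _.
  apply/subset_leq_card/subsetP=> G /setIdP[/setIdP[GF eB] eS]; apply/setIdP; split=> //.
  by move: GF; rewrite !inE eB andbT.
(* u v <= |Q0 : K| <= p^t, and the exponents of u and v, the rank of B and p - 1 times the rank of
   G1, are both at most the maximum. *)
set u := #|Q0 : N <*> K|; set v := #|N <*> K : K|; set mx := maxn _ _.
have uv : u * v <= p ^ t.
  apply: leq_trans iK; rewrite -(@leq_pmul2l #|K|) ?cardG_gt0 // Lagrange // mulnCA.
  rewrite Lagrange ?joing_subr // mulnC Lagrange // join_subG sNQ0 //.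
have u0 : 0 < u by exact: indexg_gt0.
have v0 : 0 < v by exact: indexg_gt0.
apply: (@leq_trans (u ^ mx * v ^ mx)); last by rewrite -expnMn expnM leq_expn2l.
rewrite -expnM leq_mul // leq_pexp2l //; last by rewrite leq_max leqnn.
exact: leq_trans cX (leq_maxr _ _).
Qed.

(** Q, the kernel N and the fibre over one element outside B are chosen among subsets of S, whence
    the 3 in the exponent. The factor is a constant as long as the split-off orbit has bounded
    size. *)
Lemma card_step t (S : {group sT}) (QS : {set {group sT}}) (G1 : {group gT}) :
  p.-group G1 ->
  (forall Q : {group sT}, Q \in QS -> Q \subset S /\ exists Q0 K : {group sT}, imprimitive_top p t Q Q0 K) ->
  #|[set G : {group gT * sT} | (fst @: G == G1) && [exists Q in QS, snd @: G == Q]]| <=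
   2 ^ (3 * #|S|) * (p ^ (t * frank p G1) +
     \sum_(B : {group gT} | (B \subset G1) && (#|G1 : B| == p))
        p ^ (t * maxn (p.-1 * frank p G1) (frank p B))).
Proof.
move=> pG1 QSP; set W := (_ + _)%N.
apply: (@leq_trans (\sum_(Q in QS) \sum_(N : {group sT} | N \subset S)
   #|[set G : {group gT * sT} | [&& fst @: G == G1, snd @: G == Q & fib G 1 == N]]|)).
  rewrite pair_big_dep; apply: card_bigcup_le => G; rewrite inE => /andP[pG /existsP[Q /andP[QQS qG]]].
  exists (Q, fib_group G); last by rewrite inE pG qG eqxx.
  rewrite /= QQS; apply: (fib_sub (Q := S)); rewrite (eqP qG); exact: (QSP Q QQS).1.
apply: (@leq_trans (\sum_(Q in QS) \sum_(N : {group sT} | N \subset S) 2 ^ #|S| * W)).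
  apply: leq_sum => Q QQS; apply: leq_sum => N _; have [sQS topQ] := QSP Q QQS.
  exact: card_step_fixed.
rewrite !sum_nat_const mulnA -mulnA (mulnA _ _ W) mulnA leq_mul2r; apply/orP; right.
rewrite -[3]/(1 + (1 + 1))%N !mulnDl !mul1n !expnD; apply: leq_mul; last apply: leq_mul => //.
  apply: leq_trans (card_subgroups_le S); apply/subset_leq_card/subsetP=> Q QQS.
  by rewrite inE; exact: (QSP Q QQS).1.
by rewrite -cardsE; exact: card_subgroups_le.
Qed.
End Step.

(** * Transitive p-groups as imprimitive groups *)

Section SymOn.
Variable T : finType.
Implicit Types (A O : {set T}) (Q G : {group {perm T}}).

Definition sym_on A : {set {perm T}} := [set s | perm_on A s].

Lemma sym_on_group_set A : group_set (sym_on A).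
Proof. by apply/group_setP; split=> [|s t]; rewrite !inE ?perm_on1 //; exact: perm_onM. Qed.
Canonical sym_on_group A := Group (sym_on_group_set A).

Lemma card_sym_on A : #|sym_on A| = #|A|`!.
Proof. by rewrite -card_perm cardsE. Qed.

Lemma sym_on_acts A s : s \in sym_on A -> s \in 'N(A | 'P).
Proof.
rewrite inE => sA; apply/astabsP=> x /=; exact: perm_closed.
Qed.

Lemma pgroup_sym_on_card p A Q : prime p -> p.-group Q -> Q \subset sym_on A ->
  #|Q| <= p ^ logn p #|A|`!.
Proof.
move=> pr /p_natP[k cQ] /cardSg; rewrite cQ card_sym_on => dv.
by rewrite leq_exp2l ?prime_gt1 // -(pfactorK k pr) dvdn_leq_log ?fact_gt0.
Qed.

(** A maximal subgroup Q0 above the stabiliser of w has index p, and its orbit of w has p^e points.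
    Q0 / K acts faithfully on these, so its order is at most the p-part of (p^e)!. *)
Lemma imprimitive_top_trans p e O Q : prime p -> p.-group Q -> Q \subset sym_on O ->
  [transitive Q, on O | 'P] -> #|O| = (p ^ e.+1)%N ->
  exists Q0 K : {group {perm T}}, imprimitive_top p (logn p (p ^ e)`!) Q Q0 K.
Proof.
move=> pr pQ sQO trQ cO.
have [w wO orbw] := imsetP trQ.
have sCQ : 'C_Q[w | 'P] \subset Q by exact: subsetIl.
have iC : #|Q : 'C_Q[w | 'P]| = (p ^ e.+1)%N by rewrite -card_orbit -orbw.
have [eqC|[Q0 maxQ0 sCQ0]] := maximal_exists sCQ.
  have := iC; rewrite eqC indexgg => /esym/eqP; rewrite expnS muln_eq1.
  by case/andP=> /eqP p1; rewrite p1 in pr.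
have sQ0Q := maxgroupp maxQ0; have {}sQ0Q : Q0 \subset Q by case/andP: sQ0Q.
have iQ0 := p_maximal_index pQ maxQ0.
have nQ0 := p_maximal_normal pQ maxQ0.
pose O1 := orbit 'P Q0 w.
have CQ0 : 'C_Q0[w | 'P] = 'C_Q[w | 'P].
  by apply/setP=> x; apply/setIP/setIP=> -[xQ xC]; split=> //; [apply: (subsetP sQ0Q) | apply: (subsetP sCQ0); apply/setIP].
have cO1 : #|O1| = (p ^ e)%N.
  rewrite card_orbit CQ0; apply/eqP; rewrite -(@eqn_pmul2l p) ?prime_gt0 // -expnS -iC -iQ0.
  by rewrite Lagrange_index.
have aQ0 : Q0 \subset 'N(O1 | 'P) by apply: acts_orbit; exact: subsetT.
pose K := 'C_Q0(O1 | 'P).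
exists Q0, [group of K]; split=> //=.
- split; first exact: subsetIl.
  by apply: normsI; [exact: normG | apply: subset_trans aQ0 _; exact: normal_norm (astab_normal _ _)].
- apply/trivgP/subsetP=> x /bigcapP xK; apply/set1gP/permP=> u; rewrite perm1.
  have xQ : x \in sym_on O.
    by apply: (subsetP sQO); apply: (subsetP sQ0Q); have := xK 1 (group1 _); rewrite conjsg1 => /setIP[].
  have [uO|uO] := boolP (u \in O); last by move: xQ; rewrite inE => xO; apply: out_perm xO uO.
  have /orbitP[y yQ <-] : u \in orbit 'P Q w by rewrite -orbw.
  have := xK y yQ; rewrite mem_conjg => /setIP[_ /astabP/(_ w (orbit_refl _ _ _))] /=.
  by rewrite /aperm conjgE invgK !permM => /(congr1 y); rewrite permKV.
- have -> : #|Q0 : K| = #|restr_perm O1 @* Q0|.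
    rewrite card_morphim ker_restr_perm (setIidPr aQ0) //; apply/eqP.
    by rewrite eq_sym /K -divgI -divgS ?subsetIl // setIA setIid.
  rewrite -cO1; apply: pgroup_sym_on_card; rewrite ?morphim_pgroup ?(pgroupS sQ0Q) //.
  apply/subsetP=> _ /morphimP[x _ _ ->]; rewrite inE; exact: restr_perm_on.
Qed.

End SymOn.

(** Legendre's formula, giving the relation t (p - 1) + 1 = mu on which the whole exponent count
    rests. *)
Lemma logn_fact_pow p e : prime p -> (1 + p.-1 * logn p (p ^ e)`!)%N = (p ^ e)%N.
Proof.
move=> pr; have p0 := prime_gt0 pr; have p1 := prime_gt1 pr.
have H n : logn p (p * n)`! = n + logn p n`!.
  rewrite !logn_fact //.
  have [->|n0] := posnP n; first by rewrite muln0 !big_geq.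
  rewrite big_ltn ?ltnS ?muln_gt0 ?p0 // expn1 mulKn //; congr (_ + _).
  rewrite (@big_cat_nat _ _ _ n.+2) //=; last by nia.
  rewrite big_add1 /= [X in _ + X]big1_seq ?addn0 => [|k /andP[_]]; last first.
    rewrite mem_index_iota => /andP[nk _]; apply: divn_small.
    case: k nk => // k nk; rewrite expnS ltn_pmul2l //.
    by apply: leq_trans (ltnW (ltn_expl k p1)); move: nk; rewrite ltnS.
  by apply: eq_bigr => k _; rewrite expnS divnMl.
elim: e => [|e IH]; first by rewrite expn0 logn1 muln0.
rewrite expnS H; move: (logn _ _) IH => L; case: p pr p0 p1 H => // p _ _ _ _ /=; nia.
Qed.

(** * Subgroups of index two of large rank *)

Section Characters.
Variable gT : finGroupType.
Implicit Types (P : {group gT}) (l m : {ffun gT -> bool}).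

(** Homomorphisms to Z/2, extended by [false] outside P so that they are determined by their values
    on P. *)
Definition chars (P : {set gT}) : {set {ffun gT -> bool}} :=
  [set l : {ffun gT -> bool} | [forall x in P, forall y in P, l (x * y) == l x (+) l y]
           && [forall x, (x \notin P) ==> ~~ l x]].

Definition char_add l m : {ffun gT -> bool} := [ffun x => l x (+) m x].

Lemma charsP P l : reflect ({in P &, {morph l : x y / x * y >-> x (+) y}} /\ (forall x, x \notin P -> l x = false))
  (l \in chars P).
Proof.
rewrite inE; apply: (iffP andP) => [[/forall_inP lM /forallP l0]|[lM l0]].
  split=> [x y xP yP|x xP]; first by have /forall_inP/(_ y yP)/eqP := lM x xP.
  by apply/negbTE; have /implyP := l0 x; apply.
split; first by apply/forall_inP=> x xP; apply/forall_inP=> y yP; rewrite lM.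
by apply/forallP=> x; apply/implyP=> /l0->.
Qed.

Lemma char1 P l : l \in chars P -> l 1 = false.
Proof. by case/charsP=> lM _; have := lM 1 1 (group1 P) (group1 P); rewrite mulg1; case: (l 1). Qed.

Lemma charV P l x : l \in chars P -> x \in P -> l x^-1 = l x.
Proof.
move=> lP xP; have := char1 lP; case/charsP: lP => lM _.
by rewrite -(mulgV x) lM ?groupV //; case: (l x); case: (l _).
Qed.

Lemma char_addP P l m : l \in chars P -> m \in chars P -> char_add l m \in chars P.
Proof.
case/charsP=> lM l0 /charsP[mM m0]; apply/charsP; split=> [x y xP yP|x xP].
  by rewrite !ffunE lM // mM //; case: (l x); case: (l y); case: (m x); case: (m y).
by rewrite ffunE l0 ?m0.
Qed.

Lemma char_addK l m : char_add (char_add l m) m = l.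
Proof. by apply/ffunP=> x; rewrite !ffunE -addbA addbb addbF. Qed.

Lemma char_addI l m n : char_add l n = char_add m n -> l = m.
Proof. by move=> E; rewrite -(char_addK l n) E char_addK. Qed.

Lemma char0P P : [ffun=> false] \in chars P.
Proof. by apply/charsP; split=> [x y _ _|x _]; rewrite !ffunE. Qed.

Lemma card_chars_le P : 2.-group P -> #|chars P| <= #|P|.
Proof.
move=> pP; have [X genX cX] := frank_gen (isT : prime 2) pP.
apply: leq_trans (frank_card (isT : prime 2) pP).
apply: (@leq_trans (2 ^ #|X|)); last by rewrite leq_exp2l.
rewrite -card_powerset.
apply: (@leq_card_in _ _ _ _ (fun l : {ffun gT -> bool} => [set x in X | l x])) => [l m|l _]; last first.
  by rewrite inE; apply/subsetP=> x; rewrite inE => /andP[].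
move=> lP mP eX; have gE : group_set [set x in P | l x == m x].
  apply/group_setP; split=> [|x y]; first by rewrite inE group1 (char1 lP) (char1 mP).
  have [[lM _] [mM _]] := (charsP _ _ lP, charsP _ _ mP).
  by rewrite !inE => /andP[xP /eqP ex] /andP[yP /eqP ey]; rewrite groupM // lM // mM // ex ey eqxx.
have sub : <<X>> \subset Group gE.
  rewrite gen_subG; apply/subsetP=> x xX; rewrite inE -genX mem_gen //=.
  by have /setP/(_ x) := eX; rewrite !inE xX /= => ->.
rewrite genX in sub; apply/ffunP=> x; have [xP|xP] := boolP (x \in P).
  by have := subsetP sub x xP; rewrite inE => /andP[_ /eqP].
by rewrite (charsP _ _ lP).2 // (charsP _ _ mP).2.
Qed.

Lemma card_chars_ge P (K : {group gT}) : K <| P -> 2.-abelem (P / K) ->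
  2 ^ logn 2 #|P : K| <= #|[set l : {ffun gT -> bool} in chars P | [forall x in K, ~~ l x]]|.
Proof.
move=> nsK ab; have [r [rM rS rK]] := abelem_quo_rV (isT : prime 2) nsK ab.
pose d := logn 2 #|P : K|.
pose f (v : 'cV['F_2]_d) : {ffun gT -> bool} := [ffun x => (x \in P) && ((r x *m v) 0 0 != 0)%R].
have -> : (2 ^ d)%N = #|[set f v | v in [set: 'cV['F_2]_d]]|.
  rewrite card_imset ?cardsT ?card_mx ?card_Fp ?muln1 // => v w /ffunP E.
  have F2 (a b : 'F_2) : (a != 0)%R = (b != 0)%R -> a = b.
    by case: a => [[|[|a]] ia]; case: b => [[|[|b]] ib] //= _; apply/val_inj.
  apply/matrixP=> i j; rewrite ord1 {j}; have [g gP rg] := rS (delta_mx 0 i)%R.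
  have := E g; rewrite !ffunE gP /= rg -!rowE => /F2; by rewrite !mxE.
apply/subset_leq_card/subsetP=> _ /imsetP[v _ ->]; rewrite inE; apply/andP; split; last first.
  apply/forall_inP=> x xK; rewrite ffunE rK // mul0mx mxE eqxx andbF //.
apply/charsP; split=> [x y xP yP|x xP]; last by rewrite ffunE (negPf xP).
rewrite !ffunE groupM // xP yP rM //= mulmxDl mxE.
set a := (_ *m _)%R 0%R 0%R; set b := (_ *m _)%R _ _.
by move: a b; do 2![case=> [[|[|?]] ?] //].
Qed.
End Characters.

Lemma comm_squares (gT : finGroupType) (x y : gT) : [~ x, y] = x ^- 2 * ((x * y^-1) ^+ 2 * y ^+ 2).
Proof. by rewrite commgEl conjgE !expgS !expg0 !mulg1 invMg !mulgA !mulgKV. Qed.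

Lemma sq_comm (gT : finGroupType) (b x : gT) : (b * x) ^+ 2 = b ^+ 2 * (x ^+ 2 * [~ x, b] ^ x).
Proof. by rewrite commgEl !conjgE !expgS !expg0 !mulg1 !mulgA !mulgK. Qed.

Section QuadraticCharacters.
Variables (gT : finGroupType) (G : {group gT}).
Hypothesis pG : 2.-group G.
Implicit Types (B D E : {group gT}) (l m : {ffun gT -> bool}).
Local Notation P := ('Phi(G)).

Lemma Phi_comm g h : g \in G -> h \in G -> [~ g, h] \in P.
Proof. by move=> gG hG; rewrite (Phi_joing pG) mem_gen // inE mem_commg. Qed.

Lemma Phi_sq g : g \in G -> g ^+ 2 \in P.
Proof.
move=> gG; rewrite (Phi_joing pG) mem_gen // inE; apply/orP; right.
by rewrite -[2]/(2 ^ 1)%N Mho_p_elt // (mem_p_elt pG).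
Qed.

(** For a 2-group Phi(G) is generated by the squares of elements of G, since commutators are
    products of squares. *)
Lemma char_sq_inj l m : l \in chars P -> m \in chars P ->
  {in G, forall g, l (g ^+ 2) = m (g ^+ 2)} -> l = m.
Proof.
move=> lP mP eq_sq; have [[lM l0] [mM m0]] := (charsP _ _ lP, charsP _ _ mP).
have gL : group_set [set x in P | l x == m x].
  apply/group_setP; split=> [|x y]; first by rewrite inE group1 (char1 lP) (char1 mP) eqxx.
  by rewrite !inE => /andP[xP /eqP ex] /andP[yP /eqP ey]; rewrite groupM // lM // mM // ex ey eqxx.
have sqL g : g \in G -> g ^+ 2 \in Group gL by move=> gG; rewrite inE Phi_sq //= eq_sq.
have sub : P \subset Group gL.
  move: (Group gL) sqL => L sqL; rewrite (Phi_joing pG) join_subG; apply/andP; split.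
    rewrite gen_subG; apply/subsetP=> _ /imset2P[x y xG yG ->].
    by rewrite comm_squares groupM ?groupV ?sqL // groupM ?sqL ?groupM ?groupV.
  rewrite (MhoE 1 pG) gen_subG; apply/subsetP=> _ /imsetP[x xG ->]; exact: sqL.
apply/ffunP=> x; have [xP|xP] := boolP (x \in P); last by rewrite l0 ?m0.
by have := subsetP sub x xP; rewrite inE => /andP[_ /eqP].
Qed.

(** The characters of Phi(G) invariant under G. For such l the map g -> l (g ^+ 2) is quadratic over
    F_2, and its polarisation is the alternating form (g, h) -> l [~ g, h]. *)
Definition cchars : {set {ffun gT -> bool}} :=
  [set l : {ffun gT -> bool} in chars P | [forall x in P, forall g in G, ~~ l [~ x, g]]].

Lemma ccharsP l : reflect (l \in chars P /\ {in P & G, forall x g, l (x ^ g) = l x}) (l \in cchars).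
Proof.
apply: (iffP setIdP) => [[lP lC]|[lP lC]]; split=> //; have [lM l0] := charsP _ _ lP.
  move=> x g xP gG; have /forall_inP/(_ x xP)/forall_inP/(_ g gG)/negbTE lxg := lC.
  by rewrite conjg_mulR lM ?lxg ?addbF // Phi_comm // (subsetP (Phi_sub G)).
apply/forall_inP=> x xP; apply/forall_inP=> g gG.
have xgP : x ^ g \in P by rewrite memJ_norm // (subsetP (normal_norm (Phi_normal G))).
by rewrite commgEl lM ?groupV // (charV lP) // lC // addbb.
Qed.

Lemma cchar_commMl l g h k : l \in cchars -> g \in G -> h \in G -> k \in G ->
  l [~ g * h, k] = l [~ g, k] (+) l [~ h, k].
Proof.
case/ccharsP=> lP lJ gG hG kG; have [lM _] := charsP _ _ lP.
rewrite commMgJ lM ?lJ // ?Phi_comm // memJ_norm ?Phi_comm //.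
by rewrite (subsetP (normal_norm (Phi_normal G))).
Qed.

Lemma cchar_commC l g h : l \in cchars -> g \in G -> h \in G -> l [~ g, h] = l [~ h, g].
Proof. by case/ccharsP=> lP _ gG hG; rewrite -(charV lP) ?invg_comm ?Phi_comm. Qed.

Lemma cchar_commMr l g h k : l \in cchars -> g \in G -> h \in G -> k \in G ->
  l [~ g, h * k] = l [~ g, h] (+) l [~ g, k].
Proof.
move=> lC gG hG kG; rewrite cchar_commC ?groupM // cchar_commMl //.
by rewrite (cchar_commC lC hG gG) (cchar_commC lC kG gG).
Qed.

(** The radical of the alternating form attached to l. *)
Definition Rad l : {set gT} := [set g in G | [forall h in G, ~~ l [~ g, h]]].

Lemma RadP l g : reflect (g \in G /\ {in G, forall h, l [~ g, h] = false}) (g \in Rad l).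
Proof.
rewrite inE; apply: (iffP andP) => -[gG H]; split=> //.
  by move=> h hG; apply/negbTE; move/forall_inP: H; apply.
by apply/forall_inP=> h hG; rewrite H.
Qed.

Lemma Rad_group_set l : l \in cchars -> group_set (Rad l).
Proof.
move=> lC; have [lP _] := ccharsP _ lC; apply/group_setP; split=> [|g h].
  by apply/RadP; split=> // h hG; rewrite comm1g (char1 lP).
case/RadP=> gG g0 /RadP[hG h0]; apply/RadP; split=> [|k kG]; first exact: groupM.
by rewrite cchar_commMl // g0 ?h0.
Qed.

Lemma cchar_addP l m : l \in cchars -> m \in cchars -> char_add l m \in cchars.
Proof.
case/ccharsP=> lP lJ /ccharsP[mP mJ]; apply/ccharsP; split; first exact: char_addP.
by move=> x g xP gG; rewrite !ffunE lJ ?mJ.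
Qed.

(* These characters measure the excess of [frank 2 B] over [frank 2 G]; see
   [frank_index2]. *)
Definition X0 (B : {set gT}) : {set {ffun gT -> bool}} :=
  [set l : {ffun gT -> bool} in cchars | [forall b in B, ~~ l (b ^+ 2)]].

Section IndexTwo.
Variables (B : {group gT}) (x0 : gT).
Hypotheses (sBG : B \subset G) (iB : #|G : B| = 2) (x0G : x0 \in G) (x0B : x0 \notin B).

Let nB : B <| G. Proof. exact: index_p_normal (isT : prime 2) pG sBG iB. Qed.
Let pB : 2.-group B. Proof. exact: pgroupS sBG pG. Qed.

Lemma index2_split g : g \in G -> g \in B \/ exists2 b, b \in B & g = b * x0.
Proof.
move=> gG; have [[[|[|k]] ik] //=] := index_p_rcoset (isT : prime 2) pG sBG iB x0G x0B gG.
  by rewrite expg0 rcoset1; left.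
by rewrite expg1 => /rcosetP[b bB ->]; right; exists b.
Qed.

Lemma x0_sq : x0 ^+ 2 \in B.
Proof. by rewrite (index_p_expn 2 (isT : prime 2) pG sBG iB x0G x0B). Qed.

Lemma X0_comm l b c : l \in X0 B -> b \in B -> c \in B -> l [~ b, c] = false.
Proof.
case/setIdP=> /ccharsP[lP _] /forall_inP l0 bB cB; have [lM _] := charsP _ _ lP.
have [bG cG] := (subsetP sBG b bB, subsetP sBG c cB).
rewrite comm_squares.
have sq (x : gT) : x \in B -> l (x ^+ 2) = false by move=> xB; apply/negbTE/l0.
have sqP (x : gT) : x \in B -> x ^+ 2 \in P by move=> xB; rewrite Phi_sq ?(subsetP sBG).
have bcB : b * c^-1 \in B by rewrite groupM ?groupV.
have [b2 c2 bc2] := And3 (sqP b bB) (sqP c cB) (sqP _ bcB).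
have bcP : (b * c^-1) ^+ 2 * c ^+ 2 \in P := groupM bc2 c2.
have bVP : b ^- 2 \in P by rewrite groupV.
by rewrite (lM _ _ bVP bcP) (lM _ _ bc2 c2) (charV lP b2) !sq.
Qed.

(** The quadratic form of l vanishes on B, so on B x0 it is given by l (x0 ^+ 2) and the values l
    [~ x0, b]; these depend only on the coset of b modulo E. Squares determine l by
    [char_sq_inj]. *)
Lemma card_X0_Rad E : E \subset B -> #|[set l in X0 B | E \subset Rad l]| <= 2 * 2 ^ #|B : E|.
Proof.
move=> sEB.
pose code l := (l (x0 ^+ 2), [set C in rcosets E B | l [~ x0, repr C]]).
apply: (@leq_trans #|setX [set: bool] (powerset (rcosets E B))|); last first.
  by rewrite cardsX cardsT card_bool card_powerset.
apply: (@leq_card_in _ _ _ _ code) => [l m|l _]; last first.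
  by rewrite !inE /=; apply/subsetP=> C; rewrite inE => /andP[].
case/setIdP=> lX El /setIdP[mX Em] [eq0 eqC].
have [/setIdP[lC l0] /setIdP[mC m0]] := (lX, mX).
have [[lP lJ] [mP mJ]] := (ccharsP _ lC, ccharsP _ mC).
have eqx b : b \in B -> l [~ x0, b] = m [~ x0, b].
  move=> bB; have rE : repr (E :* b) \in E :* b by apply: mem_repr (rcoset_refl _ _).
  have /rcosetP[e eE Er] := rE; have eB := subsetP sEB e eE; have [eG bG] := (subsetP sBG e eB, subsetP sBG b bB).
  have ce n : n \in cchars -> E \subset Rad n -> n [~ x0, b] = n [~ x0, repr (E :* b)].
    move=> nC /subsetP/(_ e eE)/RadP[_ /(_ x0 x0G) ne].
    by rewrite Er cchar_commMr // cchar_commC // ne.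
  rewrite !ce //; have /setP/(_ (E :* b)) := eqC; rewrite !inE.
  by have -> : E :* b \in rcosets E B by apply/rcosetsP; exists b.
apply: char_sq_inj => // g gG; have [lM _] := charsP _ _ lP; have [mM _] := charsP _ _ mP.
have [gB|[b bB ->]] := index2_split gG.
  by rewrite (negbTE (forall_inP l0 g gB)) (negbTE (forall_inP m0 g gB)).
have bG := subsetP sBG b bB.
rewrite sq_comm.
have nP : G \subset 'N(P) := normal_norm (Phi_normal G).
have cP : [~ x0, b] ^ x0 \in P by rewrite memJ_norm ?Phi_comm // (subsetP nP).
have [b2 x2 xc] := And3 (Phi_sq bG) (Phi_sq x0G) (Phi_comm x0G bG).
have xcP : x0 ^+ 2 * [~ x0, b] ^ x0 \in P := groupM x2 cP.
rewrite (lM _ _ b2 xcP) (mM _ _ b2 xcP) (lM _ _ x2 cP) (mM _ _ x2 cP).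
rewrite lJ // mJ // eqx // eq0.
by rewrite (negbTE (forall_inP l0 b bB)) (negbTE (forall_inP m0 b bB)).
Qed.

(** Let Y be the characters of Phi(G) trivial on Phi(B). B acts trivially on Y, and those fixed by
    x0 lie in [X0 B]. The norm map l -> l + l^x0 sends Y into [X0 B], and two elements of one fibre
    differ by a fixed character, so |Y| <= |X0 B|^2. *)
Lemma card_X0_ge : #|P : 'Phi(B)| <= #|X0 B| ^ 2.
Proof.
have sPB : P \subset B by rewrite Phi_sub_max // p_index_maximal // iB.
have sPBP : 'Phi(B) \subset P by exact: PhiS pG sBG.
have nP : G \subset 'N(P) := normal_norm (Phi_normal G).
have nPB : G \subset 'N('Phi(B)) by rewrite (char_norm_trans (Phi_char B)) ?normal_norm.
have nsPB : 'Phi(B) <| P by rewrite /normal sPBP (subset_trans (Phi_sub G)).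
have abP : 2.-abelem (P / 'Phi(B)).
  by apply: abelemS (Phi_quotient_abelem pB); apply: quotientS.
have ci : #|P : 'Phi(B)| = (2 ^ logn 2 #|P : 'Phi(B)|)%N.
  have /p_natP[k ck] : 2.-nat #|P : 'Phi(B)|.
    by apply: pnat_dvd (pgroupS (Phi_sub G) pG); apply: dvdn_indexg.
  by rewrite ck pfactorK.
rewrite {}ci; apply: leq_trans (card_chars_ge nsPB abP) _.
set Y := [set l in _ | _].
have YJ l f b : l \in Y -> f \in P -> b \in B -> l (f ^ b) = l f.
  case/setIdP=> lP /forall_inP lB fP bB; have [lM _] := charsP _ _ lP.
  have cB : [~ f, b] \in 'Phi(B).
    by rewrite (Phi_joing pB) mem_gen // inE mem_commg // (subsetP sPB).
  by rewrite conjg_mulR (lM _ _ fP (subsetP sPBP _ cB)) (negbTE (lB _ cB)) addbF.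
pose nm l : {ffun gT -> bool} := [ffun f => l f (+) l (f ^ x0)].
have x0N : x0 \in 'N(P) by rewrite (subsetP nP).
have sqB b : b \in B -> b ^+ 2 \in 'Phi(B).
  move=> bB; rewrite (Phi_joing pB) mem_gen // inE; apply/orP; right.
  by rewrite -[2]/(2 ^ 1)%N Mho_p_elt // (mem_p_elt pB).
have invX l : l \in Y -> {in P, forall f, l (f ^ x0) = l f} -> l \in X0 B.
  move=> lY lx; have [lP /forall_inP lB] := setIdP lY.
  rewrite inE; apply/andP; split; last by apply/forall_inP=> b bB; rewrite lB ?sqB.
  apply/ccharsP; split=> // f g fP gG; have [gB|[b bB ->]] := index2_split gG; first exact: YJ.
  by rewrite conjgM lx ?YJ // memJ_norm // (subsetP nP) // (subsetP sBG).
have nmX l : l \in Y -> nm l \in X0 B.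
  move=> lY; have [lP /forall_inP lB] := setIdP lY; have [lM l0] := charsP _ _ lP.
  apply: invX; last first.
    by move=> f fP; rewrite !ffunE -conjgM (YJ _ _ (x0 * x0)) ?x0_sq // addbC.
  rewrite inE; apply/andP; split; last first.
    by apply/forall_inP=> f fB; rewrite ffunE !(negbTE (lB _ _)) // memJ_norm // (subsetP nPB).
  apply/charsP; split=> [f g fP gP|f fP]; last by rewrite ffunE !l0 // memJ_norm.
  have JP y : y \in P -> y ^ x0 \in P by rewrite memJ_norm.
  rewrite !ffunE conjMg (lM _ _ fP gP) (lM _ _ (JP f fP) (JP g gP)).
  by case: (l f); case: (l g); case: (l (f ^ _)); case: (l _).
rewrite expnS expn1; apply: leq_trans (card_le_imset_fibers (f := nm) (k := #|X0 B|) _) _; last first.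
  rewrite leq_mul2r; apply/orP; right; apply/subset_leq_card/subsetP=> _ /imsetP[l lY ->]; exact: nmX.
move=> _ /imsetP[l0 l0Y ->].
apply: (@leq_card_in _ _ _ _ (fun l => char_add l l0)) => [l m _ _|l]; first exact: char_addI.
case/setIdP=> lY /eqP/ffunP eq_nm; have [[lP /forall_inP lB] [l0P /forall_inP l0B]] := (setIdP lY, setIdP l0Y).
apply: invX.
  rewrite inE; apply/andP; split; first exact: char_addP.
  by apply/forall_inP=> f fB; rewrite ffunE (negbTE (lB f fB)) (negbTE (l0B f fB)).
move=> f fP; have := eq_nm f; rewrite !ffunE.
by case: (l f); case: (l _); case: (l0 f); case: (l0 _).
Qed.

End IndexTwo.
End QuadraticCharacters.

Lemma indexgI_le (gT : finGroupType) (G H K : {group gT}) : H \subset G -> K \subset G ->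
  #|G : H :&: K| <= #|G : H| * #|G : K|.
Proof.
move=> sHG sKG; rewrite -(Lagrange_index sHG (subsetIl H K)) leq_mul2l; apply/orP; right.
have K0 : 0 < #|H :&: K| * #|K| by rewrite muln_gt0 !cardG_gt0.
rewrite -(leq_pmul2l K0) mulnAC Lagrange ?subsetIl // mul_cardG -mulnA (mulnC #|H * K|) leq_mul2l.
by apply/orP; right; rewrite Lagrange // subset_leq_card // mul_subG.
Qed.

Lemma card_overgroups_le (gT : finGroupType) (G D : {group gT}) :
  #|[set B : {group gT} | (D \subset B) && (B \subset G)]| <= 2 ^ #|G : D|.
Proof.
rewrite -[#|G : D|]/#|rcosets D G| -card_powerset.
apply: (@leq_card_in _ _ _ _ (fun B : {group gT} => [set C in rcosets D G | C \subset B])) => [B C|B _].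
  rewrite !inE => /andP[sDB sBG] /andP[sDC sCG] /setP eqBC.
  suff H (X Y : {group gT}) : D \subset X -> X \subset G ->
      (forall C, (C \in [set C in rcosets D G | C \subset X]) = (C \in [set C in rcosets D G | C \subset Y])) -> X \subset Y.
    by apply/val_inj/eqP; rewrite eqEsubset; apply/andP; split; apply: H.
  move=> sDX sXG eqXY; apply/subsetP=> x xX; have := eqXY (D :* x); rewrite !inE.
  have -> : D :* x \in rcosets D G by apply/rcosetsP; exists x; rewrite ?(subsetP sXG).
  rewrite /= mul_subG ?sub1set // => /esym/subsetP; apply; exact: rcoset_refl.
by rewrite inE; apply/subsetP=> C; rewrite inE => /andP[].
Qed.

Section FewBad.
Variables (gT : finGroupType) (G : {group gT}).
Hypothesis pG : 2.-group G.
Implicit Types (B D E : {group gT}) (l m : {ffun gT -> bool}).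
Local Notation P := ('Phi(G)).

Lemma out_index2 B : #|G : B| = 2 -> exists2 x, x \in G & x \notin B.
Proof. by move=> iB; apply/subsetPn; rewrite -indexg_eq1 iB. Qed.

(** The index |G : Phi(B)| is computed once through B and once through Phi(G). *)
Lemma frank_index2 B : B \subset G -> #|G : B| = 2 ->
  (2 ^ (frank 2 B).+1 <= 2 ^ frank 2 G * #|X0 G B| ^ 2)%N.
Proof.
move=> sBG iB; have [x xG xB] := out_index2 iB.
have pB : 2.-group B := pgroupS sBG pG; have pr : prime 2 by [].
have := card_X0_ge pG sBG iB xG xB => H.
have cB := card_quo_Phi pr pB; have cG := card_quo_Phi pr pG.
rewrite card_quotient ?normal_norm ?Phi_normal // in cB.
rewrite card_quotient ?normal_norm ?Phi_normal // in cG.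
have sPP : 'Phi(B) \subset P := PhiS pG sBG.
have e1 := Lagrange_index sBG (Phi_sub B); have e2 := Lagrange_index (Phi_sub G) sPP.
rewrite iB cB -expnS in e1; rewrite e1 -e2 cG leq_mul2l.
by rewrite H orbT.
Qed.

(** The form of l vanishes on B x B, so for b in B membership in the radical is the single linear
    condition l [~ x, b] = 0, for any x outside B. *)
Lemma X0_Rad_index B l : B \subset G -> #|G : B| = 2 -> l \in X0 G B ->
  #|B : B :&: Rad G l| <= 2.
Proof.
move=> sBG iB lX; have [x xG xB] := out_index2 iB.
have [lC _] := setIdP lX.
pose R := Group (Rad_group_set pG lC).
have sIB : B :&: R \subset B := subsetIl _ _.
rewrite -(@leq_pmul2l #|B :&: R|) ?cardG_gt0 // (Lagrange sIB) mulnC.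
apply: leq_trans (card_le_imset_fibers (f := fun b => l [~ x, b]) (k := #|B :&: R|) _) _; last first.
  by rewrite leq_mul2r -card_bool max_card orbT.
move=> _ /imsetP[b0 b0B ->].
apply: (@leq_card_in _ _ _ _ (fun b => b * b0^-1)) => [b c _ _ /mulIg //|b].
case/setIdP=> bB /eqP eb; have bbB : b * b0^-1 \in B by rewrite groupM ?groupV.
have [bG b0G bbG] := And3 (subsetP sBG b bB) (subsetP sBG b0 b0B) (subsetP sBG _ bbB).
have bx : l [~ x, b * b0^-1] = false.
  have : l [~ x, b] = l [~ x, b * b0^-1] (+) l [~ x, b0].
    by rewrite -(cchar_commMr pG lC xG bbG b0G) mulgKV.
  by rewrite eb; case: (l _); case: (l _).
rewrite inE bbB; apply/RadP; split=> // h hG.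
have [hB|[d dB ->]] := index2_split pG sBG iB xG xB hG; first exact: X0_comm lX bbB hB.
have dG := subsetP sBG d dB.
by rewrite (cchar_commMr pG lC bbG dG xG) (X0_comm pG sBG lX bbB dB) (cchar_commC pG lC bbG xG) bx.
Qed.

(** Take w in Rad L outside B and u in Rad L :&: B outside Rad l. An element g of the radical of the
    sum is orthogonal under l to u and w, because the form of L vanishes on them. Orthogonality to u
    forces g into B, and then orthogonality to w forces g into Rad l. *)
Lemma Rad_add B l L : B \subset G -> #|G : B| = 2 -> l \in X0 G B -> L \in cchars G ->
  ~~ (Rad G L \subset B) -> ~~ (Rad G L :&: B \subset Rad G l) ->
  Rad G (char_add L l) = Rad G L :&: (B :&: Rad G l).
Proof.
move=> sBG iB lX LC /subsetPn[w wL wB] /subsetPn[u /setIP[uL uB] ul].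
have [lC _] := setIdP lX.
have [wG wL0] := RadP _ _ _ wL; have [uG uL0] := RadP _ _ _ uL.
have lwu b : b \in B -> {in G, forall h, l [~ b, h] = (h \notin B) && l [~ b, w]}.
  move=> bB h hG; have bG := subsetP sBG b bB.
  have [hB|[d dB ->]] := index2_split pG sBG iB wG wB hG; first by rewrite hB (X0_comm pG sBG lX bB hB).
  have dG := subsetP sBG d dB.
  by rewrite (cchar_commMr pG lC bG dG wG) (X0_comm pG sBG lX bB dB) groupMl // wB.
have luw : l [~ u, w].
  apply/idPn => /negbTE luw; case/negP: ul; apply/RadP; split=> // h hG.
  by rewrite lwu // luw andbF.
apply/setP=> g; apply/idP/idP => [gR|/setIP[/RadP[gG gL] /setIP[gB /RadP[_ gl]]]]; last first.
  by apply/RadP; split=> // h hG; rewrite ffunE gL ?gl.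
have [gG g0] := RadP _ _ _ gR.
have ev h : h \in Rad G L -> l [~ g, h] = false.
  move=> hL; have [hG hL0] := RadP _ _ _ hL.
  by have := g0 h hG; rewrite ffunE (cchar_commC pG LC gG hG) hL0.
have gB : g \in B.
  have := ev u uL; rewrite (cchar_commC pG lC gG uG) lwu // luw andbT.
  by move/negbFE.
have gl : g \in Rad G l.
  by apply/RadP; split=> // h hG; rewrite lwu // ev // andbF.
rewrite 2!in_setI gB gl /= andbT.
have [_ gl0] := RadP _ _ _ gl.
by apply/RadP; split=> // h hG; have := g0 h hG; rewrite ffunE gl0 // addbF.
Qed.

Variable c : nat.
(** Over a subgroup of index at most 4^c there are at most 2^(4^c) subgroups B, and for each of them
    at most 2 * 2^(4^c) characters in [X0 G B] with radical above it. *)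
Let K : nat := (2 ^ (1 + 2 * 4 ^ c))%N.

(** The threshold is the bound of [card_X0_Rad] at index 4^c: while |G : Rad L| <= 4^c, a bad B has
    a character whose radical does not contain Rad L :&: B. *)
Definition bad_set : {set {group gT}} :=
  [set B : {group gT} | [&& B \subset G, #|G : B| == 2 & 2 ^ (1 + 4 ^ c) < #|X0 G B|]].

Let R i := [set L in cchars G | #|G : Rad G L| <= 4 ^ i].

(** Count the pairs (L, B) with Rad L not inside B; at most K subgroups B contain Rad L. Send a pair
    to L + l, with l picked in [X0 G B] so that [Rad_add] applies. B and Rad l contain the radical
    of the sum, which leaves K pairs (B, l), and l gives back L. *)
Lemma bad_step i : i < c -> #|R i| * (#|bad_set| - K) <= #|R i.+1| * K.
Proof.
move=> ic; have le4 : 4 ^ i.+1 <= 4 ^ c by rewrite leq_exp2l.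
have le4' : 4 ^ i <= 4 ^ c by rewrite leq_exp2l // ltnW.
have sRad L : Rad G L \subset G by apply/subsetP=> x /RadP[].
pose PS := [set u : {ffun gT -> bool} * {group gT} | [&& u.1 \in R i, u.2 \in bad_set & ~~ (Rad G u.1 \subset u.2)]].
have cPS : #|R i| * (#|bad_set| - K) <= #|PS|.
  rewrite -sum_nat_const -[#|PS|]sum1_card (partition_big (fun u => u.1) (mem (R i))) => [|u]; last by rewrite inE => /andP[].
  apply: leq_sum => L LR; have [LC iL] := setIdP LR.
  pose RL := Group (Rad_group_set pG LC).
  apply: (@leq_trans #|bad_set :\: [set B : {group gT} | (RL \subset B) && (B \subset G)]|).
    rewrite cardsD leq_sub2l //; apply: leq_trans (subset_leq_card (subsetIr _ _)) _.
    apply: leq_trans (card_overgroups_le _ _) _; rewrite leq_exp2l //.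
    by apply: leq_trans iL _; apply: leq_trans le4' _; lia.
  rewrite sum1dep_card; apply: (@leq_card_in _ _ _ _ (fun B : {group gT} => (L, B))) => [B C _ _ [] //|B].
  case/setDP=> bB; rewrite inE negb_and => nB; rewrite inE eqxx andbT inE LR bB /=.
  by case/orP: nB => // nB; move: bB; rewrite inE (negPf nB).
pose pk (L : {ffun gT -> bool}) (B : {group gT}) := odflt L [pick l in X0 G B | ~~ (Rad G L :&: B \subset Rad G l)].
have pkP L B : L \in R i -> B \in bad_set -> pk L B \in X0 G B /\ ~~ (Rad G L :&: B \subset Rad G (pk L B)).
  move=> LR; rewrite inE => /and3P[sBG /eqP iB bigX]; rewrite /pk; case: pickP => [l /andP[] //|nol].
  have [LC iL] := setIdP LR; pose RL := Group (Rad_group_set pG LC).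
  have [x xG xB] := out_index2 iB.
  have := card_X0_Rad pG sBG iB xG xB (subsetIr RL B).
  rewrite leqNgt => /negP[]; apply: leq_trans (_ : #|X0 G B| <= _); last first.
    apply/subset_leq_card/subsetP=> l lX; rewrite inE lX /=.
    by have := nol l; rewrite lX /= => /negbFE.
  apply: leq_ltn_trans bigX; rewrite expnS leq_mul2l leq_exp2l //=.
  apply: leq_trans le4'; apply: leq_trans iL.
  rewrite -(@leq_pmul2l #|RL :&: B|) ?cardG_gt0 // Lagrange ?subsetIr //.
  have RL0 : 0 < #|RL| by exact: cardG_gt0.
  rewrite -(leq_pmul2l RL0) mulnCA Lagrange ?sRad // mul_cardG mulnC leq_mul2l.
  by apply/orP; right; rewrite subset_leq_card // mul_subG ?sRad.
apply: (leq_trans cPS); pose f (u : {ffun gT -> bool} * {group gT}) := char_add u.1 (pk u.1 u.2).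
have radf u : u \in PS -> Rad G (f u) = Rad G u.1 :&: (u.2 :&: Rad G (pk u.1 u.2)).
  rewrite inE => /and3P[uR uB nB]; have [lX nl] := pkP _ _ uR uB.
  by move: uB; rewrite inE => /and3P[sBG /eqP iB _]; apply: Rad_add; rewrite //; case/setIdP: uR.
have fR u : u \in PS -> f u \in R i.+1.
  move=> uPS; rewrite inE radf //; move: (uPS); rewrite inE => /and3P[uR uB nB]; have [lX nl] := pkP _ _ uR uB.
  move: (uB); rewrite inE => /and3P[sBG /eqP iB _]; have [[lC _] [LC iL]] := (setIdP lX, setIdP uR).
  rewrite /f cchar_addP //=.
  pose RL := Group (Rad_group_set pG LC); pose Rl := Group (Rad_group_set pG lC).
  have sBR : u.2 :&: Rl \subset G by rewrite subIset ?sBG.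
  apply: leq_trans (indexgI_le (sRad _ : RL \subset G) sBR) _.
  (* One factor 2 is |G : B|, the other bounds |B : B :&: Rad l|. *)
  rewrite expnSr leq_mul // -(Lagrange_index sBG (subsetIl _ _)) iB -[4]/(2 * 2)%N leq_mul2l.
  exact: X0_Rad_index.
apply: leq_trans (card_le_imset_fibers (f := f) (k := K) _) _; last first.
  by rewrite leq_mul2r; apply/orP; right; apply/subset_leq_card/subsetP=> _ /imsetP[u /fR uPS ->].
move=> _ /imsetP[u0 /fR u0R ->]; move: (f u0) u0R => L' L'R.
have [L'C iL'] := setIdP L'R; have {}iL' := leq_trans iL' le4.
pose RL := Group (Rad_group_set pG L'C).
pose W := [set w : {group gT} * {ffun gT -> bool} | [&& RL \subset w.1, w.1 \subset G, #|G : w.1| == 2,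
   w.2 \in X0 G w.1 & RL \subset Rad G w.2]].
apply: (@leq_trans #|W|).
  apply: (@leq_card_in _ _ _ _ (fun u => (u.2, pk u.1 u.2))) => [u v|u].
    case/setIdP=> _ /eqP fu /setIdP[_ /eqP fv] [eq2 eqpk].
    move: fu; rewrite -fv /f eqpk => /char_addI eq1.
    by case: u v eq1 eq2 {fv eqpk} => u1 u2 [v1 v2] /= -> ->.
  case/setIdP=> uPS /eqP fu; have := radf u uPS; rewrite fu => eR.
  move: uPS; rewrite inE => /and3P[uR uB nB]; have [lX nl] := pkP _ _ uR uB.
  move: uB; rewrite inE => /and3P[sBG iB _]; rewrite inE /= sBG iB lX eR /=.
  by apply/andP; split; apply: subset_trans (subsetIr _ _) _; [exact: subsetIl | exact: subsetIr].
apply: leq_trans (card_le_imset_fibers (f := fst) (k := 2 * 2 ^ (4 ^ c)) _) _; last first.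
  have -> : K = (2 ^ (4 ^ c) * (2 * 2 ^ (4 ^ c)))%N by rewrite /K expnD expn1 mulnCA -expnD addnn -mul2n.
  rewrite leq_mul2r; apply/orP; right.
  apply: (@leq_trans (2 ^ #|G : RL|)); last by rewrite leq_exp2l.
  apply: leq_trans (card_overgroups_le G RL); apply/subset_leq_card/subsetP=> _ /imsetP[w wW ->].
  by move: wW; rewrite !inE => /and5P[-> ->].
move=> B _; case: (set_0Vmem [set x in W | x.1 == B]) => [->|[w0]]; first by rewrite cards0.
case/setIdP=> w0W /eqP Ew0; move: w0W; rewrite inE Ew0 => /and5P[sRB sBG /eqP iB _ _].
have [x xG xB] := out_index2 iB.
apply: (@leq_trans (2 * 2 ^ #|B : RL|)); last first.
  rewrite leq_mul2l leq_exp2l //=; apply: leq_trans iL'.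
  by rewrite -(Lagrange_index sBG sRB) iB leq_pmull.
apply: leq_trans (card_X0_Rad pG sBG iB xG xB sRB).
apply: (@leq_card_in _ _ _ _ snd) => [[u1 u2] [v1 v2]|w].
  by case/setIdP=> _ /eqP /= -> /setIdP[_ /eqP /= ->] ->.
case/setIdP; rewrite inE => /and5P[_ _ _ wX wR] /eqP eB; rewrite inE wR -eB.
by rewrite wX.
Qed.

(* Adding greedily a character from [X0 G B_i] for bad subgroups B_1, ..., B_c
   multiplies the index of the radical by at most 4 each time, and the radical
   remembers the B_i up to K choices each; but the sums are among at most #|G|
   characters. *)
Lemma few_bad : (#|bad_set| - K) ^ c <= K ^ c * #|G|.
Proof.
have H i : i <= c -> (#|bad_set| - K) ^ i <= K ^ i * #|R i|.
  elim: i => [_|i IH ic].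
    rewrite !expn0 mul1n; apply/card_gt0P; exists [ffun=> false].
    rewrite inE; apply/andP; split.
      by apply/(ccharsP pG); split=> [|x g _ _]; [exact: char0P | rewrite !ffunE].
    have -> : Rad G [ffun=> false] = G.
      by apply/setP=> x; apply/RadP/idP=> [[]|xG] //; split=> // h _; rewrite ffunE.
    by rewrite indexgg.
  rewrite expnSr; apply: (@leq_trans (K ^ i * #|R i| * (#|bad_set| - K))).
    by rewrite leq_mul2r IH ?orbT // ltnW.
  by rewrite -mulnA expnSr -mulnA leq_mul2l (mulnC K) bad_step ?orbT.
apply: leq_trans (H c (leqnn c)) _; rewrite leq_mul2l; apply/orP; right.
apply: (@leq_trans #|chars P|).
  by apply/subset_leq_card/subsetP=> l /setIdP[/setIdP[]].
apply: leq_trans (card_chars_le (pgroupS (Phi_sub G) pG)) _.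
exact: subset_leq_card (Phi_sub G).
Qed.

Lemma frank_not_bad B : B \subset G -> #|G : B| = 2 -> B \notin bad_set ->
  frank 2 B <= frank 2 G + (1 + 2 * 4 ^ c).
Proof.
move=> sBG iB; rewrite inE sBG iB /= -leqNgt => cX.
rewrite -ltnS -(@leq_exp2l 2) // (leq_trans (frank_index2 sBG iB)) // -addnS expnD leq_mul2l.
by apply/orP; right; rewrite (leq_trans (leq_expn2l 2 cX)) // -expnM leq_exp2l //; lia.
Qed.
End FewBad.

(** * The rank of a p-group with large orbits *)

Local Open Scope ring_scope.

Lemma perm_mx_subXp p n (s : 'S_n) : prime p ->
  (perm_mx s - 1%:M : 'M['F_p]_n) ^+ p = perm_mx (s ^+ p)%g - 1%:M.
Proof.
move=> pr; case: n s => [|n] s; first by rewrite !thinmx0.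
have ch : p \in [char 'M['F_p]_n.+1].
  by rewrite pchar_lalg; apply: pchar_Fp.
have X k : (perm_mx s : 'M['F_p]_n.+1) ^+ k = perm_mx (s ^+ k)%g.
  by elim: k => [|k IH]; rewrite ?expr0 ?expg0 ?perm_mx1 // exprS expgS perm_mxM IH.
rewrite -[LHS](pFrobenius_autE ch) pFrobenius_autB_comm ?pFrobenius_autE ?X ?expr1n //.
exact: commr1.
Qed.

(** * Generator numbers of submodules of permutation modules *)

Section PermModule.
Variables (p n : nat).
Hypothesis pr : prime p.
Local Notation F := 'F_p.
Local Notation "''P' g" := (@perm_mx F n g) (at level 10, g at level 9).
Implicit Types (M N : 'M[F]_n) (G Z : {group 'S_n}) (O : {set 'I_n}).

(** This is M I, with I the augmentation ideal of the group algebra; for a stable M and a p-group G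
    it is the radical of M. *)
Definition aug G M : 'M[F]_n := (\sum_(g in G) M *m ('P g - 1%:M))%MS.
Definition stable G M := forall g, g \in G -> (M *m 'P g <= M)%MS.
(** The rows of M are functions constant on Z-orbits and supported on O, so M lives in the
    permutation module of the Z-orbits in O. *)
Definition fixed_on (Z : {set 'S_n}) O M :=
  (forall z, z \in Z -> M *m 'P z = M) /\ (forall i j, j \notin O -> M i j = 0).
(* The number of generators of M as a G-module modulo N. *)
Definition rel_rank G M N := (\rank M - \rank (N + aug G M)%MS)%N.
(** The induction needs whole chains: filtering one module by a chief element yields nested layers,
    and generators of the larger layer are counted only modulo the smaller one. *)
Fixpoint chain_rank G N (s : seq 'M[F]_n) : nat :=
  if s is M :: s' then (rel_rank G M N + chain_rank G M s')%N else 0%N.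

Lemma rel_rank_anti G M N N' : (N <= N')%MS -> (rel_rank G M N' <= rel_rank G M N)%N.
Proof. by move=> sNN'; apply: leq_sub2l; apply: mxrankS; apply: addsmxS. Qed.

Lemma aug_sub G M : stable G M -> (aug G M <= M)%MS.
Proof.
move=> sM; apply/sumsmx_subP=> g gG.
by rewrite mulmxBr mulmx1 addmx_sub ?sM // eqmx_opp.
Qed.

Lemma chain_rank_anti G N N' s : (N <= N')%MS -> (chain_rank G N' s <= chain_rank G N s)%N.
Proof. by move=> sNN'; case: s => //= M s; rewrite leq_add2r rel_rank_anti. Qed.

Lemma chain_rank_last G N s : path (fun A B : 'M[F]_n => (A <= B)%MS) N s ->
  (chain_rank G N s + \rank N <= \rank (last N s))%N.
Proof.
elim: s N => [|M s IH] N //= /andP[sNM ps].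
apply: leq_trans (IH M ps); rewrite addnAC addnC leq_add2l /rel_rank.
have : (\rank N <= \rank (N + aug G M)%MS)%N by rewrite mxrankS ?addsmxSl.
have := mxrankS sNM; lia.
Qed.

Section Layers.
Variables (G Z : {group 'S_n}) (O : {set 'I_n}) (z : 'S_n).
Hypotheses (sZG : Z \subset G) (nZ : G \subset 'N(Z)) (zG : z \in G) (zp : (z ^+ p)%g \in Z).
Hypothesis zc : forall g, g \in G -> [~ z, g] \in Z.
Hypothesis actO : forall g i, g \in G -> (g i \in O) = (i \in O).

Local Notation fx := (fixed_on Z O).
Let th : 'M[F]_n := 'P z - 1%:M.

Lemma mulmx_permE m (A : 'M[F]_(m, n)) (g : 'S_n) i j : (A *m 'P g) i (g j) = A i j.
Proof.
rewrite mxE (bigD1 j) //= big1 => [|k kj]; first by rewrite !mxE eqxx mulr1 addr0.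
by rewrite !mxE (inj_eq perm_inj) (negPf kj) mulr0.
Qed.

Lemma fixed_perm M g : fx M -> g \in G -> fx (M *m 'P g).
Proof.
case=> Mz MO gG; split=> [y yZ|i j jO].
  have ygZ : (y ^ g^-1)%g \in Z by rewrite memJ_norm // groupV (subsetP nZ).
  by rewrite -mulmxA -perm_mxM (conjgCV g y) perm_mxM mulmxA (Mz _ ygZ).
by rewrite -(permKV g j) mulmx_permE MO // -(actO _ gG) permKV.
Qed.

Lemma fixed_add M N : fx M -> fx N -> fx (M + N).
Proof.
by case=> Mz MO [Nz NO]; split=> [y yZ|i j jO]; rewrite ?mulmxDl ?Mz ?Nz // mxE MO ?NO ?addr0.
Qed.

Lemma fixed_opp M : fx M -> fx (- M).
Proof. by case=> Mz MO; split=> [y yZ|i j jO]; rewrite ?mulNmx ?Mz // mxE MO ?oppr0. Qed.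

Lemma fixed_th M : fx M -> fx (M *m th).
Proof. by move=> fM; rewrite mulmxBr mulmx1; apply: fixed_add (fixed_opp fM); apply: fixed_perm. Qed.

Lemma thSr k : th ^+ k.+1 = th ^+ k *m th. Proof. exact: exprSr. Qed.
Lemma thSl k : th ^+ k.+1 = th *m th ^+ k. Proof. exact: exprS. Qed.
Lemma th0 : th ^+ 0 = 1%:M. Proof. exact: expr0. Qed.

Lemma fixed_thX k M : fx M -> fx (M *m th ^+ k).
Proof.
elim: k M => [|k IH] M fM; first by rewrite th0 mulmx1.
by rewrite thSr mulmxA; apply: fixed_th; apply: IH.
Qed.

Lemma fixed_mul M (A : 'M[F]_n) : fx M -> fx (A *m M).
Proof.
case=> Mz MO; split=> [y yZ|i j jO]; first by rewrite -mulmxA Mz.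
by rewrite mxE big1 // => k _; rewrite MO ?mulr0.
Qed.

Lemma fixed_sub M N : fx M -> (N <= M)%MS -> fx N.
Proof. by move=> fM /submxP[A ->]; apply: fixed_mul. Qed.

Lemma th_comm M g : fx M -> g \in G -> M *m th *m 'P g = M *m 'P g *m th.
Proof.
move=> fM gG; have [Mz _] := fixed_perm fM (groupM gG zG).
have E : M *m 'P z *m 'P g = M *m 'P g *m 'P z.
  have := Mz _ (zc gG); rewrite perm_mxM -!mulmxA -!perm_mxM => <-.
  by rewrite [in LHS]commgC -mulgA.
by rewrite (mulmxBr M ('P z)) mulmx1 mulmxBl E (mulmxBr (M *m 'P g) ('P z)) mulmx1.
Qed.

Lemma thX_comm k M g : fx M -> g \in G -> M *m th ^+ k *m 'P g = M *m 'P g *m th ^+ k.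
Proof.
move=> fM gG; elim: k => [|k IH]; first by rewrite th0 !mulmx1.
by rewrite thSr !mulmxA th_comm ?IH //; apply: fixed_thX.
Qed.

Lemma thX_aug k M g : fx M -> g \in G -> M *m th ^+ k *m ('P g - 1%:M) = M *m ('P g - 1%:M) *m th ^+ k.
Proof. by move=> fM gG; rewrite (mulmxBr (M *m th ^+ k)) mulmx1 (mulmxBr M) mulmx1 mulmxBl thX_comm. Qed.

Lemma thp0 M : fx M -> M *m th ^+ p = 0.
Proof.
by move=> [Mz _]; rewrite perm_mx_subXp // mulmxBr mulmx1 Mz // subrr.
Qed.

(** The quotient of M :&: ker th^(k+1) by M :&: ker th^k, realised through th^k inside the kernel of
    th. *)
Definition layer k M : 'M[F]_n := (M :&: kermx (th ^+ k.+1))%MS *m th ^+ k.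

Lemma layerS k M N : (M <= N)%MS -> (layer k M <= layer k N)%MS.
Proof. by move=> sMN; apply: submxMr; apply: capmxS. Qed.

Lemma layer_fixed k M : fx M -> fx (layer k M).
Proof. by move=> fM; apply: fixed_thX; apply: fixed_sub fM _; exact: capmxSl. Qed.

Lemma layer_th k M : layer k M *m th = 0.
Proof. by rewrite -mulmxA -thSr; apply/sub_kermxP; exact: capmxSr. Qed.

Lemma layer_sub k N (A : 'M[F]_n) :
  (A <= N)%MS -> A *m th ^+ k.+1 = 0 -> (A *m th ^+ k <= layer k N)%MS.
Proof. by move=> sAN Ak; apply: submxMr; rewrite sub_capmx sAN; apply/sub_kermxP. Qed.

Lemma layer_ker k M : (M :&: kermx (th ^+ k.+1))%MS *m th ^+ k.+1 = 0.
Proof. by apply/sub_kermxP; exact: capmxSr. Qed.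

Lemma layer_stable k M : fx M -> stable G M -> stable G (layer k M).
Proof.
move=> fM sM g gG; set A := (M :&: kermx (th ^+ k.+1))%MS; have fA : fx A by apply: fixed_sub fM (capmxSl _ _).
rewrite /layer -/A thX_comm //; apply: layer_sub; last by rewrite -thX_comm // layer_ker mul0mx.
by apply: submx_trans (sM g gG); apply: submxMr; exact: capmxSl.
Qed.

Lemma layer_aug k M N : fx M -> (aug G M <= N)%MS -> (aug G (layer k M) <= layer k N)%MS.
Proof.
move=> fM sMN; apply/sumsmx_subP=> g gG; set A := (M :&: kermx (th ^+ k.+1))%MS.
have fA : fx A by apply: fixed_sub fM (capmxSl _ _).
rewrite /layer -/A thX_aug //; apply: layer_sub; last by rewrite -thX_aug // layer_ker mul0mx.
apply: submx_trans sMN; apply: submx_trans (sumsmx_sup g gG (submx_refl _)).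
by apply: submxMr; exact: capmxSl.
Qed.

(** One factor z - 1 of th^(k+1) already takes M into [aug G M], hence into N. *)
Lemma layer_next k M N : (aug G M <= N)%MS -> (layer k.+1 M <= layer k N)%MS.
Proof.
move=> sMN; have A0 := layer_ker k.+1 M; have sAM := capmxSl M (kermx (th ^+ k.+2)).
rewrite {1}/layer; move: (M :&: kermx (th ^+ k.+2))%MS A0 sAM => A A0 sAM.
rewrite (thSl k) mulmxA; apply: (@layer_sub k N (A *m th)); last first.
  by rewrite -mulmxA -(thSl k.+1).
apply: submx_trans sMN; apply: submx_trans (sumsmx_sup z zG (submx_refl _)).
by apply: submxMr.
Qed.

Lemma rank_layers M : fx M -> \rank M = (\sum_(k < p) \rank (layer k M))%N.
Proof.
move=> fM; have H j : \rank (M :&: kermx (th ^+ j))%MS = (\sum_(k < j) \rank (layer k M))%N.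
  elim: j => [|j IH].
    rewrite big_ord0 th0; apply/eqP; rewrite mxrank_eq0 -submx0.
    apply: submx_trans (capmxSr _ _) _; rewrite submx0; apply/eqP.
    by rewrite -[LHS]mulmx1; apply/sub_kermxP.
  rewrite big_ord_recr /= -IH addnC -(mxrank_mul_ker (M :&: kermx (th ^+ j.+1))%MS (th ^+ j)) -/(layer j M); congr (_ + _)%N.
  apply/eqP; rewrite eqn_leq; apply/andP; split; apply: mxrankS; rewrite !sub_capmx.
    rewrite (submx_trans (capmxSl _ _) (capmxSl _ _)) /=; exact: capmxSr.
  rewrite (capmxSl M) (capmxSr M) /= andbT; apply/sub_kermxP; rewrite (thSr j) mulmxA.
  by rewrite [X in X *m _](_ : _ = 0) ?mul0mx //; apply/sub_kermxP; exact: capmxSr.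
rewrite -H; apply/eqP; rewrite eqn_leq; apply/andP; split; apply: mxrankS; last exact: capmxSl.
by rewrite sub_capmx submx_refl; apply/sub_kermxP; exact: thp0.
Qed.

(** Ranks add up over the layers, and layer k of N + aug M contains both [X k] and the augmentation
    part of layer k of M. *)
Lemma rel_rank_layers M N (X : nat -> 'M[F]_n) : fx M -> stable G M -> (N <= M)%MS ->
  (forall k, (X k <= layer k (N + aug G M)%MS)%MS) ->
  (rel_rank G M N <= \sum_(k < p) rel_rank G (layer k M) (X k))%N.
Proof.
move=> fM sM sNM sX; rewrite /rel_rank; set N' := (N + aug G M)%MS.
have sN'M : (N' <= M)%MS by rewrite addsmx_sub sNM aug_sub.
rewrite (rank_layers fM) (rank_layers (fixed_sub fM sN'M)).
rewrite -sumnB => [|k _]; last by apply: mxrankS; apply: layerS.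
apply: leq_sum => k _; apply: leq_sub2l; apply: mxrankS.
by rewrite addsmx_sub sX layer_aug // addsmxSr.
Qed.

Lemma layer1_sub0 M : stable G M -> (layer 1 M <= layer 0 M)%MS.
Proof. by move=> sM; apply: layer_next; apply: aug_sub. Qed.

Lemma chain_rank_layers N s : path (fun A B : 'M[F]_n => (A <= B)%MS) N s ->
  (forall M, M \in s -> fx M /\ stable G M) ->
  (chain_rank G N s <= \sum_(k < p) chain_rank G (layer k N) (map (layer k) s))%N.
Proof.
elim: s N => [|M s IH] N //= /andP[sNM ps] sP.
rewrite big_split /=; have [fM sM] := sP M (mem_head _ _).
apply: leq_add; last by apply: IH => // M' M's; apply: sP; rewrite inE M's orbT.
by apply: (rel_rank_layers (X := fun k => layer k N)) => // k; apply: layerS; exact: addsmxSl.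
Qed.

(* Filter by the kernels of the powers of z - 1, which is nilpotent of order p
   on vectors fixed by Z. The layers are fixed by z, and layer 1 of M lies in
   layer 0 of M, so that these two chains can be linked. *)
Lemma chain_rank_split M s : path (fun A B : 'M[F]_n => (A <= B)%MS) M s ->
  (forall M', M' \in M :: s -> fx M' /\ stable G M') ->
  (chain_rank G 0 (M :: s) <=
     chain_rank G 0 (layer 1 M :: layer 0 M :: map (layer 0) s) +
     chain_rank G 0 (map (layer 1) s) +
     \sum_(2 <= k < p) chain_rank G 0 (map (layer k) (M :: s)))%N.
Proof.
move=> ps sP; have [fM sM] := sP M (mem_head _ _).
have p1 := prime_gt1 pr; pose X (k : nat) : 'M[F]_n := if k is 0%N then layer 1 M else 0.
have HX k : (X k <= layer k ((0%R : 'M[F]_n) + aug G M)%MS)%MS.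
  by case: k => [|k]; rewrite /X ?sub0mx //; apply: layer_next; exact: addsmxSr.
have H1 := rel_rank_layers fM sM (sub0mx _ _) HX.
have H2 : (chain_rank G M s <= \sum_(k < p) chain_rank G (layer k M) (map (layer k) s))%N.
  by apply: chain_rank_layers => // M' M's; apply: sP; rewrite inE M's orbT.
rewrite /= -/(chain_rank _ _ _); apply: (leq_trans (leq_add H1 H2)).
rewrite -!(big_mkord xpredT (fun k => rel_rank G (layer k M) (X k))).
rewrite -!(big_mkord xpredT (fun k => chain_rank G (layer k M) (map (layer k) s))).
rewrite !(big_ltn (ltnW p1)) !(big_ltn p1) /= -!/(chain_rank _ _ _) big_split /=.
have H3 : (chain_rank G (layer 1 M) (map (layer 1) s) <= chain_rank G 0 (map (layer 1) s))%N.
  by apply: chain_rank_anti; exact: sub0mx.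
set a := rel_rank _ _ _; set b := rel_rank _ (layer 1 M) _.
have -> : (\sum_(2 <= i < p) rel_rank G (layer i M) (X i) = \sum_(2 <= i < p) rel_rank G (layer i M) 0)%N.
  by apply: eq_big_nat => [[|i]].
move: H3; set c := chain_rank _ _ _; set d := chain_rank _ 0 _; set e := chain_rank _ _ _.
move: (\sum_(2 <= i < p) _)%N (\sum_(2 <= i < p) _)%N => u v; clear; lia.
Qed.
End Layers.
End PermModule.

Local Close Scope ring_scope.

(** z lifts an element of order p in the centre of G / Z. *)
Lemma pgroup_chief_step p (gT : finGroupType) (G Z : {group gT}) :
  prime p -> p.-group G -> Z <| G -> Z :!=: G ->
  exists z, [/\ z \in G, z \notin Z, z ^+ p \in Z & forall g, g \in G -> [~ z, g] \in Z].
Proof.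
move=> pr pG nsZG neqZG; have nZG := normal_norm nsZG.
have pQ : p.-group (G / Z) := quotient_pgroup Z pG.
have ntQ : G / Z != 1.
  by apply: contra neqZG => /eqP/trivgP; rewrite quotient_sub1 // => sGZ; rewrite eqEsubset normal_sub.
have ntC : 'Z(G / Z) != 1 by rewrite (center_nil_eq1 (pgroup_nil pQ)).
have [_ dv _] := pgroup_pdiv (pgroupS (center_sub _) pQ) ntC.
have [x xC ox] := Cauchy pr dv.
have /setIP[xQ /centP xc] := xC.
have /morphimP[z zN zG defx0] := xQ.
have defx : x = coset Z z by exact: defx0.
exists z; split=> //.
- by apply: contraTN (prime_gt1 pr) => zZ; rewrite -ox defx coset_id // order1.
- by apply: coset_idr; rewrite ?groupX // morphX //= -defx -ox expg_order.
move=> g gG; have gN := subsetP nZG g gG.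
apply: coset_idr; first by rewrite groupR.
rewrite morphR //= -defx; apply/eqP/commgP; apply: xc; exact: mem_quotient.
Qed.

Section ChiefStep.
Variables (p : nat) (T : finType) (G Z : {group {perm T}}) (z : {perm T}).
Hypotheses (pr : prime p) (pG : p.-group G) (nsZG : Z <| G).
Hypotheses (zG : z \in G) (zZ : z \notin Z) (zp : z ^+ p \in Z).
Hypothesis zc : forall g, g \in G -> [~ z, g] \in Z.

Lemma chief_join_normal : Z <*> <[z]> <| G.
Proof.
apply/andP; split; first by rewrite join_subG normal_sub // cycle_subG.
apply/subsetP=> g gG; rewrite inE; apply/subsetP=> _ /imsetP[y yZ' ->].
move: yZ'; rewrite norm_joinEr; last by rewrite cycle_subG (subsetP (normal_norm nsZG)).
case/mulsgP=> a b aZ /cycleP[k ->] ->; rewrite -norm_joinEr; last by rewrite cycle_subG (subsetP (normal_norm nsZG)).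
rewrite conjMg conjXg.
have zg : z ^ g \in Z <*> <[z]>.
  rewrite conjg_mulR groupM //; first by rewrite mem_gen // inE cycle_id orbT.
  by rewrite mem_gen // inE zc.
rewrite groupM ?groupX // mem_gen // inE memJ_norm ?aZ // (subsetP (normal_norm nsZG)) //.
Qed.

Lemma chief_join_index : #|Z <*> <[z]> : Z| = p.
Proof.
have zN : z \in 'N(Z) by rewrite (subsetP (normal_norm nsZG)).
rewrite norm_joinEr ?cycle_subG // -card_quotient; last first.
  by rewrite mul_subG ?normG ?cycle_subG.
rewrite quotientMidl quotient_cycle // -orderE.
have e : coset Z (z ^+ p) = coset Z z ^+ p by exact: morphX.
have : #[coset Z z] %| p by rewrite order_dvdn -e coset_id.
case/primeP: pr => _ H /H /orP[|/eqP //]; rewrite order_eq1 => /eqP/coset_idr.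
by move/(_ zN)=> zZ'; case/negP: zZ.
Qed.

(** The stabiliser of w in Z <*> <[z]> contains the one in Z with index p, which keeps the orbit, or
    with index 1, which multiplies it by p. *)
Lemma chief_orbit w :
  #|orbit 'P (Z <*> <[z]>) w| = #|orbit 'P Z w| \/
  #|orbit 'P (Z <*> <[z]>) w| = (p * #|orbit 'P Z w|)%N.
Proof.
set Z' := Z <*> <[z]>; pose C := 'C_Z'[w | 'P]; pose C0 := 'C_Z[w | 'P].
have sZZ' : Z \subset Z' by exact: joing_subl.
have C0E : C0 = Z :&: C by rewrite /C0 /C setIA (setIidPl sZZ').
have sC0C : C0 \subset C by rewrite C0E subsetIr.
have h1 := card_orbit 'P Z w; have h2 := card_orbit 'P [group of Z'] w.
have l1 : (#|C0| * #|orbit 'P Z w|)%N = #|Z| by rewrite h1 Lagrange // subsetIl.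
have l2 : (#|C| * #|orbit 'P Z' w|)%N = #|Z'| by rewrite h2 Lagrange // subsetIl.
have l3 : (#|Z| * p)%N = #|Z'| by rewrite -chief_join_index Lagrange.
have pZ' : p.-group Z' := pgroupS (normal_sub chief_join_normal) pG.
have l4 : (#|C0| * #|C : C0|)%N = #|C| := Lagrange sC0C.
have le : #|C : C0| <= p.
  have CS0 : 0 < #|C0| * #|Z| by rewrite muln_gt0 !cardG_gt0.
  rewrite -(leq_pmul2l CS0) mulnAC l4 -mulnA l3 {1}C0E.
  have := mul_cardG Z [group of C]; rewrite mulnC => ->; rewrite mulnC leq_mul2l; apply/orP; right.
  by rewrite subset_leq_card // mul_subG // subsetIl.
have /p_natP[k ck] : p.-nat #|C : C0|.
  by apply: pnat_dvd (dvdn_indexg _ _) (pgroupS (subsetIl _ _) pZ').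
have c0 : 0 < #|C0| by exact: cardG_gt0.
have : k <= 1 by rewrite -(@leq_exp2l p) ?prime_gt1 // -ck expn1.
rewrite ck in l4; case: k ck l4 => [|[|//]] _; rewrite ?expn0 ?expn1 ?muln1 => l4 _; [right|left].
  apply/eqP; rewrite -(eqn_pmul2l c0) {1}l4 l2 -l3 -l1; apply/eqP; ring.
apply/eqP; rewrite -(@eqn_pmul2l (#|C0| * p)) ?muln_gt0 ?c0 ?prime_gt0 // l4 l2 -l3 -l1 -l4; apply/eqP; ring.
Qed.
End ChiefStep.

Section ModuleBound.
Variables (p n : nat) (G : {group 'S_n}) (O : {set 'I_n}) (w : 'I_n).
Hypotheses (pr : prime p) (pG : p.-group G) (defO : O = orbit 'P G w).

Let actO g i : g \in G -> (g i \in O) = (i \in O).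
Proof. by move=> gG; rewrite defO; exact: (acts_act (acts_orbit 'P w (subsetT G)) gG). Qed.

(** Equality of the two orbits of w carries over by conjugation to every point of O, and functions
    fixed by Z are constant on Z-orbits. *)
Lemma orbit_fixed (Z Z' : {group 'S_n}) (M : 'M['F_p]_n) : Z \subset Z' -> Z <| G -> Z' <| G ->
  #|orbit 'P Z' w| = #|orbit 'P Z w| -> fixed_on Z O M -> fixed_on Z' O M.
Proof.
move=> sZZ' nsZ nsZ' eqc [Mz MO]; split=> // z zZ'.
have eqO : orbit 'P Z' w = orbit 'P Z w.
  by apply/esym/eqP; rewrite eqEcard eqc leqnn andbT; apply: imsetS.
apply/matrixP=> i j'; rewrite -(permKV z j'); move: (z^-1 j') => j.
rewrite mulmx_permE; have zG := subsetP (normal_sub nsZ') z zZ'.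
have [jO|jO] := boolP (j \in O); last by rewrite !MO ?actO.
move: jO; rewrite defO => /orbitP[g gG /= gw]; rewrite /aperm in gw.
have zgZ : z ^ g^-1 \in Z' by rewrite memJ_norm // groupV (subsetP (normal_norm nsZ')).
have : (z ^ g^-1) w \in orbit 'P Z' w by apply/orbitP; exists (z ^ g^-1).
rewrite eqO => /orbitP[y yZ /= ywE]; rewrite /aperm conjgE invgK !permM gw in ywE.
have yg : y ^ g \in Z by rewrite memJ_norm // (subsetP (normal_norm nsZ)).
have -> : z j = (y ^ g) j by rewrite conjgE !permM -[in RHS]gw permK ywE permKV.
by rewrite -[in LHS](mulmx_permE M (y ^ g)) Mz.
Qed.

(** Induction up a chief series from Z to G, with p^i the number of Z-orbits in O. A step that keeps
    the orbits changes nothing; a step that fuses them in classes of p pairs [chain_rank_split] with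
    the recursion of [walks]. At Z = G only multiples of the indicator of O are left, of total rank
    at most 1. *)
Lemma chain_rank_walks (Z : {group 'S_n}) i (s : seq 'M['F_p]_n) :
  Z <| G -> (#|orbit 'P Z w| * p ^ i)%N = #|O| ->
  path (fun A B : 'M['F_p]_n => (A <= B)%MS) 0%R s ->
  (forall M, M \in s -> fixed_on Z O M /\ stable G M) ->
  chain_rank G 0%R s <= walks p (size s) i.
Proof.
have [m] := ubnP #|G : Z|; elim: m Z i s => // m IH Z i s ltm nsZ ci ps sP.
have [eqZG|neqZG] := eqVneq (Z : {set _}) G.
  have i0 : i = 0.
    move: ci; rewrite eqZG -defO => ci; apply/eqP; rewrite -(@eqn_exp2l p) ?prime_gt1 // expn0.
    rewrite -(@eqn_pmul2l #|O|) ?ci ?muln1 //; apply/card_gt0P; exists w.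
    by rewrite defO orbit_refl.
  rewrite {}i0; case: s ps sP => // M s ps sP.
  have := chain_rank_last pr G ps; rewrite mxrank0 addn0 => /leq_trans; apply.
  rewrite /= ; have := sP _ (mem_last M s); move: (last M s) => L [[Lz LO] _].
  have -> : L = (col w L *m \row_j (j \in O)%:R)%R.
    apply/matrixP=> a b; rewrite !mxE big_ord1 !mxE; have [bO|bO] := boolP (b \in O); last by rewrite mulr0 LO.
    rewrite mulr1; move: bO; rewrite defO => /orbitP[g gG /= <-].
    by have := Lz g; rewrite eqZG => /(_ gG)/matrixP/(_ a (g w)); rewrite mulmx_permE.
  by apply: leq_trans (mxrankM_maxl _ _) (rank_leq_col _).
have [z [zG zZ zp zc]] := pgroup_chief_step pr pG nsZ neqZG.
set Z' := [group of Z <*> <[z]>].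
have nsZ' : Z' <| G by exact: chief_join_normal.
have sZZ' : Z \subset Z' by exact: joing_subl.
have iZ' : #|Z' : Z| = p by exact: (chief_join_index pr nsZ zG zZ zp).
have ltm' : #|G : Z'| < m.
  have := Lagrange_index (normal_sub nsZ') sZZ'; rewrite iZ' => e; rewrite -e in ltm.
  have := prime_gt1 pr; have := indexg_gt0 G Z'; move: ltm; move: #|G : Z'| => x; rewrite ltnS; clear; nia.
have [eqo|grow] := chief_orbit pr pG nsZ zG zZ zp zc w.
  apply: (IH Z') => //; first by rewrite -ci -eqo.
  by move=> M /sP[fM sM]; split=> //; apply: orbit_fixed fM.
have i_gt0 : 0 < i.
  case: i ci => // ci; rewrite expn0 muln1 in ci; have : #|orbit 'P Z' w| <= #|O|.
    by apply: subset_leq_card; rewrite defO; apply: imsetS; exact: normal_sub.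
  have : 0 < #|O| by apply/card_gt0P; exists w; rewrite defO orbit_refl.
  rewrite [#|orbit _ _ _|]grow ci; have := prime_gt1 pr; move: #|O| => x; clear; nia.
case: i i_gt0 ci => // i _ ci.
have ci' : (#|orbit 'P Z' w| * p ^ i)%N = #|O| by rewrite [#|orbit _ _ _|]grow -ci expnS; ring.
have nZ := normal_norm nsZ.
case: s ps sP => [//|M s] /= /andP[_ ps] sP.
pose L k := layer z k : 'M['F_p]_n -> 'M['F_p]_n.
have LP k A : fixed_on Z O A /\ stable G A -> fixed_on Z' O (L k A) /\ stable G (L k A).
  move=> [fA sA]; have fLA := layer_fixed nZ zG actO k fA.
  split; last exact: layer_stable fA sA.
  case: (fLA) => Lz LO; split=> // y.
  have gS : group_set [set y : 'S_n | (L k A *m perm_mx y)%R == L k A].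
    apply/group_setP; split=> [|a b]; rewrite !inE ?perm_mx1 ?mulmx1 // => /eqP ha /eqP hb.
    by rewrite perm_mxM mulmxA ha hb.
  have sub : Z' \subset Group gS.
    rewrite join_subG cycle_subG; apply/andP; split; first by apply/subsetP=> a aZ; rewrite inE Lz.
    by rewrite inE -subr_eq0 -[X in (_ - X)%R]mulmx1 -mulmxBr; apply/eqP; exact: layer_th.
  by move=> yZ'; have := subsetP sub y yZ'; rewrite inE => /eqP.
have LS k A B : (A <= B)%MS -> (L k A <= L k B)%MS by exact: layerS.
have [fM sM] := sP M (mem_head _ _).
have sP' A : A \in s -> fixed_on Z O A /\ stable G A by move=> As; apply: sP; rewrite inE As orbT.
have H := chain_rank_split pr nZ zG zp zc actO ps sP.
apply: (leq_trans H); apply: leq_add; first apply: leq_add.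
- have := IH Z' i (L 1%N M :: L 0%N M :: map (L 0%N) s); rewrite /= size_map; apply => //.
    rewrite sub0mx (layer1_sub0 zG sM) /=.
    by apply: (homo_path (e := fun A B : 'M['F_p]_n => (A <= B)%MS)) ps => A B; exact: LS.
  move=> A; rewrite !inE => /or3P[/eqP->|/eqP->|/mapP[B /sP' BP ->]]; apply: LP => //; exact: sP (mem_head _ _).
- have := IH Z' i (map (L 1%N) s); rewrite size_map; apply => //.
    case: s ps {H sP sP'} => //= B s /andP[_ ps]; rewrite sub0mx.
    by apply: (homo_path (e := fun A B : 'M['F_p]_n => (A <= B)%MS)) ps => A C; exact: LS.
  by move=> A /mapP[B /sP' BP ->]; exact: LP.
rewrite -sum_nat_const_nat; apply: leq_sum => k _.
have := IH Z' i (map (L k) (M :: s)); rewrite size_map; apply => //.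
  rewrite /= sub0mx /=.
  by apply: (homo_path (e := fun A B : 'M['F_p]_n => (A <= B)%MS)) ps => A C; exact: LS.
by move=> A /mapP[B /sP BP ->]; exact: LP.
Qed.
End ModuleBound.

(** [N1, G] lies in Phi(G), so in G / Phi(G) the factor N1 / N2 contributes at most the index of N2
    [N1, G]. *)
Lemma logn_quo_Phi_step (p : nat) (gT : finGroupType) (G N1 N2 : {group gT}) :
  p.-group G -> N1 <| G -> N2 <| G -> N2 \subset N1 ->
  logn p #|N1 / 'Phi(G)| <= logn p #|N2 / 'Phi(G)| + logn p #|N1 : N2 <*> [~: N1, G]|.
Proof.
move=> pG nsN1 nsN2 sN21; set K := [~: N1, G].
have sK1 : K \subset N1 by rewrite commg_subl normal_norm.
have sKP : K \subset 'Phi(G).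
  rewrite (Phi_joing pG); apply: subset_trans (joing_subl _ _).
  by rewrite derg1 commSg // normal_sub.
have nPhi : G \subset 'N('Phi(G)) := normal_norm (Phi_normal G).
have nP1 : N1 \subset 'N('Phi(G)) := subset_trans (normal_sub nsN1) nPhi.
have nP2 : N2 \subset 'N('Phi(G)) := subset_trans (normal_sub nsN2) nPhi.
have nKN2 : N2 \subset 'N(K).
  by apply: subset_trans (normal_sub nsN2) _; rewrite normsR ?normG ?normal_norm.
have HE : (N2 <*> K) / 'Phi(G) = N2 / 'Phi(G).
  rewrite norm_joinEl // quotientMl // (quotientS1 sKP) mulg1 //.
have sH1 : N2 <*> K \subset N1 by rewrite join_subG sN21.
have L := Lagrange (quotientS 'Phi(G) sH1).
rewrite -[in leqLHS]L lognM ?cardG_gt0 // [X in logn p X](congr1 (fun A : {set _} => #|A|) HE) leq_add2l dvdn_leq_log //.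
by apply: (@index_quotient _ N1 'Phi(G)%G [group of N2 <*> K]); rewrite subIset // nP1.
Qed.

(** f identifies N1 / N2 with a submodule of the permutation module, and the image of [N1, G]
    contains its augmentation part. Group generators thus become module generators. *)
Lemma logn_quo_Phi_rel_rank (p n : nat) (G N1 N2 : {group 'S_n}) (f : {morphism N1 >-> 'rV['F_p]_n}) :
  prime p -> p.-group G -> N1 <| G -> N2 <| G -> 'ker f = N2 ->
  (forall x g, x \in N1 -> g \in G -> f (x ^ g) = (f x *m perm_mx g)%R) ->
  logn p #|N1 / 'Phi(G)| <= logn p #|N2 / 'Phi(G)| + rel_rank G (rowg_mx (f @* N1)) 0%R.
Proof.
move=> pr pG nsN1 nsN2 kerf feq.
have sN21 : N2 \subset N1 by rewrite -kerf subsetIl.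
apply: (leq_trans (logn_quo_Phi_step pG nsN1 nsN2 sN21)); rewrite leq_add2l.
set H := N2 <*> [~: N1, G]; set M := rowg_mx _.
have sH1 : H \subset N1 by rewrite join_subG sN21 commg_subl normal_norm.
have augH : (aug G M <= rowg_mx (f @* H))%MS.
  apply/sumsmx_subP => g gG; apply/row_subP => i; rewrite row_mul.
  have : row i M \in rowg M by rewrite mem_rowg row_sub.
  rewrite rowg_mxK => /morphimP[x xN _ ->].
  rewrite mulmxBr mulmx1 -feq // -mem_rowg rowg_mxK.
  have xgN : x ^ g \in N1 by rewrite memJ_norm // (subsetP (normal_norm nsN1)).
  have -> : (f (x ^ g)%g - f x)%R = f ([~ x, g]).
    have cN : [~ x, g] \in N1 by rewrite groupM ?groupV.
    have e : f (x * [~ x, g]) = (f x + f [~ x, g])%R by exact: morphM.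
    by rewrite conjg_mulR e addrC addKr.
  apply: mem_morphim; first by rewrite groupM ?groupV.
  by rewrite mem_gen // inE mem_commg // orbT.
rewrite /rel_rank adds0mx.
have idx := index_morphim_ker f sH1 (subxx N1).
have {idx} idx : #|f @* N1 : f @* H| = #|N1 : H|.
  rewrite -idx; have -> : #|'ker_N1 f : H| = 1%N; last by rewrite muln1.
  have sKH : 'ker f \subset H by rewrite kerf joing_subl.
  by apply/eqP; rewrite indexg_eq1; exact: subset_trans (subsetIr _ _) sKH.
have e := Lagrange (morphimS f sH1); rewrite idx in e.
have {e}e : (p ^ \rank (rowg_mx (f @* H)) * #|N1 : H| = p ^ \rank M)%N.
  have cH := card_rowg (rowg_mx (f @* H)); have cM := card_rowg M.
  rewrite rowg_mxK card_Fp // in cH; rewrite rowg_mxK card_Fp // in cM.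
  by rewrite -cH -cM.
have := congr1 (logn p) e; rewrite lognM ?indexg_gt0 ?expn_gt0 ?prime_gt0 // !pfactorK // => <-.
have le := mxrankS augH.
by rewrite -addnBAC // leq_addl.
Qed.

(** For an orbit O of G and N in G this interpolates between N, at Z = G, and the pointwise
    stabiliser of O in N, at Z = 1. *)
Definition orbit_fix n (N Z : {set 'S_n}) (O : {set 'I_n}) :=
  [set x in N | [forall y in O, x y \in orbit 'P Z y]].

Section OrbitFix.
Variables (p n : nat) (G Z : {group 'S_n}) (O : {set 'I_n}) (w : 'I_n).
Hypotheses (defO : O = orbit 'P G w) (nsZ : Z <| G).
Let c (y : 'I_n) := orbit 'P Z y.

Let actO g i : g \in G -> (g i \in O) = (i \in O).
Proof. by move=> gG; rewrite defO; exact: (acts_act (acts_orbit 'P w (subsetT G)) gG). Qed.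

Lemma orbitZ_eqP (x y : 'I_n) : reflect (c x = c y) (x \in c y).
Proof. exact: orbit_eqP. Qed.

Lemma orbitZ_act g y1 y2 : g \in G -> c y1 = c y2 -> c (g y1) = c (g y2).
Proof.
move=> gG /orbitZ_eqP/orbitP[a aZ /= <-]; apply/orbitZ_eqP/orbitP; exists (a ^ g).
  by rewrite memJ_norm // (subsetP (normal_norm nsZ)).
by rewrite /= /aperm -!permM conjgE !mulgA mulgV mul1g.
Qed.

Lemma orbit_fixP (N : {set 'S_n}) x :
  reflect (x \in N /\ forall y, y \in O -> c (x y) = c y) (x \in orbit_fix N Z O).
Proof.
rewrite inE; apply: (iffP andP) => -[xN H]; split=> //.
  by move=> y yO; apply/orbitZ_eqP; move/forall_inP: H; apply.
by apply/forall_inP=> y yO; apply/orbitZ_eqP; exact: H.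
Qed.

Lemma orbit_fix_group_set (N : {group 'S_n}) : N \subset G -> group_set (orbit_fix N Z O).
Proof.
move=> sNG; apply/group_setP; split; first by apply/orbit_fixP; split=> // y _; rewrite perm1.
move=> a b /orbit_fixP[aN Ha] /orbit_fixP[bN Hb]; apply/orbit_fixP; split; first exact: groupM.
move=> y yO; rewrite permM (orbitZ_act _ (Ha y yO)) ?Hb //; exact: (subsetP sNG).
Qed.

Lemma orbit_fix_norm (N : {group 'S_n}) : N <| G -> G \subset 'N(orbit_fix N Z O).
Proof.
move=> nsN; apply/subsetP=> g gG; rewrite inE; apply/subsetP=> _ /imsetP[a /orbit_fixP[aN Ha] ->].
apply/orbit_fixP; split; first by rewrite memJ_norm // (subsetP (normal_norm nsN)).
move=> y yO; rewrite conjgE !permM.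
have := orbitZ_act gG (Ha (g^-1 y) _); rewrite permKV; apply.
by rewrite actO ?groupV.
Qed.
End OrbitFix.

(** * Displacements of suborbits as a module homomorphism *)

Section Kappa.
Variables (p n : nat) (G Z : {group 'S_n}) (z : 'S_n) (O : {set 'I_n}) (w : 'I_n).
Hypotheses (pr : prime p) (pG : p.-group G) (defO : O = orbit 'P G w).
Hypotheses (nsZG : Z <| G) (zG : z \in G) (zZ : z \notin Z) (zp : z ^+ p \in Z).
Hypothesis zc : forall g, g \in G -> [~ z, g] \in Z.
Hypothesis grow : #|orbit 'P (Z <*> <[z]>) w| = (p * #|orbit 'P Z w|)%N.
Let c (y : 'I_n) := orbit 'P Z y.
Let Z' := [group of Z <*> <[z]>].

Let actO g i : g \in G -> (g i \in O) = (i \in O).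
Proof. by move=> gG; rewrite defO; exact: (acts_act (acts_orbit 'P w (subsetT G)) gG). Qed.

Let cact g y1 y2 : g \in G -> c y1 = c y2 -> c (g y1) = c (g y2).
Proof. exact: orbitZ_act. Qed.

Let zXG k : z ^+ k \in G.
Proof. exact: groupX. Qed.

Lemma orbit_central_act g k y : g \in G -> c (g ((z ^+ k) y)) = c ((z ^+ k) (g y)).
Proof.
move=> gG; elim: k y => [|k IH] y; first by rewrite !perm1.
rewrite expgS !permM IH; apply: cact => //.
apply/orbitZ_eqP/orbitP; exists [~ z, g]; first exact: zc.
rewrite /= /aperm -!permM; congr (fun_of_perm _ _).
by rewrite commgEl conjgE !mulgA mulgK mulgV mul1g.
Qed.

(** If a power of z with exponent prime to p fixed one Z-orbit in O, then z would fix the Z-orbit of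
    w, and the orbit could not grow. *)
Lemma orbit_pow_free k y : y \in O -> c ((z ^+ k) y) = c y -> p %| k.
Proof.
rewrite defO => /orbitP[g gG /= <-] eqk; rewrite /aperm in eqk.
have {}eqk : c ((z ^+ k) w) = c w.
  have := orbit_central_act k w gG; rewrite eqk => /(cact (groupVr gG)).
  by rewrite !permK.
apply: contraT => npk; have cop : coprime k p by rewrite coprime_sym prime_coprime.
have eq1 : c (z w) = c w.
  have k_gt0 : 0 < k by case: (k) npk; rewrite ?dvdn0.
  have iter j : c ((z ^+ (j * k)) w) = c w.
    elim: j => [|j IH]; first by rewrite mul0n perm1.
    by rewrite mulSn expgD permM (cact (zXG (j * k)) eqk) IH.
  have [u v uv _] := egcdnP p k_gt0; rewrite (eqP cop) in uv.
  have := iter u; rewrite uv expgD expg1 mulnC expgM permM => <-.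
  apply: cact => //; apply/esym/orbitZ_eqP/orbitP; exists ((z ^+ p) ^+ v) => //; exact: groupX.
have sub : orbit 'P Z' w \subset orbit 'P Z w.
  apply/subsetP=> _ /orbitP[a aZ' <-] /=; rewrite /aperm; apply/orbitZ_eqP.
  pose S := [set a in G | c (a w) == c w].
  have gS : group_set S.
    apply/group_setP; split=> [|a1 a2]; rewrite !inE ?perm1 ?group1 ?eqxx //.
    case/andP=> a1G /eqP h1 /andP[a2G /eqP h2]; rewrite groupM //= permM.
    by rewrite (cact a2G h1) h2.
  have : Z' \subset Group gS.
    rewrite join_subG cycle_subG; apply/andP; split.
      apply/subsetP=> b bZ; rewrite inE (subsetP (normal_sub nsZG)) //=.
      by apply/eqP/orbitZ_eqP/orbitP; exists b.
    by rewrite inE zG; apply/eqP.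
  by move/subsetP/(_ a aZ'); rewrite inE => /andP[_ /eqP].
have := subset_leq_card sub; rewrite [#|orbit 'P Z' w|]grow.
have : 0 < #|orbit 'P Z w| by apply/card_gt0P; exists w; exact: orbit_refl.
by have := prime_gt1 pr; move: #|orbit 'P Z w| => x; clear; nia.
Qed.

Lemma orbit_pow_eq k l y : y \in O ->
  c ((z ^+ k) y) = c ((z ^+ l) y) -> (k%:R = l%:R :> 'F_p)%R.
Proof.
wlog le_kl : k l / k <= l => [H|] yO e.
  by case/orP: (leq_total k l) => le; [exact: H|apply/esym; exact: H].
have : p %| l - k.
  apply: (@orbit_pow_free _ ((z ^+ k) y)); first by rewrite actO.
  by rewrite -permM -expgD subnKC.
rewrite (dvdn_pcharf (pchar_Fp pr)) natrB // subr_eq0 => /eqP ->//.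
Qed.

Lemma orbit_pow_mod k y : c ((z ^+ k) y) = c ((z ^+ (k %% p)) y).
Proof.
rewrite {1}(divn_eq k p) expgD permM mulnC expgM; apply: cact => //.
by apply/orbitZ_eqP/orbitP; exists ((z ^+ p) ^+ (k %/ p)) => //; exact: groupX.
Qed.

Lemma orbit_join_exp a y : a \in orbit 'P Z' y -> exists k, c a = c ((z ^+ k) y).
Proof.
have zN : z \in 'N(Z) by rewrite (subsetP (normal_norm nsZG)).
have czN : <[z]> \subset 'N(Z) by rewrite cycle_subG.
case/orbitP=> b; rewrite /= norm_joinEr // -(normC czN).
case/mulsgP=> _ d /cycleP[k ->] dZ -> <-; rewrite /aperm permM.
by exists k; apply/orbitZ_eqP/orbitP; exists d.
Qed.

(* x maps the Z-orbit of y to its image under [z ^+ kappa_exp x y]. *)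
Definition kappa_exp (x : 'S_n) (y : 'I_n) : 'F_p :=
  if [pick k : 'I_p | c (x y) == c ((z ^+ k) y)] is Some k then (k%:R)%R else 0%R.

Lemma kappa_expE (x : 'S_n) y k : y \in O -> c (x y) = c ((z ^+ k) y) -> kappa_exp x y = (k%:R)%R.
Proof.
move=> yO e; rewrite /kappa_exp; case: pickP => [l /eqP e'|no].
  by apply: (@orbit_pow_eq _ _ y) => //; rewrite -e' -e.
have kp : k %% p < p by rewrite ltn_mod prime_gt0.
by have := no (Ordinal kp); rewrite /= e -orbit_pow_mod eqxx.
Qed.

Definition kappa (x : 'S_n) : 'rV['F_p]_n := \row_y (if y \in O then kappa_exp x y else 0)%R.

Section KappaMorph.
Variable (N : {group 'S_n}).
Hypothesis nsN : N <| G.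
Let N1 := Group (orbit_fix_group_set O (chief_join_normal nsZG zG zc) (normal_sub nsN)).
Let N2 := Group (orbit_fix_group_set O nsZG (normal_sub nsN)).

Let N1P x : x \in N1 -> x \in G /\ forall y, y \in O -> exists k, c (x y) = c ((z ^+ k) y).
Proof.
rewrite inE => /andP[xN /forall_inP H]; split; first exact: (subsetP (normal_sub nsN)).
by move=> y /H/orbit_join_exp.
Qed.

(** Elements of N1 commute with z modulo Z, so each displacement is the same on all Z-orbits of one
    Z'-orbit, and displacements add. *)
Lemma kappa_morph : {in N1 &, {morph kappa : x y / x * y >-> (x + y)%R}}.
Proof.
move=> a b /N1P[aG Ha] /N1P[bG Hb]; apply/rowP=> y; rewrite !mxE.
case: ifP => yO; last by rewrite addr0.
have [k ek] := Ha y yO; have [l el] := Hb y yO.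
rewrite (kappa_expE yO ek) (kappa_expE yO el) -natrD.
apply: kappa_expE => //; rewrite permM (cact bG ek) orbit_central_act //.
by rewrite (cact (zXG k) el) -permM -expgD addnC.
Qed.

Canonical kappa_morphism := Morphism kappa_morph.

Lemma ker_kappa : 'ker kappa = N2.
Proof.
apply/setP=> x; apply/idP/idP.
  case/morphpreP=> xN1 /set1P k0; apply/orbit_fixP.
  have [xG H] := N1P xN1; split; first by move: xN1; rewrite inE => /andP[].
  move=> y yO; have [k ek] := H y yO.
  have := congr1 (fun v : 'rV_n => v ord0 y) k0; rewrite !mxE yO (kappa_expE yO ek).
  move=> k00; rewrite -/(c _) ek; move/eqP: k00; rewrite -(dvdn_pcharf (pchar_Fp pr)) => /dvdnP[j ->].
  by rewrite orbit_pow_mod modnMl perm1.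
move/orbit_fixP => [xN H]; have xN1 : x \in N1.
  rewrite inE xN; apply/forall_inP=> y yO; have /orbitZ_eqP/orbitP[a aZ e] := H y yO.
  by apply/orbitP; exists a => //; rewrite mem_gen // inE aZ.
apply/morphpreP; split=> //; apply/set1P/rowP=> y; rewrite !mxE; case: ifP => // yO.
by apply: (@kappa_expE x y 0) => //; rewrite perm1; exact: H.
Qed.

Lemma kappa_conj x g : x \in N1 -> g \in G -> kappa (x ^ g) = (kappa x *m perm_mx g)%R.
Proof.
move=> /N1P[xG H] gG; apply/rowP=> y'; rewrite -(permKV g y'); move: (g^-1 y') => y.
rewrite mulmx_permE !mxE actO //; case: ifP => // yO.
have [k ek] := H y yO; rewrite (kappa_expE yO ek); apply: kappa_expE; first by rewrite actO.
by rewrite conjgE !permM permK (cact gG ek) orbit_central_act.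
Qed.

Let nsN1 : N1 <| G.
Proof.
apply/andP; split; last exact: (orbit_fix_norm defO (chief_join_normal nsZG zG zc) nsN).
by apply/subsetP=> x /N1P[].
Qed.

Let nsN2 : N2 <| G.
Proof.
apply/andP; split; last exact: (orbit_fix_norm defO nsZG nsN).
by apply/subsetP=> x; rewrite inE => /andP[xN _]; exact: (subsetP (normal_sub nsN)).
Qed.

Let M := rowg_mx (kappa @* N1).

Let rowM i : exists2 x, x \in N1 & row i M = kappa x.
Proof.
have : row i M \in rowg M by rewrite mem_rowg row_sub.
by rewrite rowg_mxK => /morphimP[x xN _ ->]; exists x.
Qed.

Lemma kappa_fixed : fixed_on Z' O M.
Proof.
split=> [a aZ'|i j jO]; last first.
  have [x xN e] := rowM i; have := congr1 (fun v : 'rV_n => v ord0 j) e.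
  by rewrite !mxE (negPf jO).
apply/row_matrixP=> i; rewrite row_mul; have [x xN ->] := rowM i.
have aG : a \in G by rewrite (subsetP (normal_sub (chief_join_normal nsZG zG zc))).
apply/rowP=> y'; rewrite -(permKV a y'); move: (a^-1 y') => y.
rewrite mulmx_permE !mxE actO //; case: ifP => // yO.
have [xG H] := N1P xN; have [k ek] := H y yO; rewrite (kappa_expE yO ek).
apply/esym; apply: kappa_expE; first by rewrite actO.
have [l el] : exists l, c (a y) = c ((z ^+ l) y) by apply: orbit_join_exp; apply/orbitP; exists a.
rewrite (cact xG el) (cact (zXG k) el) orbit_central_act // (cact (zXG l) ek).
by rewrite -!permM -!expgD addnC.
Qed.

Lemma kappa_stable : stable G M.
Proof.
move=> g gG; apply/row_subP=> i; rewrite row_mul; have [x xN ->] := rowM i.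
rewrite -kappa_conj // -mem_rowg rowg_mxK mem_morphim //;
  by rewrite memJ_norm // (subsetP (normal_norm nsN1)).
Qed.

(** [kappa] embeds N1 / N2 as a G-submodule of the functions fixed by Z' on O; it is a chain of
    length one for [chain_rank_walks]. *)
Lemma logn_orbit_fix_grow i : (#|orbit 'P Z' w| * p ^ i)%N = #|O| ->
  logn p #|N1 / 'Phi(G)| <= logn p #|N2 / 'Phi(G)| + walks p 1 i.
Proof.
move=> ci; have := logn_quo_Phi_rel_rank pr pG nsN1 nsN2 ker_kappa kappa_conj.
move/leq_trans; apply; rewrite leq_add2l.
have := chain_rank_walks pr pG defO (chief_join_normal nsZG zG zc) ci (s := [:: M]).
rewrite /= addn0; apply; first by rewrite sub0mx.
by move=> _ /[1!inE] /eqP ->; split; [exact: kappa_fixed|exact: kappa_stable].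
Qed.
End KappaMorph.
End Kappa.

Section OrbitSum.
Variables (p n : nat) (G : {group 'S_n}).
Hypotheses (pr : prime p) (pG : p.-group G).

(** Climb a chief series from Z to G. [orbit_fix] changes only when the orbits grow, and the step
    after which p^j suborbits remain costs [walks p 1 j]. *)
Lemma logn_orbit_fix (N Z : {group 'S_n}) (w : 'I_n) i : N <| G -> Z <| G ->
  (#|orbit 'P Z w| * p ^ i)%N = #|orbit 'P G w| ->
  logn p #|N / 'Phi(G)| <=
    logn p #|orbit_fix N Z (orbit 'P G w) / 'Phi(G)| + \sum_(j < i) walks p 1 j.
Proof.
move=> nsN; have [m] := ubnP #|G : Z|; elim: m Z i => // m IH Z i ltm nsZ ci.
have [eqZG|neqZG] := eqVneq (Z : {set _}) G.
  have -> : orbit_fix N Z (orbit 'P G w) = N; last by rewrite leq_addr.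
  apply/setP=> x; rewrite inE; apply: andb_idr => xN; apply/forall_inP=> y yO.
  by rewrite eqZG; apply/orbitP; exists x => //; exact: (subsetP (normal_sub nsN)).
have [z [zG zZ zp zc]] := pgroup_chief_step pr pG nsZ neqZG.
set Z' := [group of Z <*> <[z]>].
have nsZ' : Z' <| G by exact: chief_join_normal.
have sZZ' : Z \subset Z' by exact: joing_subl.
have iZ' : #|Z' : Z| = p by exact: (chief_join_index pr nsZ zG zZ zp).
have ltm' : #|G : Z'| < m.
  have := Lagrange_index (normal_sub nsZ') sZZ'; rewrite iZ' => e; rewrite -e in ltm.
  have := prime_gt1 pr; have := indexg_gt0 G Z'; move: ltm; move: #|G : Z'| => x; rewrite ltnS; clear; nia.
have [eqo|grow] := chief_orbit pr pG nsZ zG zZ zp zc w.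
  have ci' : (#|orbit 'P Z' w| * p ^ i)%N = #|orbit 'P G w| by rewrite -ci -eqo.
  have := IH Z' i ltm' nsZ' ci'; congr (_ <= logn p #|_ / _| + _).
  apply/setP=> x; rewrite !inE; congr (_ && _); apply: eq_forallb_in => y /orbitP[g gG /= <-].
  have e Y : Y <| G -> orbit 'P Y (aperm w g) = g @: orbit 'P Y w.
    move=> nsY; apply/setP=> t; apply/orbitP/imsetP.
      case=> b bY <-; exists ((b ^ g^-1) w).
        by apply/orbitP; exists (b ^ g^-1) => //; rewrite memJ_norm // groupV (subsetP (normal_norm nsY)).
      by rewrite /= /aperm conjgE invgK !permM permKV.
    case=> _ /orbitP[b bY <-] ->; exists (b ^ g); first by rewrite memJ_norm // (subsetP (normal_norm nsY)).
    by rewrite /= /aperm conjgE !permM permK.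
  have -> : orbit 'P Z (aperm w g) = orbit 'P Z' (aperm w g); last by [].
  rewrite (e Z nsZ) (e Z' nsZ'); have -> // : orbit 'P Z w = orbit 'P Z' w.
  by apply/eqP; rewrite eqEcard imsetS //= eqo leqnn.
have i_gt0 : 0 < i.
  case: i ci => // ci; rewrite expn0 muln1 in ci; have : #|orbit 'P Z' w| <= #|orbit 'P G w|.
    by apply: subset_leq_card; apply: imsetS; exact: normal_sub.
  have : 0 < #|orbit 'P G w| by apply/card_gt0P; exists w; rewrite orbit_refl.
  rewrite [#|orbit _ Z' _|]grow ci; have := prime_gt1 pr; move: #|orbit 'P G w| => x; clear; nia.
case: i i_gt0 ci => // i _ ci.
have ci' : (#|orbit 'P Z' w| * p ^ i)%N = #|orbit 'P G w| by rewrite [#|orbit _ Z' _|]grow -ci expnS; ring.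
apply: (leq_trans (IH Z' i ltm' nsZ' ci')).
rewrite big_ord_recr /= [X in _ <= _ + X]addnC addnA leq_add2r.
have H := logn_orbit_fix_grow pr pG (erefl (orbit 'P G w)) nsZ zG zp zc grow nsN ci'.
exact: H.
Qed.

Let S w := \sum_(j < logn p #|orbit 'P G w|) walks p 1 j.

(** The orbits are fixed pointwise one after the other, each by [logn_orbit_fix] with trivial Z. The
    subgroup left at the end fixes every point, so it is trivial. *)
Lemma frank_le_orbits (A : {set 'I_n}) : G \subset sym_on A ->
  frank p G <= \sum_(w in orbit_transversal 'P G A) S w.
Proof.
move=> sGA; set X := orbit_transversal 'P G A.
suff [K [nsK fixK leK]] : exists K : {group 'S_n}, [/\ K <| G,
    forall x w y, x \in K -> w \in enum X -> y \in orbit 'P G w -> x y = y &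
    logn p #|G / 'Phi(G)| <= logn p #|K / 'Phi(G)| + \sum_(w <- enum X) S w].
  have actA : [acts G, on A | 'P] by apply/subsetP=> x /(subsetP sGA)/sym_on_acts.
  have [_ _ _ XP] := orbit_transversalP actA.
  have K1 : K :=: 1.
    apply/trivgP/subsetP=> x xK; rewrite inE; apply/eqP/permP=> y; rewrite perm1.
    have [yA|yA] := boolP (y \in A).
      have [a aG ayX] := XP y yA; apply: (fixK _ (aperm y a)) => //; first by rewrite mem_enum.
      by rewrite orbit_sym; apply/orbitP; exists a.
    have := subsetP sGA x (subsetP (normal_sub nsK) x xK); rewrite inE => /out_perm; exact.
  move: leK; rewrite K1 quotient1 cards1 logn1 add0n card_quotient ?normal_norm ?Phi_normal //.
  by rewrite big_enum.
elim: (enum X) => [|w s [K [nsK fixK leK]]].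
  by exists G; rewrite big_nil addn0; split.
have gK := orbit_fix_group_set (orbit 'P G w) (normal1 G) (normal_sub nsK).
have orbit1 y : orbit 'P [1 'S_n] y = [set y] by rewrite /orbit imset_set1 act1.
have c1 : (#|orbit 'P [1 'S_n] w| * p ^ logn p #|orbit 'P G w|)%N = #|orbit 'P G w|.
  rewrite orbit1 cards1 mul1n.
  have /p_natP[m e] : p.-nat #|orbit 'P G w| by apply: pnat_dvd pG; exact: dvdn_orbit.
  by rewrite e pfactorK.
exists (Group gK); split.
- apply/andP; split; last exact: (orbit_fix_norm (erefl _) (normal1 G) nsK).
  by apply/subsetP=> x; rewrite inE => /andP[xK _]; exact: (subsetP (normal_sub nsK)).
- move=> x w' y; rewrite inE => /andP[xK /forall_inP H]; rewrite inE => /predU1P[->|w's] yw.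
    by have := H y yw; rewrite orbit1 inE => /eqP.
  exact: fixK yw.
rewrite big_cons; have := logn_orbit_fix nsK (normal1 G) c1; rewrite -/(S w) /=.
move=> H; apply: (leq_trans leK); rewrite addnA leq_add2r; exact: H.
Qed.
End OrbitSum.

Theorem frank_small_of_large_orbits p k : prime p -> exists e0, forall n (G : {group 'S_n}) (A : {set 'I_n}),
  p.-group G -> G \subset sym_on A -> (forall x, x \in A -> p ^ e0 <= #|orbit 'P G x|) ->
  k * frank p G <= #|A|.
Proof.
move=> pr; have [e0 He0] := sum_walks_small k (prime_gt1 pr); exists e0 => n G A pG sGA large.
apply: leq_trans (leq_mul (leqnn k) (frank_le_orbits pr pG sGA)) _.
set X := orbit_transversal 'P G A.
have actA : [acts G, on A | 'P] by apply/subsetP=> x /(subsetP sGA)/sym_on_acts.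
have [_ sXA Xdis _] := orbit_transversalP actA.
rewrite big_distrr /=; apply: (@leq_trans (\sum_(w in X) #|orbit 'P G w|)).
  apply: leq_sum => w wX.
  have /p_natP[m e] : p.-nat #|orbit 'P G w| by apply: pnat_dvd pG; exact: dvdn_orbit.
  rewrite e pfactorK //; apply: He0.
  by rewrite -(@leq_exp2l p) ?prime_gt1 // -e large // (subsetP sXA).
rewrite -sum1_card; under eq_bigr do rewrite -sum1_card big_mkcond /=.
rewrite exchange_big /= (bigID (mem A)) /= [X in _ + X]big1 ?addn0 => [|y yA]; last first.
  apply: big1 => w wX; case: ifP => // yw; case/negP: yA.
  have wA := subsetP sXA w wX; move: yw => /orbitP[a aG <-].
  by rewrite (acts_act actA aG).
apply: leq_sum => y yA; rewrite -big_mkcondr /= sum1_card.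
apply/card_le1P => w /andP[wX yw] w'; rewrite !inE; apply/andP/eqP => [[w'X yw']|->//].
apply/esym/eqP; rewrite -Xdis //; move: yw yw' => /orbit_eqP e /orbit_eqP e'.
by apply/orbit_eqP; rewrite -e' e.
Qed.

(** * Counting p-subgroups *)

Lemma psubsP (p : nat) (gT : finGroupType) (H : {set gT}) (G : {group gT}) :
  reflect (p.-group G /\ G \subset H) (G \in psubs p H).
Proof. by rewrite inE; exact: andP. Qed.

Lemma card_psubs_injm (p : nat) (gT rT : finGroupType) (H : {group gT}) (K : {set rT})
    (f : {morphism H >-> rT}) :
  'injm f -> f @* H \subset K -> #|psubs p H| <= #|psubs p K|.
Proof.
move=> injf sfK; apply: (@leq_card_in _ _ _ _ (fun G : {group gT} => (f @* G)%G)) => [G G'|G].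
  move=> /psubsP[_ sG] /psubsP[_ sG'] /(congr1 val) /= e; apply: val_inj => /=.
  by rewrite -(injmK injf sG) e injmK.
case/psubsP=> pG sG; apply/psubsP; split; first exact: morphim_pgroup.
exact: subset_trans (morphimS f sG) sfK.
Qed.

(** A group with a subgroup B of prime index is generated by B and any one element outside B. *)
Lemma card_index_p_over (p : nat) (gT : finGroupType) (H : {group gT}) (P : pred {group gT}) : prime p ->
  #|[set G in psubs p H | [exists B : {group gT}, [&& B \subset G, #|G : B| == p & P B]]]| <=
    #|H| * #|[set B in psubs p H | P B]|.
Proof.
move=> pr; rewrite mulnC; set D := [set B in _ | P B].
pose g (xy : {group gT} * gT) : {group gT} := (xy.1 <*> <[xy.2]>)%G.
apply: (@leq_trans #|g @: setX D H|); last first.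
  by apply: leq_trans (leq_imset_card _ _) _; rewrite cardsX.
apply/subset_leq_card/subsetP=> G; rewrite inE => /andP[GX /existsP[B /and3P[sBG /eqP iB PB]]].
have [pG sGX] := psubsP _ _ _ GX.
have [x xG xB] : exists2 x, x \in G & x \notin B.
  by apply/subsetPn; rewrite -indexg_eq1 iB; case: (p) pr => [|[]].
apply/imsetP; exists (B, x).
  rewrite inE /= (subsetP sGX) // andbT inE PB andbT; apply/psubsP.
  by rewrite (pgroupS sBG) // (subset_trans sBG).
apply/val_inj => /=; apply/eqP; rewrite eq_sym eqEsubset join_subG sBG cycle_subG xG /=.
rewrite -indexg_eq1; set J := [group of B <*> <[x]>].
have sJG : J \subset G by rewrite join_subG sBG cycle_subG.
have sBJ : B \subset J by exact: joing_subl.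
have := Lagrange_index sJG sBJ; rewrite iB => e.
have /primeP[_ dvp] := pr; have : #|J : B| %| p by rewrite -e dvdn_mull.
case/dvp/orP => /eqP e'.
  case/negP: xB; move/eqP: e'; rewrite indexg_eq1 => /subsetP; apply.
  by rewrite mem_gen // inE cycle_id orbT.
have p0 := prime_gt0 pr; rewrite -/J; clear -p0 e e'; move: e; rewrite e'; move: #|G : J| => k; nia.
Qed.

Lemma morphim_fstE (gT rT : finGroupType) (K : {group gT * rT}) : fst @* K = fst @: K.
Proof. by rewrite morphimEsub ?subsetT. Qed.

Lemma morphim_sndE (gT rT : finGroupType) (K : {group gT * rT}) : snd @* K = snd @: K.
Proof. by rewrite morphimEsub ?subsetT. Qed.

Definition sym_vec (p n : nat) (A : {set 'I_n}) (j : nat) : {set 'S_n * 'rV['F_p]_j} :=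
  setX (sym_on A) [set: 'rV['F_p]_j].

Section SymVec.
Variables (p n : nat).
Hypothesis pr : prime p.
Implicit Types (A : {set 'I_n}) (j : nat).

Lemma sym_vec_group_set A j : group_set (sym_vec p A j).
Proof. exact: (group_setX (sym_on_group A) [group of [set: 'rV['F_p]_j]]). Qed.
Canonical sym_vec_group A j := Group (sym_vec_group_set A j).

Lemma mem_sym_vec A j x : (x \in sym_vec p A j) = (x.1 \in sym_on A).
Proof. by rewrite !inE andbT. Qed.

Lemma card_sym_vec A j : #|sym_vec p A j| = (#|A|`! * p ^ j)%N.
Proof. by rewrite cardsX card_sym_on cardsT card_mx card_Fp // mul1n. Qed.

Definition num_psubs A j := #|psubs p (sym_vec p A j)|.

Lemma moment A j i :
  \sum_(G in psubs p (sym_vec p A j)) p ^ (i * frank p G) <= num_psubs A (j + i).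
Proof.
apply: leq_trans (psubs_moment i [group of sym_vec p A j] pr) _.
pose f (x : ('S_n * 'rV['F_p]_j) * 'rV['F_p]_i) := (x.1.1, row_mx x.1.2 x.2).
have fM : {in setX (sym_vec p A j) [set: 'rV['F_p]_i] &, {morph f : x y / x * y}}.
  by move=> [[s v] u] [[s' v'] u'] _ _; congr pair; exact/esym/add_row_mx.
apply: (card_psubs_injm _ (H := [group of setX (sym_vec p A j) [set: 'rV['F_p]_i]]) (f := Morphism fM)).
  apply/injmP=> [[[s v] u]] [[s' v'] u'] _ _ [-> e].
  by have [-> ->] := eq_row_mx e.
apply/subsetP=> _ /morphimP[[[s v] u] _ xX ->]; rewrite mem_sym_vec /=.
by move: xX; rewrite !inE /= => /andP[/andP[]].
Qed.

Section Restrict.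
Variables (A O : {set 'I_n}) (j : nat).
Hypothesis sOA : O \subset A.
Let A1 := A :\: O.
Let H := [group of sym_vec p A j :&: setX 'N(O | 'P) [set: 'rV['F_p]_j]].

Let HP x : x \in H -> [/\ x.1 \in sym_on A, x.1 \in 'N(O | 'P) & x.1 \in 'N(A1 | 'P)].
Proof.
case/setIP; rewrite mem_sym_vec => xA; rewrite [_ \in setX _ _]inE in_setT andbT => xO; split=> //.
by apply: (subsetP (astabsD 'P A O)); rewrite inE xO sym_on_acts.
Qed.

Definition split_sym (x : 'S_n * 'rV['F_p]_j) : ('S_n * 'rV['F_p]_j) * 'S_n :=
  ((restr_perm A1 x.1, x.2), restr_perm O x.1).

Lemma split_symM : {in H &, {morph split_sym : x y / x * y}}.
Proof.
move=> x y /HP[_ xO xA1] /HP[_ yO yA1]; rewrite /split_sym /=.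
by congr (_, _, _); exact: morphM.
Qed.
Canonical split_sym_morphism := Morphism split_symM.

Lemma split_sym_inj : 'injm split_sym.
Proof.
apply/injmP=> x y xH yH [eA1 ev eO].
have [xA xO xA1] := HP xH; have [yA yO yA1] := HP yH.
suff e : x.1 = y.1 by move: e ev; case: (x) (y) => [s v] [s' v'] /= -> ->.
apply/permP=> u; have [uA|uA] := boolP (u \in A); last first.
  by move: xA yA; rewrite !inE => xA yA; rewrite (out_perm xA uA) (out_perm yA uA).
have [uO|uO] := boolP (u \in O).
  by rewrite -(restr_permE xO uO) eO restr_permE.
have uA1 : u \in A1 by rewrite inE uO.
by rewrite -(restr_permE xA1 uA1) eA1 restr_permE.
Qed.

(** Restriction to A minus O and to O embeds G in a product in which its second projection is a
    transitive p-group on O. So [card_step] applies, with S the symmetric group on O. *)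
Lemma card_orbit_split e : #|O| = (p ^ e.+1)%N ->
  #|[set G in psubs p (sym_vec p A j) | [transitive fst @* G, on O | 'P]]| <=
  \sum_(G1 in psubs p (sym_vec p A1 j)) 2 ^ (3 * #|O|`!) *
    (p ^ (logn p (p ^ e)`! * frank p G1) +
     \sum_(B : {group 'S_n * 'rV['F_p]_j} | (B \subset G1) && (#|G1 : B| == p))
        p ^ (logn p (p ^ e)`! * maxn (p.-1 * frank p G1) (frank p B))).
Proof.
move=> cO; set F := [set G in _ | _]; set t := logn p _.
have FP G : G \in F -> [/\ p.-group G, G \subset sym_vec p A j, [transitive fst @* G, on O | 'P] & G \subset H].
  rewrite inE => /andP[/psubsP[pG sG] trG]; split=> //.
  rewrite subsetI sG; apply/subsetP=> x xG; rewrite [_ \in setX _ _]inE in_setT andbT.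
  by have /subsetP/(_ x.1) := atrans_acts trG; apply; rewrite mem_morphim ?inE.
pose QS : {set {group 'S_n}} := [set Q : {group 'S_n} | [&& p.-group Q, Q \subset sym_on O & [transitive Q, on O | 'P]]].
pose T (G1 : {group 'S_n * 'rV['F_p]_j}) := [set G' : {group ('S_n * 'rV['F_p]_j) * 'S_n} |
   (fst @: G' == G1) && [exists Q in QS, snd @: G' == Q]].
pose f (G : {group 'S_n * 'rV['F_p]_j}) := (split_sym @* G)%G.
have injf : {in F &, injective f}.
  move=> G G' /FP[_ _ _ sG] /FP[_ _ _ sG'] /(congr1 val) /= e'; apply: val_inj => /=.
  by rewrite -(injmK split_sym_inj sG) e' (injmK split_sym_inj sG').
rewrite -(card_in_imset injf).
apply: (@leq_trans (\sum_(G1 in psubs p (sym_vec p A1 j)) #|T G1|)).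
  apply: card_bigcup_le => _ /imsetP[G /FP[pG sG trG sGH] ->].
  have fE : (split_sym @* G)%G = split_sym @: G :> {set _} by exact: morphimEsub.
  have pf : p.-group (f G) by exact: morphim_pgroup.
  exists (fst @* f G)%G.
    apply/psubsP; split; first exact: morphim_pgroup.
    rewrite /= morphim_fstE; apply/subsetP=> _ /imsetP[y yf ->].
    move: yf; rewrite /f fE => /imsetP[x xG ->]; rewrite mem_sym_vec inE /=.
    exact: restr_perm_on.
  rewrite inE; apply/andP; split; first by rewrite /= morphim_fstE.
  apply/existsP; exists (snd @* f G)%G.
  have sE : (snd @* f G)%G = [set restr_perm O s | s in fst @* G] :> {set _}.
    by rewrite /= morphim_fstE morphim_sndE [in LHS]fE -!imset_comp.
  apply/andP; split; last by rewrite /= morphim_sndE.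
  rewrite inE; apply/and3P; split; first exact: morphim_pgroup.
    by rewrite sE; apply/subsetP=> _ /imsetP[s _ ->]; rewrite inE restr_perm_on.
  have [w wO orbw] := imsetP trG.
  have restrE s : s \in fst @* G -> restr_perm O s w = s w.
    by move=> sG1; rewrite restr_permE // (subsetP (atrans_acts trG)).
  apply/imsetP; exists w => //; apply/setP=> y; rewrite [in LHS]orbw.
  apply/orbitP/orbitP => [[s sG1 <-]|[s' s'G <-]].
    exists (restr_perm O s); last exact: restrE.
    by rewrite sE; apply: imset_f.
  by move: s'G; rewrite sE => /imsetP[s sG1 ->]; exists s => //; exact/esym/restrE.
apply: leq_sum => G1 /psubsP[pG1 _].
have := card_step pr (t := t) (S := sym_on_group O) (QS := QS) pG1.
rewrite card_sym_on; apply=> Q; rewrite inE => /and3P[pQ sQ trQ]; split=> //.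
exact: imprimitive_top_trans trQ cO.
Qed.
End Restrict.

Lemma card_fixed_point A w j : w \in A ->
  #|[set G in psubs p (sym_vec p A j) | [forall x in G, x.1 w == w]]| <= num_psubs (A :\ w) j.
Proof.
move=> wA; apply/subset_leq_card/subsetP=> G; rewrite inE => /andP[/psubsP[pG sG] /forall_inP fixw].
apply/psubsP; split=> //; apply/subsetP=> x xG; rewrite mem_sym_vec inE; apply/subsetP=> u; rewrite inE => xu.
have := subsetP sG x xG; rewrite mem_sym_vec inE => /subsetP/(_ u); rewrite inE => /(_ xu) uA.
by rewrite !inE uA andbT; apply: contraNneq xu => ->; exact: fixw.
Qed.
End SymVec.

Lemma logn_fact_le p n : prime p -> p.-1 * logn p n`! <= n.
Proof.
move=> pr; rewrite logn_fact //.
suff H m : p.-1 * (\sum_(1 <= k < m.+1) n %/ p ^ k) + n %/ p ^ m <= n.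
  exact: leq_trans (leq_addr _ _) (H n).
elim: m => [|m IH]; first by rewrite big_geq // muln0 expn0 divn1.
rewrite big_nat_recr //= mulnDr -addnA; apply: leq_trans IH; rewrite leq_add2l.
rewrite expnSr divnMA; move: (n %/ p ^ m) => x; have := prime_gt0 pr.
by have := leq_divM x p; move: (x %/ p) => y; case: (p) => // q; nia.
Qed.

Lemma card_pgroup_sym_on p n (A : {set 'I_n}) (Q : {group 'S_n}) : prime p -> p.-group Q -> Q \subset sym_on A ->
  #|Q| <= p ^ #|A|.
Proof.
move=> pr pQ sQ; apply: leq_trans (pgroup_sym_on_card pr pQ sQ) _.
rewrite leq_exp2l ?prime_gt1 //; have := logn_fact_le #|A| pr; have := prime_gt1 pr.
by move: (logn _ _) => x; case: (p) => [|[|q]] //= _; nia.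
Qed.

(** All these groups are conjugate into one Sylow subgroup P: there are |A|! conjugating elements
    and |P|^d lists of generators, padded by 1. *)
Lemma card_psubs_frank_logn p n (A : {set 'I_n}) d : prime p ->
  #|[set G in psubs p (sym_on A) | frank p G <= d]| <= #|A|`! * p ^ (logn p #|A|`! * d).
Proof.
move=> pr; have [P sylP] := Sylow_exists p [group of sym_on A].
have sPA : P \subset sym_on A := pHall_sub sylP.
have pP : p.-group P := pHall_pgroup sylP.
pose im (f : {ffun 'I_d -> 'S_n}) : {set 'S_n} := [set f i | i in 'I_d].
pose g (xf : 'S_n * {ffun 'I_d -> 'S_n}) : {group 'S_n} := (generated_group (im xf.2) :^ xf.1)%G.
pose D := setX (sym_on A) [set f : {ffun 'I_d -> 'S_n} | f \in ffun_on (mem P)].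
apply: (@leq_trans #|g @: D|).
  apply/subset_leq_card/subsetP=> G; rewrite inE => /andP[/psubsP[pG sG] dG].
  have [x xA sGx] := Sylow_subJ sylP sG pG.
  have [X genX cX] := frank_gen pr pG.
  pose f := [ffun i : 'I_d => (nth 1 (enum X) i) ^ x^-1].
  have XG : X \subset G by rewrite -genX subset_gen.
  apply/imsetP; exists (x, f).
    rewrite inE /= xA inE; apply/ffun_onP=> i; rewrite ffunE.
    have [ltX|leX] := ltnP i (size (enum X)); last by rewrite nth_default // conj1g group1.
    have : nth 1 (enum X) i \in G by rewrite (subsetP XG) // -mem_enum mem_nth.
    by move/(subsetP sGx); rewrite mem_conjg.
  apply/val_inj; rewrite /= -genJ -genX; apply/eqP; rewrite eqEsubset !gen_subG.
  apply/andP; split.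
    apply/subsetP=> u uX; rewrite mem_gen // -(conjgKV x u) memJ_conjg.
    have ltd : index u (enum X) < d.
      by apply: leq_trans (leq_trans cX dG); rewrite cardE index_mem mem_enum.
    by apply/imsetP; exists (Ordinal ltd); rewrite // ffunE /= nth_index // mem_enum.
  apply/subsetP=> _ /imsetP[_ /imsetP[i _ ->] ->]; rewrite ffunE conjgKV.
  have [ltX|leX] := ltnP i (size (enum X)); last by rewrite nth_default // group1.
  by rewrite mem_gen // -mem_enum mem_nth.
apply: leq_trans (leq_imset_card _ _) _; rewrite cardsX card_sym_on leq_mul2l; apply/orP; right.
rewrite cardsE card_ffun_on card_ord expnM; apply: leq_expn2l; exact: pgroup_sym_on_card.
Qed.

Lemma card_psubs_frank p n (A : {set 'I_n}) d : prime p ->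
  #|[set G in psubs p (sym_on A) | frank p G <= d]| <= #|A|`! * p ^ (#|A| * d).
Proof.
move=> pr; apply: leq_trans (card_psubs_frank_logn A d pr) _.
rewrite leq_mul2l leq_exp2l ?prime_gt1 // leq_mul2r; apply/orP; right; apply/orP; right.
by have := logn_fact_le #|A| pr; have := prime_gt1 pr; move: (logn _ _) => x; case: (p) => [|[|q]] //= _; nia.
Qed.

Lemma card_psubs_crude p n (A : {set 'I_n}) : prime p ->
  #|psubs p (sym_on A)| <= #|A|`! * p ^ (logn p #|A|`! * logn p #|A|`!).
Proof.
move=> pr; apply: leq_trans (card_psubs_frank_logn A _ pr); apply/subset_leq_card/subsetP=> G GA.
rewrite inE GA /=; have [pG sG] := psubsP _ _ _ GA.
by rewrite -(@leq_exp2l p) ?prime_gt1 // (leq_trans (frank_card pr pG)) // pgroup_sym_on_card.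
Qed.

Lemma card_over_setT (p : nat) (gT sT : finGroupType) (G1 : {group gT}) (N : {group sT}) : prime p -> p.-group G1 ->
  #|[set G : {group gT * sT} | (fst @: G == G1) && (fib G 1 == N)]| <= #|[set: sT] : N| ^ frank p G1.
Proof.
move=> pr pG1; apply: (@card_over _ _ p G1 N [group of [set: sT]]) => //; first exact: subsetT.
  by move=> G; rewrite inE => /andP[/eqP ? /eqP ?].
by move=> *; rewrite inE.
Qed.

(** A bound for the Gaussian binomial coefficient by its Pascal recursion. A subspace either meets
    the line of the first coordinate trivially, and is then one of at most p^i lifts of its
    projection, or contains that line and is given by its projection, of dimension i - 1. *)
Lemma card_subgroups_vec p j i : prime p ->
  #|[set N : {group 'rV['F_p]_j} | #|N| == (p ^ i)%N]| <= 2 ^ j * p ^ (i * (j - i)).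
Proof.
move=> pr; have p1 := prime_gt1 pr; have p0 := prime_gt0 pr.
elim: j i => [|j IH] i.
  rewrite expn0 mul1n sub0n muln0 expn0; apply/card_le1_eqP => N N' _ _; apply/val_inj/setP => x.
  by rewrite [x]thinmx0 !group1.
pose f (v : 'rV['F_p]_(1 + j)) := (rsubmx v, lsubmx v).
have fM : {in [set: 'rV['F_p]_(1 + j)] &, {morph f : x y / x * y}}.
  by move=> x y _ _; apply/pair_equal_spec; split; apply/rowP=> k; rewrite !mxE.
pose F := Morphism fM.
have injF : 'injm F.
  apply/injmP=> x y _ _ [er el]; by rewrite -(hsubmxK x) -(hsubmxK y) er el.
pose fG (N : {group 'rV['F_p]_(1 + j)}) := (F @* N)%G.
set S := [set N | _].
have injf : {in S &, injective fG}.
  move=> N N' _ _ /(congr1 val) /= e; apply: val_inj => /=.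
  by rewrite -(injmK injF (subsetT N)) e (injmK injF (subsetT N')).
rewrite -(card_in_imset injf).
pose T1 k := [set G1 : {group 'rV['F_p]_j} | #|G1| == (p ^ k)%N].
pose T (N : {group 'rV['F_p]_1}) (G1 : {group 'rV['F_p]_j}) :=
  [set G : {group 'rV['F_p]_j * 'rV['F_p]_1} | (fst @: G == G1) && (fib G 1 == N)].
have pV m (G1 : {group 'rV['F_p]_m}) : p.-group G1.
  apply: pgroupS (subsetT _) _; rewrite /pgroup cardsT card_mx card_Fp // mul1n.
  by rewrite pnatX pnat_id.
have c1 : #|[set: 'rV['F_p]_1]| = p by rewrite cardsT card_mx card_Fp.
pose R (b : bool) (G1 : {group 'rV['F_p]_j}) := if b then #|G1| == (p ^ i)%N else (0 < i) && (#|G1| == (p ^ i.-1)%N).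
pose N_ (b : bool) : {group 'rV['F_p]_1} := if b then 1%G else [set: 'rV['F_p]_1]%G.
apply: (@leq_trans (\sum_(x : bool * {group 'rV['F_p]_j} | R x.1 x.2) #|T (N_ x.1) x.2|)).
  apply: card_bigcup_le => _ /imsetP[N NS ->]; move: NS; rewrite inE => /eqP cN.
  pose b := fib (fG N) 1 == 1.
  have cf : #|fG N| = (p ^ i)%N by rewrite card_injm // subsetT.
  have cfib : fib (fG N) 1 = N_ b.
    rewrite /b; case: eqP => [//|/eqP ntr]; apply/eqP; rewrite eqEcard subsetT /= c1.
    have /p_natP[m] := pV _ [group of fib (fG N) 1]; rewrite /= => cm; rewrite cm.
    case: m cm => [|m] cm; last by rewrite expnS leq_pmulr // expn_gt0 p0.
    by case/negP: ntr; rewrite trivg_card1 cm.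
  exists (b, (fst @* fG N)%G); last by rewrite inE /= -morphim_fstE cfib !eqxx.
  rewrite /R /= morphim_fstE; have := card_fst (fG N); rewrite cf cfib.
  case: (b) => /=; first by rewrite cards1 muln1 => <-.
  rewrite c1 => e.
  case: (i) e => [|i'] e.
    have : p %| 1 by rewrite -(expn0 p) e dvdn_mull.
    by rewrite dvdn1 => /eqP p_1; rewrite p_1 in p1.
  by rewrite /= -(eqn_pmul2r p0) -e expnSr.
apply: (@leq_trans (\sum_(x : bool * {group 'rV['F_p]_j} | R x.1 x.2) if x.1 then (p ^ i)%N else 1%N)).
  apply: leq_sum => -[[] G1]; rewrite /R /=; [move/eqP=> cG|move=> _].
    apply: leq_trans (card_over_setT _ pr (pV _ G1)) _.
    rewrite indexg1 c1 leq_exp2l // -(@leq_exp2l p) // -cG; exact: frank_card.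
  by apply: leq_trans (card_over_setT _ pr (pV _ G1)) _; rewrite indexgg exp1n.
rewrite -(pair_big_dep xpredT R (fun b G1 => if b then (p ^ i)%N else 1%N)) big_bool /=.
have -> : (\sum_(G1 | R true G1) p ^ i = #|T1 i| * p ^ i)%N.
  by rewrite -sum_nat_const; apply: eq_bigl => G1; rewrite inE.
have s2 : \sum_(G1 | R false G1) 1 <= (if i is i'.+1 then #|T1 i'| else 0).
  rewrite /R /=; case: (i) => [|i']; first by rewrite big_pred0.
  by rewrite -sum1_card /=; apply/eq_leq/eq_bigl => G1; rewrite inE.
rewrite expnS mul2n -addnn mulnDl; apply: leq_add.
  have [le|gt] := leqP i j.
    rewrite subSn // mulnS expnD; have := leq_mul (IH i) (leqnn (p ^ i)).
    by move/leq_trans; apply; rewrite -mulnA [X in _ * X <= _]mulnC.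
  rewrite (_ : #|_| = 0) ?mul0n //; apply/eqP; rewrite cards_eq0; apply/eqP/setP=> G1; rewrite !inE.
  apply/negP=> /eqP cG; have := subset_leq_card (subsetT G1).
  by rewrite cG cardsT card_mx card_Fp // mul1n leq_exp2l // leqNgt gt.
apply: (leq_trans s2); case: i {S injf R s2} => [|i] //=; apply: (leq_trans (IH i)).
by rewrite leq_mul2l leq_exp2l // subSS leq_mul2r leqnSn !orbT.
Qed.

(** G is given by its projection to the symmetric group, its fibre N over 1, of order p^i, and one
    of at most |F_p^j : N|^d lifts. *)
Lemma card_small_frank p n (A : {set 'I_n}) j d : prime p ->
  #|[set G in psubs p (sym_vec p A j) | frank p (fst @* G) <= d]| <=
  #|A|`! * p ^ (#|A| * d) * \sum_(i < j.+1) 2 ^ j * p ^ (i * (j - i)) * p ^ ((j - i) * d).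
Proof.
move=> pr; have p1 := prime_gt1 pr; have p0 := prime_gt0 pr.
pose S := [set G in psubs p (sym_on A) | frank p G <= d].
pose T (x : {group 'S_n} * {group 'rV['F_p]_j}) :=
  [set G : {group 'S_n * 'rV['F_p]_j} | (fst @: G == x.1) && (fib G 1 == x.2)].
have cV : #|[set: 'rV['F_p]_j]| = (p ^ j)%N by rewrite cardsT card_mx card_Fp // mul1n.
apply: (@leq_trans (\sum_(x : {group 'S_n} * {group 'rV['F_p]_j} | (x.1 \in S) && true) #|T x|)).
  apply: card_bigcup_le => G; rewrite inE => /andP[/psubsP[pG sG] dG].
  exists ((fst @* G)%G, [group of fib G 1]); last by rewrite inE /= morphim_fstE !eqxx.
  rewrite andbT inE dG andbT; apply/psubsP; split; first exact: morphim_pgroup.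
  rewrite /= morphim_fstE; apply/subsetP=> _ /imsetP[x /(subsetP sG) xA ->].
  by rewrite mem_sym_vec in xA.
apply: (@leq_trans (\sum_(x : {group 'S_n} * {group 'rV['F_p]_j} | (x.1 \in S) && true) #|[set: 'rV['F_p]_j] : x.2| ^ d)).
  apply: leq_sum => -[G1 N]; rewrite andbT /= inE => /andP[/psubsP[pG1 _] dG1].
  apply: leq_trans (card_over_setT _ pr pG1) _.
  by rewrite leq_pexp2l // indexg_gt0.
rewrite -(pair_big_dep (fun G1 => G1 \in S) (fun _ _ => true) (fun _ (N : {group 'rV['F_p]_j}) => #|[set: 'rV['F_p]_j] : N| ^ d)%N) /=.
rewrite sum_nat_const; apply: leq_mul; first exact: card_psubs_frank.
have pN (N : {group 'rV['F_p]_j}) : exists2 i, i <= j & #|N| = (p ^ i)%N.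
  have := cardSg (subsetT N); rewrite cV => /(dvdn_pfactor _ _ pr)[i le e]; by exists i.
have lN (N : {group 'rV['F_p]_j}) : logn p #|N| < j.+1.
  by have [i le ->] := pN N; rewrite pfactorK.
rewrite (partition_big (fun N : {group 'rV['F_p]_j} => Ordinal (lN N)) xpredT) //=.
apply: leq_sum => i _; apply: leq_trans (leq_mul (card_subgroups_vec j i pr) (leqnn _)).
rewrite -sum_nat_const; apply: eq_leq; apply: eq_big => N.
  rewrite inE; have [k le e] := pN N; rewrite -val_eqE /= e pfactorK //.
  by rewrite eqn_exp2l.
move/eqP=> /(congr1 val) /= <-; have [k le e] := pN N; rewrite e pfactorK //.
rewrite -divgS ?subsetT // cV e -expnB // expnM //.
Qed.

(** * Splitting a nilpotent permutation group *)

Lemma double_imset_le (T1 T2 : finType) (D : {set T1}) (f : T1 -> T2) :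
  (forall t, t \in D -> 1 < #|[set u in D | f u == f t]|) -> 2 * #|f @: D| <= #|D|.
Proof.
move=> fib2; rewrite -[X in _ <= X]sum1_card (partition_big_imset f) /= mulnC -sum_nat_const.
apply: leq_sum => _ /imsetP[t tD ->]; rewrite sum1_card; apply: leq_trans (fib2 t tD) _.
by rewrite cardsE.
Qed.

Section CommutingOrbits.
Variables (n : nat) (G X Y : {group 'S_n}).
Hypotheses (defG : X * Y = G) (cXY : forall x y, x \in X -> y \in Y -> x * y = y * x).
Hypothesis coXY : coprime #|X| #|Y|.

Let sXG : X \subset G. Proof. by rewrite -defG mulG_subl. Qed.
Let sYG : Y \subset G. Proof. by rewrite -defG mulG_subr. Qed.

Let cact x y u : x \in X -> y \in Y -> x (y u) = y (x u) :> 'I_n.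
Proof. by move=> xX yY; rewrite -!permM (cXY xX yY). Qed.

(** If x u = y u, then x^k u = y^k u for all k since x and y commute; the Chinese remainder theorem
    provides k with x^k = x and y^k = 1. *)
Lemma commuting_orbits_meet u v : v \in orbit 'P X u -> v \in orbit 'P Y u -> v = u.
Proof.
case/orbitP=> x xX /= xv /orbitP[y yY /= yv]; rewrite /aperm in xv yv.
have pw k : (x ^+ k) u = (y ^+ k) u.
  elim: k => [|k IH]; first by rewrite !perm1.
  by rewrite expgSr permM IH (cact _ xX (groupX k yY)) xv -yv -permM -expgS.
have X0 : 0 < #|X| := cardG_gt0 X; have Y0 : 0 < #|Y| := cardG_gt0 Y.
have kX := chinese_modl coXY 1 0; have kY := chinese_modr coXY 1 0.
move: kX kY; set k := chinese _ _ _ _ => kX kY.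
have xk : x ^+ k = x by rewrite -(expg_mod k (expg_cardG xX)) kX expg_mod ?expg_cardG ?expg1.
have yk : y ^+ k = 1 by rewrite -(expg_mod k (expg_cardG yY)) kY mod0n expg0.
by have := pw k; rewrite xk yk perm1 xv.
Qed.

Definition orbit_rep (t : 'I_n) := odflt t [pick u in orbit 'P G t].

Lemma orbit_rep_mem t : orbit_rep t \in orbit 'P G t.
Proof. by rewrite /orbit_rep; case: pickP => [u|/(_ t)] //=; rewrite orbit_refl. Qed.

Lemma orbit_rep_eq g t : g \in G -> orbit_rep (g t) = orbit_rep t.
Proof.
move=> gG; have e : orbit 'P G (g t) = orbit 'P G t by exact: (orbit_act 'P t gG).
rewrite /orbit_rep (eq_pick (Q := mem (orbit 'P G t))); last by move=> u; rewrite /= e.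
by case: pickP => [u|/(_ t)] //=; rewrite orbit_refl.
Qed.

(* Every orbit of G = X * Y is the product of an X-orbit and a Y-orbit. Both
   factors are realised inside the orbit, through the base point
   [orbit_rep]. *)
Definition coordX t := odflt t [pick u in orbit 'P X (orbit_rep t) :&: orbit 'P Y t].
Definition coordY t := odflt t [pick u in orbit 'P Y (orbit_rep t) :&: orbit 'P X t].

Lemma coordX_mem t : coordX t \in orbit 'P X (orbit_rep t) /\ coordX t \in orbit 'P Y t.
Proof.
rewrite /coordX; case: pickP => [u|] /=; first by rewrite inE => /andP.
have : t \in orbit 'P G (orbit_rep t) by rewrite orbit_sym orbit_rep_mem.
case/orbitP=> g; rewrite -defG => /mulsgP[x y xX yY ->] /= gt /(_ (x (orbit_rep t))).
rewrite inE => /negP[]; apply/andP; split; first by apply/orbitP; exists x.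
rewrite orbit_sym; apply/orbitP; exists y => //.
by rewrite -[RHS]gt /= /aperm permM.
Qed.

Lemma coordY_mem t : coordY t \in orbit 'P Y (orbit_rep t) /\ coordY t \in orbit 'P X t.
Proof.
rewrite /coordY; case: pickP => [u|] /=; first by rewrite inE => /andP.
have : t \in orbit 'P G (orbit_rep t) by rewrite orbit_sym orbit_rep_mem.
case/orbitP=> g; rewrite -defG => /mulsgP[x y xX yY ->] /= gt /(_ (y (orbit_rep t))).
rewrite inE => /negP[]; apply/andP; split; first by apply/orbitP; exists y.
rewrite orbit_sym; apply/orbitP; exists x => //.
by rewrite -[RHS]gt /= /aperm permM cact.
Qed.

Let meet u v w : u \in orbit 'P X w -> v \in orbit 'P X w -> u \in orbit 'P Y v -> u = v.
Proof.
move=> uw vw uv; apply: commuting_orbits_meet uv.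
by move/orbit_eqP: vw => ->.
Qed.

Let meet' u v w : u \in orbit 'P Y w -> v \in orbit 'P Y w -> u \in orbit 'P X v -> u = v.
Proof.
move=> uw vw uv; apply: (commuting_orbits_meet uv).
by move/orbit_eqP: vw => ->.
Qed.

Let oX x t : x \in X -> orbit 'P X (x t) = orbit 'P X t.
Proof. exact: orbit_act. Qed.
Let oY y t : y \in Y -> orbit 'P Y (y t) = orbit 'P Y t.
Proof. exact: orbit_act. Qed.
Let memX x t w : x \in X -> t \in orbit 'P X w -> x t \in orbit 'P X w.
Proof. by move=> xX /orbit_eqP <-; apply/orbitP; exists x. Qed.
Let memY y t w : y \in Y -> t \in orbit 'P Y w -> y t \in orbit 'P Y w.
Proof. by move=> yY /orbit_eqP <-; apply/orbitP; exists y. Qed.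

Let XactY x t w : x \in X -> t \in orbit 'P Y w -> x t \in orbit 'P Y (x w).
Proof. by move=> xX /orbitP[y yY <-]; apply/orbitP; exists y; rewrite //= /aperm (cact _ xX yY). Qed.
Let YactX y t w : y \in Y -> t \in orbit 'P X w -> y t \in orbit 'P X (y w).
Proof. by move=> yY /orbitP[x xX <-]; apply/orbitP; exists x; rewrite //= /aperm (cact _ xX yY). Qed.

Lemma coordX_X x t : x \in X -> coordX (x t) = x (coordX t).
Proof.
move=> xX; have [a1 a2] := coordX_mem (x t); have [b1 b2] := coordX_mem t.
rewrite (orbit_rep_eq _ (subsetP sXG x xX)) in a1.
apply: (meet a1 (memX xX b1)).
by move/orbit_eqP: (XactY xX b2) => ->.
Qed.

Lemma coordX_Y y t : y \in Y -> coordX (y t) = coordX t.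
Proof.
move=> yY; have [a1 a2] := coordX_mem (y t); have [b1 b2] := coordX_mem t.
rewrite (orbit_rep_eq _ (subsetP sYG y yY)) in a1; rewrite oY // in a2.
by apply: (meet a1 b1); move/orbit_eqP: b2 => ->.
Qed.

Lemma coordY_Y y t : y \in Y -> coordY (y t) = y (coordY t).
Proof.
move=> yY; have [a1 a2] := coordY_mem (y t); have [b1 b2] := coordY_mem t.
rewrite (orbit_rep_eq _ (subsetP sYG y yY)) in a1.
apply: (meet' a1 (memY yY b1)).
by move/orbit_eqP: (YactX yY b2) => ->.
Qed.

Lemma coordY_X x t : x \in X -> coordY (x t) = coordY t.
Proof.
move=> xX; have [a1 a2] := coordY_mem (x t); have [b1 b2] := coordY_mem t.
rewrite (orbit_rep_eq _ (subsetP sXG x xX)) in a1; rewrite oX // in a2.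
by apply: (meet' a1 b1); move/orbit_eqP: b2 => ->.
Qed.

(** Equal X-coordinates put t and t' in one Y-orbit, equal Y-coordinates in one X-orbit, and such
    orbits share a single point. *)
Lemma coord_inj t t' : coordX t = coordX t' -> coordY t = coordY t' -> t = t'.
Proof.
move=> eX eY; have [_ a] := coordX_mem t; have [_ b] := coordY_mem t.
have [_ a'] := coordX_mem t'; have [_ b'] := coordY_mem t'.
rewrite -eX in a'; rewrite -eY in b'; rewrite orbit_sym in a; rewrite orbit_sym in b.
rewrite orbit_sym in a'; rewrite orbit_sym in b'.
by apply: (meet b b'); move/orbit_eqP: a' => ->.
Qed.

Definition moved := [set t | [exists x in X, x t != t]].

Lemma movedP t : reflect (exists2 x, x \in X & x t != t) (t \in moved).
Proof. by rewrite inE; apply: (iffP exists_inP) => -[x ? ?]; exists x. Qed.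

Lemma moved_X x t : x \in X -> (x t \in moved) = (t \in moved).
Proof.
move=> xX; apply/movedP/movedP => -[z zX zt].
  exists (z ^ x^-1); first by rewrite groupJ ?groupV.
  rewrite conjgE invgK !permM; apply: contra_neq zt => e.
  by apply: (perm_inj (s := x^-1)); rewrite e permK.
exists (z ^ x); first by rewrite groupJ.
rewrite conjgE !permM permK; apply: contra_neq zt => e; exact: (perm_inj e).
Qed.

Lemma moved_Y y t : y \in Y -> (y t \in moved) = (t \in moved).
Proof.
move=> yY; apply/movedP/movedP => -[z zX zt]; exists z => //.
  by apply: contra_neq zt => e; rewrite cact // e.
by rewrite cact //; apply: contra_neq zt => e; exact: (perm_inj e).
Qed.

Definition moved_both := [set t in moved | 1 < #|orbit 'P Y t|].

Lemma card_orbitY_X x t : x \in X -> #|orbit 'P Y (x t)| = #|orbit 'P Y t|.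
Proof.
move=> xX; have -> : orbit 'P Y (x t) = x @: orbit 'P Y t; last by rewrite card_imset //; exact: perm_inj.
apply/setP=> u; apply/orbitP/imsetP => [[y yY <-]|[_ /orbitP[y yY <-] ->]].
  by exists (y t); [apply/orbitP; exists y|rewrite /= /aperm (cact _ xX yY)].
by exists y; rewrite //= /aperm (cact _ xX yY).
Qed.

(* A moved point with trivial Y-orbit pays for one point of the first image.
   Any other moved point pays one half in each image, since there all fibres
   have at least two points. *)
Lemma card_coords : #|coordX @: moved| + #|coordY @: moved_both| <= #|moved| /\
  2 * #|coordY @: moved_both| <= #|moved|.
Proof.
pose T1 := moved :\: moved_both.
have sb : moved_both \subset moved by apply/subsetP=> t; rewrite inE => /andP[].
have cT : #|moved| = #|T1| + #|moved_both| by rewrite cardsD (setIidPr sb) subnK // subset_leq_card.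
have hX : 2 * #|coordX @: moved_both| <= #|moved_both|.
  apply: double_imset_le => t tD; move: (tD); rewrite inE => /andP[tm lt].
  apply: leq_trans lt _; apply/subset_leq_card/subsetP=> _ /orbitP[y yY <-].
  by rewrite inE inE /= /aperm moved_Y // tm oY // coordX_Y // eqxx andbT; move: tD; rewrite inE => /andP[].
have hY : 2 * #|coordY @: moved_both| <= #|moved_both|.
  apply: double_imset_le => t tD; move: (tD); rewrite inE => /andP[tm lt].
  have [x xX xt] := movedP t tm.
  apply: (@leq_trans #|[set t; x t]|); first by rewrite cards2 eq_sym xt.
  apply/subset_leq_card/subsetP=> u /set2P[->|->]; apply/setIdP; split=> //; last by rewrite coordY_X.
  by apply/setIdP; rewrite moved_X // card_orbitY_X.
have hT1 : #|coordX @: moved| <= #|T1| + #|coordX @: moved_both|.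
  have -> : moved = T1 :|: moved_both by rewrite setUC -{1}(setIidPr sb) setID.
  rewrite imsetU; apply: leq_trans (leq_card_setU _ _) _.
  by rewrite leq_add2r leq_imset_card.
lia.
Qed.
End CommutingOrbits.

Section NilSubs.
Variables (n : nat).
Implicit Types (C T A B S : {set 'I_n}) (G : {group 'S_n}).

Definition nil_subs q C : {set {group 'S_n}} :=
  [set G : {group 'S_n} | [&& nilpotent G, G \subset sym_on C & [forall r : 'I_q, prime r ==> ~~ (r %| #|G|)]]].

Lemma nil_subsP q C G :
  reflect [/\ nilpotent G, G \subset sym_on C & forall r, prime r -> r %| #|G| -> q <= r] (G \in nil_subs q C).
Proof.
rewrite inE; apply: (iffP and3P) => [[nG sG /forallP H]|[nG sG H]]; split=> //.
  move=> r pr rG; rewrite leqNgt; apply/negP=> lt.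
  by have := H (Ordinal lt); rewrite pr /= rG.
by apply/forallP=> r; apply/implyP=> pr; apply/negP=> /(H r pr); rewrite leqNgt ltn_ord.
Qed.

Lemma nil_subs_not_prime q C : ~~ prime q -> nil_subs q C \subset nil_subs q.+1 C.
Proof.
move=> npr; apply/subsetP=> G /nil_subsP[nG sG H]; apply/nil_subsP; split=> // r pr rG.
rewrite ltn_neqAle H // andbT; apply: contraNneq npr => ->; exact: pr.
Qed.

Lemma nil_subs_large q C : n < q -> #|nil_subs q C| <= 1.
Proof.
move=> lt; apply/card_le1_eqP => G G' GC GC'.
suff H (K : {group 'S_n}) : K \in nil_subs q C -> K :=: 1 by apply: val_inj; rewrite /= (H G) ?(H G').
case/nil_subsP=> _ _ HK; apply/eqP; rewrite trivg_card1; apply/negP=> /negP K1.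
have c1 : 1 < #|K| by rewrite ltn_neqAle eq_sym K1 cardG_gt0.
have pr := pdiv_prime c1; have := HK _ pr (pdiv_dvd _).
have : pdiv #|K| %| n`!.
  apply: dvdn_trans (pdiv_dvd _) _.
  have := cardSg (subsetT K); rewrite cardsT card_Sn //.
move=> dv; have : pdiv #|K| <= n; last by move: (pdiv _) => r; lia.
move: dv; move: (pdiv _) pr => r pr; elim: (n) => [|m IH]; first by rewrite fact0 dvdn1 => /eqP r1; rewrite r1 in pr.
rewrite factS Euclid_dvdM // => /orP[/dvdn_leq|/IH/leqW]; exact.
Qed.

Variables (q : nat) (C : {set 'I_n}).
Hypothesis pr : prime q.

Let X G := [group of 'O_q(G)].
Let Y G := [group of 'O_q^'(G)].
Let T_ G := moved (X G).
Let cX G := coordX G (X G) (Y G).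
Let cY G := coordY G (X G) (Y G).
Let A_ G := cX G @: T_ G.
Let B_ G := cY G @: moved_both (X G) (Y G).
Let f_ G := [ffun t => if t \in T_ G then Some (cX G t) else None].
Let h_ G := [ffun t => if t \in T_ G then Some (cY G t) else None].
Let codeT := ({set 'I_n} * {set 'I_n} * {set 'I_n} * ({ffun 'I_n -> option 'I_n} * {ffun 'I_n -> option 'I_n}))%type.
(* With the actions of ['O_q(G)] on A_ and of ['O_q^'(G)] on (C minus T_) with
   B_ added, this determines G. *)
Definition nil_code G : codeT := (T_ G, A_ G, B_ G, (f_ G, h_ G)).

Section OneGroup.
Variable G : {group 'S_n}.
Hypothesis GC : G \in nil_subs q C.

Let nG : nilpotent G. Proof. by case/nil_subsP: GC. Qed.
Let sG : G \subset sym_on C. Proof. by case/nil_subsP: GC. Qed.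

Lemma pcore_prod : X G * Y G = G.
Proof. by have /dprodP[_ ] := nilpotent_pcoreC q nG. Qed.

Lemma pcore_comm x y : x \in X G -> y \in Y G -> x * y = y * x.
Proof.
by have /dprodP[_ _ /centsP c _] := nilpotent_pcoreC q nG; move=> xX yY; rewrite (c y yY x xX).
Qed.

Lemma pcore_coprime : coprime #|X G| #|Y G|.
Proof. exact: coprime_pcoreC. Qed.

Let H1 := pcore_prod. Let H2 := pcore_comm. Let H3 := pcore_coprime.

Lemma sub_sym_on_moved (Z : {group 'S_n}) x t : Z \subset G -> x \in Z -> t \notin C -> x t = t.
Proof.
move=> sZ xZ tC; have := subsetP sG x (subsetP sZ x xZ); rewrite inE => h; exact: (out_perm h tC).
Qed.

Lemma code_TC : T_ G \subset C.
Proof.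
apply/subsetP=> t /movedP[x xX xt]; apply: contraR xt => tC.
by apply/eqP; apply: (sub_sym_on_moved (pcore_sub _ _) xX).
Qed.

Lemma cX_moved t : t \in T_ G -> cX G t \in T_ G.
Proof.
move=> tT; have [_] := coordX_mem H1 t; rewrite -[coordX _ _ _ _]/(cX G t) => /orbitP[y yY <-].
by rewrite /= /aperm /T_ (moved_Y H2).
Qed.

Lemma cY_moved t : t \in T_ G -> cY G t \in T_ G.
Proof.
move=> tT; have [_] := coordY_mem H1 H2 t; rewrite -[coordY _ _ _ _]/(cY G t) => /orbitP[x xX <-].
by rewrite /= /aperm /T_ moved_X.
Qed.

Lemma code_AT : A_ G \subset T_ G.
Proof. by apply/subsetP=> _ /imsetP[t tT ->]; exact: cX_moved. Qed.

Lemma code_BT : B_ G \subset T_ G.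
Proof. by apply/subsetP=> _ /imsetP[t /setIdP[tT _] ->]; exact: cY_moved. Qed.

Lemma X_fix_off x t : x \in X G -> t \notin T_ G -> x t = t.
Proof. by move=> xX tT; apply/eqP; apply: contraR tT => xt; apply/movedP; exists x. Qed.

Lemma X_norm_A x : x \in X G -> x \in 'N(A_ G | 'P).
Proof.
move=> xX; apply/astabsP=> u /=; rewrite /aperm.
have sub z v : z \in X G -> v \in A_ G -> z v \in A_ G.
  move=> zX /imsetP[t tT ->]; apply/imsetP; exists (z t); first by rewrite /T_ moved_X.
  by rewrite /cX (coordX_X H1 H2).
apply/idP/idP=> [|]; last exact: sub.
by move/(sub x^-1 _ (groupVr xX)); rewrite permK.
Qed.

Let S := (C :\: T_ G) :|: B_ G.

Lemma Y_norm_S y : y \in Y G -> y \in 'N(S | 'P).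
Proof.
move=> yY; apply/astabsP=> u /=; rewrite /aperm.
have sub z v : z \in Y G -> v \in S -> z v \in S.
  move=> zY; case/setUP=> [/setDP[vC vT]|/imsetP[t /setIdP[tT lt] ->]]; apply/setUP.
    left; apply/setDP; split; last by rewrite /T_ (moved_Y H2).
    have : z \in sym_on C by rewrite (subsetP sG) // (subsetP (pcore_sub q^' G)).
    by rewrite inE => h; rewrite (perm_closed v h).
  right; apply/imsetP; exists (z t); last by rewrite /cY (coordY_Y H1 H2).
  apply/setIdP; split; first by rewrite (moved_Y H2).
  by rewrite (orbit_act 'P t zY).
apply/idP/idP=> [|]; last exact: sub.
by move/(sub y^-1 _ (groupVr yY)); rewrite permK.
Qed.

Lemma Y_fix_off y t : y \in Y G -> t \in T_ G -> cY G t \notin B_ G -> y t = t.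
Proof.
move=> yY tT cB; have o1 : #|orbit 'P (Y G) t| <= 1.
  by rewrite leqNgt; apply: contra cB => lt; apply/imsetP; exists t => //; apply/setIdP.
have /card_le1_eqP h := o1; apply: h; first exact: orbit_refl.
by apply/orbitP; exists y.
Qed.
End OneGroup.

(** An element of the q-part moves X-coordinates as it acts on A and keeps Y-coordinates; one of the
    complement does the reverse with B. The code makes the coordinates of both groups equal, so
    equal actions on A, on B and outside T give equal permutations. *)
Lemma code_pcore_eq G G' : G \in nil_subs q C -> G' \in nil_subs q C -> nil_code G = nil_code G' ->
  restr_perm (A_ G) @* X G = restr_perm (A_ G) @* X G' ->
  restr_perm (C :\: T_ G :|: B_ G) @* Y G = restr_perm (C :\: T_ G :|: B_ G) @* Y G' ->
  G \subset G'.
Proof.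
move=> GC GC' [eT eA eB ef eh] eX eY.
have HX t : t \in T_ G -> cX G t = cX G' t.
  by move=> tT; have /ffunP/(_ t) := ef; rewrite !ffunE -eT tT => -[].
have HY t : t \in T_ G -> cY G t = cY G' t.
  by move=> tT; have /ffunP/(_ t) := eh; rewrite !ffunE -eT tT => -[].
have P1 := pcore_prod GC; have P2 := pcore_comm GC; have P3 := pcore_coprime G.
have Q1 := pcore_prod GC'; have Q2 := pcore_comm GC'; have Q3 := pcore_coprime G'.
suff sub : X G * Y G \subset X G' * Y G' by move: sub; rewrite P1 Q1.
apply: mulgSS; apply/subsetP=> x xX.
  have : restr_perm (A_ G) x \in restr_perm (A_ G) @* X G by rewrite mem_morphim // X_norm_A.
  rewrite eX => /morphimP[x' x'N x'X ex]; suff -> : x = x' by [].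
  apply/permP=> t; have [tT|tT] := boolP (t \in T_ G); last first.
    by rewrite (X_fix_off xX tT) (X_fix_off (G := G') x'X) -?eT.
  have xtT : x t \in T_ G by rewrite /T_ moved_X.
  have x'tT : x' t \in T_ G by rewrite eT /T_ moved_X // -/(T_ G') -eT.
  have aA : cX G t \in A_ G by apply/imsetP; exists t.
  apply: (coord_inj P1 P2 P3).
    rewrite (coordX_X P1 P2 P3) // -[RHS]/(cX G (x' t)) (HX _ x'tT) /cX (coordX_X Q1 Q2 Q3) //.
    rewrite -/(cX G t) -/(cX G' t) -HX // -(restr_permE (X_norm_A GC xX) aA) ex restr_permE //.
  rewrite (coordY_X P1 P2 P3) // -[RHS]/(cY G (x' t)) (HY _ x'tT) /cY (coordY_X Q1 Q2 Q3) //.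
  exact: HY.
set S := C :\: T_ G :|: B_ G in eY.
have : restr_perm S x \in restr_perm S @* Y G by rewrite mem_morphim // Y_norm_S.
rewrite eY => /morphimP[x' x'N x'Y ex]; suff -> : x = x' by [].
apply/permP=> t; have [tT|tT] := boolP (t \in T_ G); last first.
  have [tC|tC] := boolP (t \in C); last first.
    by rewrite (sub_sym_on_moved GC (pcore_sub _ _) xX tC) (sub_sym_on_moved GC' (pcore_sub _ _) x'Y tC).
  have tS : t \in S by apply/setUP; left; apply/setDP.
  by rewrite -(restr_permE (Y_norm_S GC xX) tS) ex restr_permE.
have xtT : x t \in T_ G by rewrite /T_ (moved_Y P2).
have x'tT : x' t \in T_ G by rewrite eT /T_ (moved_Y Q2) // -/(T_ G') -eT.
have [bB|bB] := boolP (cY G t \in B_ G); last first.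
  rewrite (Y_fix_off xX tT bB) (Y_fix_off (G := G') x'Y) -?eT //.
  by rewrite -HY // -eB.
apply: (coord_inj P1 P2 P3).
  rewrite (coordX_Y P1 P2 P3) // -[RHS]/(cX G (x' t)) (HX _ x'tT) /cX (coordX_Y Q1 Q2 Q3) //.
  exact: HX.
rewrite (coordY_Y P1 P2 P3) // -[RHS]/(cY G (x' t)) (HY _ x'tT) /cY (coordY_Y Q1 Q2 Q3) //.
have bS : cY G t \in S by apply/setUP; right.
by rewrite -/(cY G t) -/(cY G' t) -HY // -(restr_permE (Y_norm_S GC xX) bS) ex restr_permE.
Qed.

Lemma card_same_code k :
  #|[set G in nil_subs q C | nil_code G == k]| <=
    #|psubs q (sym_on k.1.1.2)| * #|nil_subs q.+1 (C :\: k.1.1.1 :|: k.1.2)|.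
Proof.
case: k => [[[T A] B] [f h]] /=; set F := [set G in _ | _]; rewrite -cardsX.
pose S := C :\: T :|: B.
pose r (G : {group 'S_n}) : {group 'S_n} * {group 'S_n} := ((restr_perm A @* X G)%G, (restr_perm S @* Y G)%G).
apply: (@leq_card_in _ _ _ _ r) => [G G'|G].
  case/setIdP=> GC /eqP eG /setIdP[GC' /eqP eG'] e.
  have [eT eA eB _ _] := eG.
  have eX : restr_perm A @* X G = restr_perm A @* X G' by exact: (congr1 (fun z => gval z.1) e).
  have eY : restr_perm S @* Y G = restr_perm S @* Y G' by exact: (congr1 (fun z => gval z.2) e).
  have eC : nil_code G = nil_code G' by rewrite eG.
  have [eT' eA' eB' _ _] := eC.
  apply/val_inj/eqP; rewrite eqEsubset; apply/andP; split; apply: code_pcore_eq => //.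
  - by rewrite eA.
  - by rewrite eT eB.
  - by rewrite -eA' eA.
  - by rewrite -eT' -eB' eT eB.
case/setIdP=> GC /eqP eG; have [nG sG pG] := nil_subsP _ _ _ GC; apply/setXP; split=> /=.
  apply/psubsP; split; first by apply: morphim_pgroup; exact: pcore_pgroup.
  by apply/subsetP=> _ /morphimP[x _ _ ->]; rewrite inE restr_perm_on.
apply/nil_subsP; split.
- by apply: morphim_nil; apply: nilpotentS nG; exact: pcore_sub.
- by apply/subsetP=> _ /morphimP[x _ _ ->]; rewrite inE restr_perm_on.
move=> r' pr' r'd; have r'Y : r' %| #|Y G| by apply: dvdn_trans r'd _; exact: dvdn_morphim.
rewrite ltn_neqAle pG //; last by apply: dvdn_trans r'Y _; apply: cardSg; exact: pcore_sub.
rewrite andbT; apply: contraTneq r'Y => <-; have := pcore_pgroup q^' G.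
by rewrite /pgroup p'natE.
Qed.

Definition nil_split (x : {set 'I_n} * {set 'I_n} * {set 'I_n}) :=
  [&& x.1.1 \subset C, x.1.2 \subset x.1.1, x.2 \subset x.1.1,
      #|x.1.2| + #|x.2| <= #|x.1.1| & 2 * #|x.2| <= #|x.1.1|].

(** The power of n + 1 counts the two coordinate maps in [nil_code], functions to [option 'I_n]
    supported on T. *)
Lemma card_nil_subs_step :
  #|nil_subs q C| <= \sum_(x | nil_split x)
    n.+1 ^ (2 * #|x.1.1|) * (#|psubs q (sym_on x.1.2)| * #|nil_subs q.+1 (C :\: x.1.1 :|: x.2)|).
Proof.
pose w (x : {set 'I_n} * {set 'I_n} * {set 'I_n}) :=
  (#|psubs q (sym_on x.1.2)| * #|nil_subs q.+1 (C :\: x.1.1 :|: x.2)|)%N.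
pose Fs (x : {set 'I_n} * {set 'I_n} * {set 'I_n}) := pffun_on (None : option 'I_n) (mem x.1.1) predT.
pose Q x (y : {ffun 'I_n -> option 'I_n} * {ffun 'I_n -> option 'I_n}) := (y.1 \in Fs x) && (y.2 \in Fs x).
apply: (@leq_trans (\sum_(k : codeT | nil_split k.1 && Q k.1 k.2) #|[set G in nil_subs q C | nil_code G == k]|)).
  apply: card_bigcup_le => G GC; exists (nil_code G); last by apply/setIdP.
  have P1 := pcore_prod GC; have P2 := pcore_comm GC; have P3 := pcore_coprime G.
  have [c1 c2] := card_coords P1 P2 P3.
  have fP (g : 'I_n -> 'I_n) : [ffun t => if t \in T_ G then Some (g t) else None] \in Fs (nil_code G).1.
    apply/pffun_onP; split; last by move=> u _; rewrite inE.
    by apply/supportP=> t tT; rewrite ffunE (negPf tT).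
  apply/andP; split; last by apply/andP; split; exact: fP.
  by apply/and5P; split; [exact: code_TC|exact: code_AT|exact: code_BT|exact: c1|exact: c2].
apply: (@leq_trans (\sum_(k : codeT | nil_split k.1 && Q k.1 k.2) w k.1)).
  by apply: leq_sum => k _; exact: card_same_code.
rewrite -(pair_big_dep nil_split Q (fun x _ => w x)) /=; apply: leq_sum => x _.
rewrite sum_nat_const leq_mul2r; apply/orP; right.
have -> : #|[pred y | Q x y]| = (#|Fs x| * #|Fs x|)%N by rewrite -cardX; apply: eq_card => y.
by rewrite card_pffun_on card_option card_ord mul2n -addnn expnD.
Qed.
End NilSubs.

Local Close Scope group_scope.

(** * Estimates *)

Lemma few_bad_const (c : nat) : exists K : nat, forall (gT : finGroupType) (G : {group gT}), (2.-group G)%g ->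
  exists bad : {set {group gT}}, ((#|bad| - K) ^ c <= K ^ c * #|G|)%N /\
    forall B : {group gT}, B \subset G -> #|G : B|%g = 2%N -> B \notin bad -> (frank 2 B <= frank 2 G + K)%N.
Proof.
exists (2 ^ (1 + 2 * 4 ^ c))%N => gT G pG; exists (bad_set G c); split; first exact: few_bad.
move=> B sBG iB Bb; apply: leq_trans (frank_not_bad pG sBG iB Bb) _.
by rewrite leq_add2l; apply: leq_trans (ltnW (ltn_expl _ (ltnSn 1))) _; rewrite leq_exp2l // leq_add2l.
Qed.

Definition step_weight (p t : nat) (gT : finGroupType) (G1 : {group gT}) : nat :=
  p ^ (t * frank p G1) + \sum_(B : {group gT} | (B \subset G1) && (#|G1 : B|%g == p))
        p ^ (t * maxn (p.-1 * frank p G1) (frank p B)).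

Lemma bin_le_exp2 n m : 'C(n, m) <= 2 ^ n.
Proof.
elim: n m => [|n IH] [|m] //; first by rewrite bin0 expn_gt0.
by rewrite binS expnS mul2n -addnn leq_add.
Qed.

(** a^(k+1) is at most (k+1)! times a binomial coefficient, so at most a constant times 2^a; the
    spare factor a absorbs the constant. *)
Lemma expn_le_exp2 (k : nat) : exists a0 : nat, forall a : nat, a0 <= a -> a ^ k <= 2 ^ a.
Proof.
exists (k.+1`! * 2 ^ k.+1).+1 => a le; have a_gt0 : 0 < a by apply: leq_ltn_trans le.
have le' : a ^ k.+1 <= (k.+1)`! * 2 ^ k.+1 * 2 ^ a.
  rewrite -mulnA -expnD addnC; apply: (@leq_trans ((a + k.+1) ^_ k.+1)).
    rewrite ffact_prod -[X in a ^ X <= _]card_ord -prod_nat_const; apply: leq_prod => i _.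
    by have := ltn_ord i; lia.
  by rewrite -bin_ffact mulnC leq_mul2l bin_le_exp2 orbT.
rewrite -(leq_pmul2l a_gt0) -expnS; apply: (leq_trans le').
by rewrite leq_mul2r (ltnW le) orbT.
Qed.

Lemma fact_le_expn n : n`! <= n ^ n.
Proof.
elim: n => // n IH; rewrite factS expnS leq_mul2l /=.
exact: leq_trans IH (leq_expn2l n (leqnSn n)).
Qed.

Lemma fact_expn_le (p k : nat) : 1 < p -> exists C : nat, forall a : nat, a`! ^ k <= C * p ^ (a ^ 2).
Proof.
move=> p1; have [a0 H] := expn_le_exp2 k; exists (a0`! ^ k) => a.
have [le|gt] := leqP a0 a; last first.
  rewrite -[leqLHS]muln1; apply: leq_mul; last by rewrite expn_gt0 ltnW.
  by apply: leq_expn2l; apply: leq_fact; exact: ltnW.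
rewrite -[leqLHS]mul1n; apply: leq_mul; first by rewrite expn_gt0 fact_gt0.
apply: leq_trans (leq_expn2l k (fact_le_expn a)) _.
rewrite -expnM mulnC expnM -[(a ^ 2)%N]/(a * a)%N expnM; apply: leq_expn2l.
exact: leq_trans (H a le) (leq_expn2l a p1).
Qed.

Lemma card_small_subsets n L : #|[set O : {set 'I_n} | #|O| <= L]| <= n.+1 ^ L.
Proof.
pose g (f : {ffun 'I_L -> option 'I_n}) := [set x | [exists i, f i == Some x]].
apply: (@leq_trans #|g @: [set: {ffun 'I_L -> option 'I_n}]|).
  apply/subset_leq_card/subsetP=> O; rewrite inE => OL.
  apply/imsetP; exists [ffun i : 'I_L => nth None (map Some (enum O)) i] => //.
  apply/setP=> x; rewrite inE; apply/idP/existsP => [xO|[i]].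
    have lt : index x (enum O) < #|O| by rewrite cardE index_mem mem_enum.
    exists (Ordinal (leq_trans lt OL)); rewrite ffunE /= (nth_map x) -?cardE //.
    by rewrite nth_index // mem_enum.
  rewrite ffunE; have [lt|ge] := ltnP i (size (map Some (enum O))); last by rewrite nth_default.
  rewrite size_map in lt; rewrite (nth_map x) // => /eqP[<-].
  by rewrite -mem_enum mem_nth.
apply: leq_trans (leq_imset_card _ _) _.
by rewrite cardsT card_ffun card_option !card_ord.
Qed.

(** The three terms are the costs in [num_psubs_bound] of groups with large orbits, of a fixed point
    and of a split-off small orbit; the exponent on the right becomes the error constant per
    point. *)
Lemma dominate_expn N L K : 1 < N -> N + N + N ^ L * K <= N ^ (L + 4 * K + 3).
Proof.
move=> N1; rewrite [X in _ <= X]expnD (expnD N L); have x0 : 0 < N ^ L by rewrite expn_gt0 ltnW.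
have X1 : K < N ^ (4 * K) by apply: leq_trans (ltn_expl K N1) _; rewrite leq_exp2l //; lia.
have N3 : 4 * N <= N ^ 3 by rewrite !expnS expn0; nia.
have h := leq_mul (leq_mul (leqnn (N ^ L)) X1) N3; apply: leq_trans h.
move: (N ^ L) x0 => x x0; rewrite (_ : x * K.+1 * (4 * N) = 4 * (x * N) + 4 * (x * K) * N); last by ring.
have h1 : N <= x * N by rewrite leq_pmull.
have h2 : x * K <= x * K * N by rewrite leq_pmulr // ltnW.
by move: (x * N) (x * K) h1 h2 => y z; nia.
Qed.

Lemma psubs_le_num_psubs q n (A : {set 'I_n}) j : #|psubs q (sym_on A)| <= num_psubs q A j.
Proof.
pose f (s : 'S_n) : 'S_n * 'rV['F_q]_j := (s, 0%R).
have fM : {in sym_on A &, {morph f : x y / (x * y)%g}}.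
  by move=> x y _ _; rewrite /f; congr pair; rewrite -[RHS]/(0 + 0)%R addr0.
apply: (card_psubs_injm _ (H := [group of sym_on A]) (f := Morphism fM)).
  by apply/injmP=> x y _ _ [].
by apply/subsetP=> _ /morphimP[x _ xA ->]; rewrite mem_sym_vec.
Qed.

Lemma card_nil_split n (C : {set 'I_n}) tau :
  #|[set x : {set 'I_n} * {set 'I_n} * {set 'I_n} | nil_split C x && (#|x.1.1| == tau)]| <= n.+1 ^ (3 * tau).
Proof.
pose D := [set O : {set 'I_n} | #|O| <= tau].
apply: (@leq_trans #|setX (setX D D) D|).
  apply/subset_leq_card/subsetP=> -[[T A] B]; rewrite !inE /= => /andP[/and5P[/= _ sA sB _ _] /eqP cT].
  by rewrite -cT leqnn !subset_leq_card.
rewrite !cardsX; have h := card_small_subsets n tau.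
by apply: leq_trans (leq_mul (leq_mul h h) h) _; rewrite -!expnD leq_pexp2l //; lia.
Qed.

Local Open Scope ring_scope.

(** Exponents for [step_weight_stable], with q = p - 1 and D = max(d, m/2). The third bound serves
    the bad subgroups for p = 2; the fourth serves p > 2, where (mu - 1) D is at least 2 t D. *)
Lemma stable_arith (F : realFieldType) (t q mu d D delta m : F) :
  0 <= t -> 1 <= q -> t * q + 1 = mu -> 0 <= d -> d <= D -> m / 2 <= D -> 0 <= m ->
  0 <= delta -> 4 * mu * delta <= 1 ->
  [/\ t * d <= mu * D, t * (q * d) <= (mu - 1) * D, t * (D + delta * m) <= t * D + D / 2 &
    2 <= q -> t * (D + delta * m) <= (mu - 1) * D].
Proof.
move=> t0 q1 emu d0 dD mD m0 dl0 mud.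
have D0 : 0 <= D by exact: le_trans dD.
have tq : t <= t * q by rewrite ler_peMr.
have tmu : mu - 1 = t * q by rewrite -emu addrK.
have a1 : t * d <= t * D by exact: ler_wpM2l.
have a2 : t * D <= t * q * D by exact: ler_wpM2r.
have a3 : t * q * d <= t * q * D by apply: ler_wpM2l => //; apply: le_trans tq.
have a4 : t * delta <= mu * delta by apply: ler_wpM2r => //; rewrite -emu; lra.
have a5 : delta * m <= delta * (2 * D) by apply: ler_wpM2l => //; lra.
have a6 : t * (delta * m) <= t * (delta * (2 * D)) by exact: ler_wpM2l.
have a7 : (t * delta) * (2 * D) <= 4^-1 * (2 * D) by apply: ler_wpM2r; lra.
split.
- have -> : mu * D = t * q * D + D by rewrite -emu; ring.
  lra.
- by rewrite tmu mulrA.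
- rewrite mulrDr; have e : t * (delta * (2 * D)) = (t * delta) * (2 * D) by ring.
  by rewrite e in a6; lra.
move=> q2; have a8 : t * 2 * D <= t * q * D by apply: ler_wpM2r => //; exact: ler_wpM2l.
have a9 : 1 * delta <= mu * delta by apply: ler_wpM2r => //; rewrite -emu; lra.
have a10 : (t * D) * (delta * 2) <= (t * D) * 1 by apply: ler_wpM2l; [exact: mulr_ge0|lra].
have e : t * (delta * (2 * D)) = (t * D) * (delta * 2) by ring.
by rewrite tmu mulrDr; rewrite e in a6; lra.
Qed.

Section PowNat.
Variables (R : realType) (p : nat).
Hypothesis pr : prime p.
Let P (x : R) : R := p%:R `^ x.

Lemma pnat_ge2 : 2 <= p%:R :> R.
Proof. by rewrite ler_nat prime_gt1. Qed.
Let p_ge2 := pnat_ge2.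

Lemma pnat_powRD x y : P (x + y) = P x * P y.
Proof. by rewrite /P powRD //; apply/implyP => _; rewrite pnatr_eq0 -lt0n prime_gt0. Qed.

Lemma pnat_powR_gt0 x : 0 < P x.
Proof. by rewrite powR_gt0 // (lt_le_trans _ p_ge2). Qed.

Lemma pnat_powR_ge0 x : 0 <= P x. Proof. exact: ltW (pnat_powR_gt0 x). Qed.

Lemma pnat_ler_powR x y : x <= y -> P x <= P y.
Proof. by apply: ler_powR; move: p_ge2; lra. Qed.

Lemma pnat_powR_nat k : P k%:R = (p ^ k)%N%:R.
Proof. by rewrite /P powR_mulrn // natrX. Qed.

Lemma pnat_powR_ge1 x : 0 <= x -> 1 <= P x.
Proof. by move=> x0; rewrite -[1](powRr0 p%:R); exact: pnat_ler_powR. Qed.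

Lemma pnat_le_powR (k : nat) x : k%:R <= x -> (p ^ k)%N%:R <= P x.
Proof. by move=> kx; rewrite -pnat_powR_nat; exact: pnat_ler_powR. Qed.
End PowNat.

Section Stable.
Variables (R : realType) (p mu : nat).
Hypotheses (pr : prime p).
Let P (x : R) : R := p%:R `^ x.

(* Only p = 2 is delicate: all 2 ^ d subgroups B of index 2 occur in the sum,
   but by [few_bad_const] at most [2 ^ (m / 4)] of them, up to a constant, have
   rank larger than that of G1 by more than a constant. *)
Lemma step_weight_stable : exists C : nat, forall (t : nat) (gT : finGroupType) (G1 : {group gT}) (m delta : R),
  (t * p.-1 + 1 = mu)%N -> (p.-group G1)%g -> 0 <= m -> 0 <= delta -> 4 * mu%:R * delta <= 1 ->
  #|G1|%:R <= P (p%:R * m) ->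
  (forall B : {group gT}, B \subset G1 -> #|G1 : B|%g = p ->
     (frank p B)%:R <= Num.max (frank p G1)%:R (m / 2) + delta * m) ->
  (step_weight p t G1)%:R <= C%:R * P (mu%:R * Num.max (frank p G1)%:R (m / 2)).
Proof.
(* As |G1| <= 2^(2m) for p = 2, an 8th root leaves about 2^(m/4) bad subgroups, and m/4 <= D/2 fits
   into the slack of the exponent. *)
have [K HK] := few_bad_const 8.
exists (1 + 1 + (p ^ (mu * K) + (K + K)))%N => t gT G1 m delta tmu pG1 m0 delta0 dmu cG1 stab.
set d1 := frank p G1; set D := Num.max _ _.
have D1 : d1%:R <= D by rewrite le_max lexx.
have D2 : m / 2 <= D by rewrite le_max lexx orbT.
have D0 : 0 <= D by apply: le_trans D1.
have muR : t%:R * p.-1%:R + 1 = mu%:R :> R by rewrite -tmu natrD natrM.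
have q1 : 1 <= p.-1%:R :> R by rewrite ler1n; have := prime_gt1 pr; case: (p) => [|[]].
have [ar1 ar2 ar3 ar4] := stable_arith (ler0n R t) q1 muR (ler0n R d1) D1 D2 m0 delta0 dmu.
have P0 x : 0 <= P x by exact: pnat_powR_ge0.
have PM x y : x <= y -> P x <= P y by exact: pnat_ler_powR.
have PD x y : P (x + y) = P x * P y by exact: pnat_powRD.
have PN (k : nat) x : k%:R <= x -> (p ^ k)%N%:R <= P x by exact: pnat_le_powR.
have maxR (a b : nat) : (maxn a b)%:R = Num.max a%:R b%:R :> R.
  by rewrite /maxn; case: ltnP => h; [rewrite max_r|rewrite max_l] => //; rewrite ler_nat // ltnW.
rewrite /step_weight natrD natrD mulrDl; apply: lerD.
  rewrite -[leLHS]mul1r; apply: ler_pM => //; first by rewrite ler1n.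
  by apply: PN; rewrite natrM.
rewrite natr_sum.
set IB := (X in \sum_(B | X B) _).
have cB : #|[pred B | IB B]| = #|[set B | IB B]| by rewrite cardsE.
have {}cB : #|[pred B | IB B]|%:R <= P d1%:R.
  by rewrite cB /P pnat_powR_nat // ler_nat; exact: card_index_p_subgroups.
(* For p > 2 the count of all p^d subgroups B suffices, each term being at most p^((mu - 1) D). *)
have [p3|p_le2] := ltnP 2 p.
  have q2 : 2 <= p.-1%:R :> R by rewrite ler_nat; case: (p) p3 => [|[|[]]].
  apply: (@le_trans _ _ (\sum_(B | IB B) P ((mu%:R - 1) * D))).
    apply: ler_sum => B /andP[sB /eqP iB]; apply: PN; rewrite natrM maxR.
    have dB := stab B sB iB.
    case: (leP (p.-1 * d1)%:R (frank p B)%:R) => _; last by rewrite natrM.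
    by apply: le_trans (ar4 q2); apply: ler_wpM2l.
  rewrite sumr_const -[leLHS]mulr_natl; apply: (@le_trans _ _ (P (mu%:R * D))).
    have -> : mu%:R * D = D + (mu%:R - 1) * D by ring.
    by rewrite PD; apply: ler_wpM2r => //; apply: le_trans cB _; exact: PM.
  by rewrite ler_peMl // ler1n addn_gt0 expn_gt0 prime_gt0.
have p2 : p = 2%N by apply/eqP; rewrite eqn_leq p_le2 prime_gt1.
have pG2 : (2.-group G1)%g by rewrite -p2.
have [bad [cbad nbad]] := HK _ G1 pG2.
rewrite (bigID (mem bad)) /= addrC natrD mulrDl; apply: lerD.
  apply: (@le_trans _ _ (\sum_(B | IB B) P (t%:R * (d1%:R + K%:R)))).
    rewrite [leRHS](bigID (mem bad)) /= -[leLHS]add0r; apply: lerD; first by apply: sumr_ge0 => *.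
    apply: ler_sum => B /andP[/andP[sB /eqP iB] Bb]; apply: PN; rewrite natrM maxR.
    apply: ler_wpM2l => //; rewrite ge_max -natrD !ler_nat /d1 p2 /= mul1n leq_addr /=.
    by rewrite p2 in iB; rewrite nbad.
  rewrite sumr_const -[leLHS]mulr_natl.
  apply: (@le_trans _ _ (P d1%:R * P (t%:R * (d1%:R + K%:R)))); first exact: ler_wpM2r.
  have -> : (p ^ (mu * K))%N%:R = P (mu%:R * K%:R) by rewrite -natrM /P pnat_powR_nat.
  rewrite -!PD; apply: PM.
  have tmuR : t%:R + 1 = mu%:R :> R by rewrite -muR p2 mulr1.
  have dD : mu%:R * d1%:R <= mu%:R * D by exact: ler_wpM2l.
  have K0 : 0 <= K%:R :> R by [].
  rewrite -tmuR in dD *.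
  by move: dD; rewrite !mulrDl !mul1r mulrDr; lra.
rewrite (eq_bigl (fun B => (B \in bad) && IB B)); last by move=> B; rewrite andbC.
apply: (@le_trans _ _ (\sum_(B in bad) P (t%:R * (D + delta * m)))).
  rewrite big_mkcondr /=; apply: ler_sum => B Bb; case: ifP => // /andP[sB /eqP iB].
  apply: PN; rewrite natrM maxR; apply: ler_wpM2l => //.
  rewrite ge_max stab // andbT (_ : (p.-1 * frank p G1)%N = d1); last by rewrite /d1 p2 /= mul1n.
  by apply: le_trans D1 _; rewrite lerDl mulr_ge0.
rewrite sumr_const -[leLHS]mulr_natl.
have cbad' : #|bad|%:R <= K%:R + K%:R * P (m / 4) :> R.
  have le : (#|bad| - K)%N%:R <= K%:R * P (m / 4) :> R.
    rewrite -(@ler_pXn2r _ 8) ?nnegrE ?mulr_ge0 ?P0 // exprMn -!natrX.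
    rewrite -[P (m / 4) ^+ 8]powR_mulrn ?P0 // -powRrM.
    have -> : m / 4 * 8%:R = 2 * m by lra.
    apply: le_trans (_ : (K ^ 8 * #|G1|)%N%:R <= _); first by rewrite ler_nat.
    rewrite natrM; apply: ler_wpM2l => //.
    by have -> : 2 * m = p%:R * m by rewrite p2.
  rewrite -lerBlDl; apply: le_trans le; by rewrite lerBlDr -natrD ler_nat addnC -leq_subLR.
have PM1 : 1 <= P (m / 4) by apply: pnat_powR_ge1 => //; lra.
apply: (@le_trans _ _ ((K + K)%N%:R * P (m / 4) * P (t%:R * (D + delta * m)))).
  apply: ler_wpM2r => //; apply: le_trans cbad' _; rewrite natrD mulrDl lerD2r ler_peMr //.
rewrite -mulrA -PD; apply: ler_wpM2l => //; apply: PM.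
have tmuR : t%:R + 1 = mu%:R :> R by rewrite -muR p2 mulr1.
clear -ar3 D2 tmuR; by rewrite -tmuR mulrDl mul1r; lra.
Qed.
End Stable.

(** (m + i)^2 / 4 - i (1/2 + delta) m equals m^2 / 4 + i^2 / 4 - i delta m, which is least at i = 2
    delta m with gain delta^2 m^2. Half of the gain pays for the term delta^2 m^2 / 2 on the left;
    completing a square bounds the linear terms c m against the other half. *)
Lemma unstable_arith (F : realFieldType) (m j i mu p delta : F) :
  0 <= i -> i <= 2 * delta * m -> 2 * delta * m < i + 1 -> j <= m -> 0 <= m -> 0 <= mu -> 0 < delta ->
  p * mu * m + delta ^+ 2 / 2 * m ^+ 2 + j + ((m + i) ^+ 2 / 4 + 2 * (j + i) - i * ((2^-1 + delta) * m)) <=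
  (p * mu + 1 + 5 * delta) ^+ 2 / (2 * delta ^+ 2) + ((m + mu) ^+ 2 / 4 + 2 * j).
Proof.
move=> i0 i_le i_gt jm m0 mu0 dl0; set c := p * mu + 1 + 5 * delta.
have h1 : i * i <= i * (2 * delta * m) by exact: ler_wpM2l.
have h2 : (2 * delta * m - 1) * (delta * m) <= i * (delta * m).
  by apply: ler_wpM2r; [rewrite mulr_ge0 // ltW|lra].
have h3 : 0 <= mu * m by exact: mulr_ge0.
have h4 : 0 <= mu * mu by exact: mulr_ge0.
have h5 : 0 <= (delta * m - c / delta) ^+ 2 by exact: sqr_ge0.
have h6 : (delta * m - c / delta) ^+ 2 = delta ^+ 2 * m ^+ 2 - 2 * (c * m) + 2 * (c ^+ 2 / (2 * delta ^+ 2)).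
  by field; rewrite gt_eqF.
have h7 : c * m = p * mu * m + m + 5 * (delta * m) by rewrite /c; ring.
have h8 : 0 <= delta * m by rewrite mulr_ge0 // ltW.
have e1 : i * (2 * delta * m) = 2 * (i * (delta * m)) by ring.
have e2 : (2 * delta * m - 1) * (delta * m) = 2 * (delta ^+ 2 * m ^+ 2) - delta * m by ring.
have e3 : (m + i) ^+ 2 = m ^+ 2 + 2 * (i * m) + i * i by ring.
have e4 : i * ((2^-1 + delta) * m) = 2^-1 * (i * m) + i * (delta * m) by ring.
have e5 : (m + mu) ^+ 2 = m ^+ 2 + 2 * (mu * m) + mu * mu by ring.
have e6 : delta ^+ 2 / 2 * m ^+ 2 = 2^-1 * (delta ^+ 2 * m ^+ 2) by ring.
have i_le' : i <= 2 * (delta * m) by rewrite mulrA.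
rewrite e3 e4 e5 e6; rewrite h6 h7 in h5; rewrite e1 in h1; rewrite e2 in h2.
move: (delta ^+ 2 * m ^+ 2) (c ^+ 2 / _) (p * mu * m) (i * (delta * m)) (i * m) (mu * m) (mu * mu) (i * i) (delta * m) (m ^+ 2) h1 h2 h3 h4 h5 h8 i_le'.
clear -jm m0 => *; lra.
Qed.

Section Core.
Variables (R : realType) (p mu : nat).
Hypothesis pr : prime p.
Let P (x : R) : R := p%:R `^ x.

Lemma pnat_powR_le_inv x y : P x <= P y -> x <= y.
Proof.
rewrite /P -ler_ln ?posrE ?pnat_powR_gt0 // !ln_powR ler_pM2r //.
by apply: ln_gt0; rewrite ltr1n prime_gt1.
Qed.

Lemma step_weight_crude (t : nat) (gT : finGroupType) (G1 : {group gT}) (m : R) :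
  (t * p.-1 + 1 = mu)%N -> (p.-group G1)%g -> 0 <= m -> #|G1|%:R <= P (p%:R * m) ->
  (step_weight p t G1)%:R <= 2 * P (p%:R * mu%:R * m).
Proof.
move=> tmu pG1 m0 cG1; have p1 := prime_gt1 pr.
have pR : 1 < p%:R :> R by rewrite ltr1n.
have P0 x : 0 <= P x by exact: pnat_powR_ge0.
have frk (H : {group gT}) : H \subset G1 -> (frank p H)%:R <= p%:R * m.
  move=> sH; have : P (frank p H)%:R <= P (p%:R * m).
    apply: le_trans cG1; rewrite /P pnat_powR_nat // ler_nat.
    exact: leq_trans (frank_card pr (pgroupS sH pG1)) (subset_leq_card sH).
  exact: pnat_powR_le_inv.
have q1 : (0 < p.-1)%N by case: (p) p1 => [|[]].
have tmuR : t%:R * p.-1%:R + 1 = mu%:R :> R by rewrite -tmu natrD natrM.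
have tq : t%:R <= t%:R * p.-1%:R :> R by rewrite ler_peMr // ler1n.
have pm0 : 0 <= p%:R * m by rewrite mulr_ge0 // ltW // ltr0n prime_gt0.
have d1m := frk G1 (subxx _).
have main (k : nat) : k%:R <= p.-1%:R * (p%:R * m) -> (t * k)%N%:R <= (mu%:R - 1) * (p%:R * m).
  move=> km; rewrite natrM -tmuR addrK -mulrA; exact: ler_wpM2l.
rewrite /step_weight natrD mulr_natl mulr2n; apply: lerD.
  apply: pnat_le_powR => //; rewrite natrM.
  apply: (@le_trans _ _ (t%:R * (p%:R * m))); first exact: ler_wpM2l.
  have -> : p%:R * mu%:R * m = mu%:R * (p%:R * m) by ring.
  by apply: ler_wpM2r => //; rewrite -tmuR; lra.
rewrite natr_sum; set IB := (X in \sum_(B | X B) _).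
apply: (@le_trans _ _ (\sum_(B | IB B) P ((mu%:R - 1) * (p%:R * m)))).
  apply: ler_sum => B /andP[sB /eqP iB]; apply: pnat_le_powR => //; apply: main.
  have [h|h] := leqP (p.-1 * frank p G1) (frank p B).
    apply: le_trans (frk B sB) _; rewrite ler_peMl // ler1n //.
  by rewrite natrM; apply: ler_wpM2l.
rewrite sumr_const -[leLHS]mulr_natl.
have -> : p%:R * mu%:R * m = p%:R * m + (mu%:R - 1) * (p%:R * m) by ring.
rewrite /P pnat_powRD //; apply: ler_wpM2r; first exact: P0.
apply: (@le_trans _ _ (P (frank p G1)%:R)); last exact: pnat_ler_powR.
rewrite /P pnat_powR_nat // ler_nat; apply: leq_trans (card_index_p_subgroups pr pG1).
by rewrite cardsE.
Qed.

(* The unstable groups G1 have a subgroup B of index p and rank above (1/2 +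
   delta) m. By [moment] with i close to 2 delta m they are rarer by a factor
   [p ^ (delta ^ 2 m ^ 2)], which beats [#|A|`!]. For the stable ones apply
   [moment] with i = mu if d exceeds m / 2, and count them trivially
   otherwise. *)
Lemma sum_step_weight_le : (0 < mu)%N -> exists Kc : nat, forall (t n : nat) (A : {set 'I_n}) (j : nat) (W : R),
  (t * p.-1 + 1 = mu)%N -> 0 <= W ->
  (forall j' : nat, (num_psubs p A j')%:R <= P ((#|A|%:R / p%:R + j'%:R) ^+ 2 / 4 + 2 * j'%:R) * W) ->
  (\sum_(G1 in psubs p (sym_vec p A j)) step_weight p t G1)%N%:R <=
  Kc%:R * (P ((#|A|%:R / p%:R + j%:R + mu%:R) ^+ 2 / 4 + 2 * j%:R) * W).
Proof.
move=> mu_gt0; have [C HC] := step_weight_stable R mu pr.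
(* With delta = 1 / (4 mu), k delta^2 / 2 = p^2. Since |A| <= p m, the k-th root of [fact_expn_le]
   bounds |A|! by a constant times p^(delta^2 m^2 / 2). *)
pose k := (32 * p ^ 2 * mu ^ 2)%N.
have [Cf HCf] := fact_expn_le k (prime_gt1 pr).
pose delta : R := (4 * mu%:R)^-1.
pose X : R := (p%:R * mu%:R + 1 + 5 * delta) ^+ 2 / (2 * delta ^+ 2).
have muR : 0 < mu%:R :> R by rewrite ltr0n.
have dl0 : 0 < delta by rewrite invr_gt0 mulr_gt0.
pose Kr : R := C%:R * (P (2 * mu%:R) + 1) + 2 * Cf%:R * P X.
exists (Num.Def.archi_bound Kr) => t n A j W tmu W0 IH.
set m := #|A|%:R / p%:R + j%:R.
have P0 x : 0 <= P x by exact: pnat_powR_ge0.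
have PM x y : x <= y -> P x <= P y by exact: pnat_ler_powR.
have PD x y : P (x + y) = P x * P y by exact: pnat_powRD.
have pR : 0 < p%:R :> R by rewrite ltr0n prime_gt0.
have a0 : 0 <= #|A|%:R / p%:R :> R by rewrite divr_ge0.
have m0 : 0 <= m by rewrite addr_ge0.
have jm : j%:R <= m by rewrite lerDr.
set Y := P ((m + mu%:R) ^+ 2 / 4 + 2 * j%:R).
suff main : (\sum_(G1 in psubs p (sym_vec p A j)) step_weight p t G1)%N%:R <= Kr * (Y * W).
  apply: le_trans main _; apply: ler_wpM2r; first by rewrite mulr_ge0 ?P0.
  by apply/ltW/archi_boundP; rewrite addr_ge0 ?mulr_ge0 ?addr_ge0 ?P0.
have pm : p%:R * m = #|A|%:R + p%:R * j%:R by rewrite mulrDr mulrCA divff ?gt_eqF // mulr1.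
have cG (G1 : {group 'S_n * 'rV['F_p]_j}) : G1 \in psubs p (sym_vec p A j) -> #|G1|%:R <= P (p%:R * m).
  case/psubsP=> pG sG; rewrite pm; apply: (@le_trans _ _ (p ^ (#|A| + j))%N%:R); last first.
    by apply: pnat_le_powR => //; rewrite natrD lerD2l ler_peMl // ler1n prime_gt0.
  rewrite ler_nat card_fst expnD; apply: leq_mul.
    have := card_pgroup_sym_on pr (morphim_pgroup (fst_morphism _ _) pG); rewrite /= morphim_fstE; apply.
    by apply/subsetP=> _ /imsetP[x xG ->]; have := subsetP sG x xG; rewrite mem_sym_vec.
  by rewrite (leq_trans (max_card _)) // card_mx card_Fp // mul1n.
rewrite natr_sum.
pose stab (G1 : {group 'S_n * 'rV['F_p]_j}) := [forall B : {group 'S_n * 'rV['F_p]_j},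
  ((B \subset G1) && (#|G1 : B|%g == p)) ==>
  ((frank p B)%:R <= Num.max (frank p G1)%:R (m / 2) + delta * m)].
rewrite (bigID stab) /= mulrDl; apply: lerD.
  apply: (@le_trans _ _ (\sum_(G1 in psubs p (sym_vec p A j))
     C%:R * ((p ^ (mu * frank p G1))%N%:R + P (mu%:R * (m / 2))))).
    rewrite big_mkcondr /=; apply: ler_sum => G1 GX; case: ifP => [/forallP st|_]; last first.
      by rewrite mulr_ge0 ?addr_ge0 ?P0.
    have [pG _] := psubsP _ _ _ GX.
    apply: le_trans (HC t _ G1 m delta tmu pG m0 (ltW dl0) _ (cG _ GX) _) _.
    - by rewrite /delta mulfV // gt_eqF // mulr_gt0.
    - by move=> B sB iB; have := st B; rewrite sB iB eqxx.
    apply: ler_wpM2l => //; have [_|_] := leP (frank p G1)%:R (m / 2); first by rewrite lerDr.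
    by rewrite -natrM /P pnat_powR_nat // lerDl P0.
  rewrite -mulr_sumr -mulrA -[(P _ + 1) * _]mulrC; apply: ler_wpM2l => //.
  rewrite big_split /= mulrDr mulr1; apply: lerD.
    rewrite -natr_sum; apply: le_trans (_ : (num_psubs p A (j + mu))%:R <= _); first by rewrite ler_nat moment.
    apply: le_trans (IH _) _; rewrite [leRHS]mulrAC; apply: ler_wpM2r => //; rewrite -PD; apply: PM.
    by rewrite /m natrD addrA; lra.
  rewrite sumr_const -[leLHS]mulr_natl.
  apply: (@le_trans _ _ (P (m ^+ 2 / 4 + 2 * j%:R) * W * P (mu%:R * (m / 2)))).
    by apply: ler_wpM2r => //; exact: IH.
  rewrite mulrAC; apply: ler_wpM2r => //; rewrite -PD; apply: PM.
  have : 0 <= mu%:R ^+ 2 :> R by exact: sqr_ge0.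
  have -> : (m + mu%:R) ^+ 2 = m ^+ 2 + 2 * (mu%:R * m) + mu%:R ^+ 2 by ring.
  by rewrite mulrA; move: (mu%:R * m) (mu%:R ^+ 2) => x y; lra.
pose Bd (B : {group 'S_n * 'rV['F_p]_j}) := (2^-1 + delta) * m <= (frank p B)%:R.
pose U := [set G in psubs p (sym_vec p A j) | [exists B : {group 'S_n * 'rV['F_p]_j}, [&& B \subset G, #|G : B|%g == p & Bd B]]].
apply: (@le_trans _ _ (\sum_(G1 in U) 2 * P (p%:R * mu%:R * m))).
  rewrite [leRHS](bigID (fun G1 => (G1 \in psubs p (sym_vec p A j)) && ~~ stab G1)) /= -[leLHS]addr0; apply: lerD; last first.
    by apply: sumr_ge0 => *; rewrite mulr_ge0 ?P0.
  rewrite [leRHS](eq_bigl (fun G1 => (G1 \in psubs p (sym_vec p A j)) && ~~ stab G1)).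
    apply: ler_sum => G1 /andP[GX _]; have [pG _] := psubsP _ _ _ GX.
    exact: step_weight_crude tmu pG m0 (cG _ GX).
  move=> G1; rewrite inE; case GX: (G1 \in _) => //=; apply: andb_idl.
  rewrite negb_forall => /existsP[B]; rewrite negb_imply -ltNge => /andP[/andP[sB iB] h].
  apply/existsP; exists B; rewrite sB iB /Bd /=; apply: le_trans (ltW h).
  by rewrite mulrDl lerD2r le_max orbC mulrC lexx.
rewrite sumr_const -[leLHS]mulr_natl.
set i := Num.Def.trunc (2 * delta * m).
have dm0 : 0 <= 2 * delta * m by rewrite mulr_ge0 // mulr_ge0 // ltW.
have /andP[i_le i_gt] := truncn_itv dm0; rewrite -/i in i_le i_gt.
have i_gt' : 2 * delta * m < i%:R + 1 by rewrite natr1.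
set Bset := [set B in psubs p (sym_vec p A j) | Bd B].
have cU : #|U|%:R <= #|A|`!%:R * P j%:R * #|Bset|%:R :> R.
  rewrite /P pnat_powR_nat // -!natrM ler_nat -card_sym_vec //.
  exact: (card_index_p_over [group of sym_vec p A j] Bd pr).
have cB : #|Bset|%:R * P (i%:R * ((2^-1 + delta) * m)) <= P ((m + i%:R) ^+ 2 / 4 + 2 * (j%:R + i%:R)) * W.
  apply: le_trans (_ : (num_psubs p A (j + i))%:R <= _); last first.
    by apply: le_trans (IH _) _; rewrite natrD addrA.
  apply: le_trans (_ : (\sum_(G in psubs p (sym_vec p A j)) p ^ (i * frank p G))%N%:R <= _); last by rewrite ler_nat moment.
  rewrite natr_sum mulr_natl -sumr_const /Bset.
  rewrite [leRHS](bigID Bd) /= -[leLHS]addr0; apply: lerD; last by apply: sumr_ge0.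
  rewrite [leLHS](eq_bigl (fun B => (B \in psubs p (sym_vec p A j)) && Bd B)); last by move=> B; rewrite inE.
  apply: ler_sum => B /andP[_ dB]; rewrite -pnat_powR_nat //; apply: PM; rewrite natrM ler_wpM2l //.
have cfact : #|A|`!%:R <= Cf%:R * P (delta ^+ 2 / 2 * m ^+ 2).
  have k0 : (0 < k)%N by rewrite /k !muln_gt0 (prime_gt0 pr) mu_gt0.
  have Cf1 : (1 <= Cf)%N by have := HCf 0%N; rewrite fact0 exp1n exp0n // expn0 muln1.
  have := HCf #|A|; rewrite -(ler_nat R) natrX natrM => h.
  rewrite -(@ler_pXn2r _ k) ?nnegrE ?mulr_ge0 ?P0 //; apply: le_trans h _.
  rewrite exprMn; apply: ler_pM => //; first by rewrite -natrX ler_nat -[leqLHS]expn1 leq_pexp2l.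
  rewrite -[P _ ^+ k]powR_mulrn ?P0 // -powRrM; apply: pnat_le_powR => //.
  have -> : delta ^+ 2 / 2 * m ^+ 2 * k%:R = (p%:R * m) ^+ 2.
    by rewrite /k /delta !natrM; field; rewrite gt_eqF.
  rewrite natrX; apply: lerXn2r; rewrite ?nnegrE //; first by rewrite mulr_ge0 // ltW.
  by rewrite pm lerDl mulr_ge0 // ltW.
have Pi : 0 < P (i%:R * ((2^-1 + delta) * m)) by exact: pnat_powR_gt0.
have cB' : #|Bset|%:R <= P ((m + i%:R) ^+ 2 / 4 + 2 * (j%:R + i%:R) - i%:R * ((2^-1 + delta) * m)) * W.
  rewrite -(ler_pM2r Pi); apply: (le_trans cB).
  by rewrite [leRHS]mulrAC -PD subrK.
apply: (@le_trans _ _ (Cf%:R * P (delta ^+ 2 / 2 * m ^+ 2) * P j%:R *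
   (P ((m + i%:R) ^+ 2 / 4 + 2 * (j%:R + i%:R) - i%:R * ((2^-1 + delta) * m)) * W) * (2 * P (p%:R * mu%:R * m)))).
  apply: ler_wpM2r; first by rewrite mulr_ge0 ?P0.
  apply: le_trans cU _; apply: ler_pM => //; first by rewrite mulr_ge0 ?P0.
  by apply: ler_wpM2r.
have := unstable_arith p%:R (ler0n R i) i_le i_gt' jm m0 (ltW muR) dl0.
rewrite -/X; set a1 := p%:R * mu%:R * m; set a2 := delta ^+ 2 / 2 * _; set a3 := (X in a1 + a2 + j%:R + X).
set a4 := (X in _ <= _ + X) => le.
have -> : Cf%:R * P a2 * P j%:R * (P a3 * W) * (2 * P a1) = 2 * Cf%:R * (P (a1 + a2 + j%:R + a3) * W).
  by rewrite !PD; ring.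
have -> : 2 * Cf%:R * P X * (Y * W) = 2 * Cf%:R * (P (X + a4) * W) by rewrite PD /Y -/a4; ring.
apply: ler_wpM2l; first by rewrite mulr_ge0.
by apply: ler_wpM2r => //; exact: PM.
Qed.
End Core.

(** (j - i) (i + d) <= (j + d)^2 / 4, and a d <= u^2 / 8 for u = a / p. The other half of u^2 / 4
    and the cross term u j / 2 absorb what d contributes. *)
Lemma large_arith (F : realFieldType) (p a d j i : F) : 2 <= p -> 0 <= a -> 0 <= d -> 0 <= j ->
  8 * p ^+ 2 * d <= a -> a * d + j + (i * (j - i) + (j - i) * d) <= (a / p + j) ^+ 2 / 4 + j.
Proof.
move=> p2 a0 d0 j0 da; have p0 : 0 < p by lra.
set u := a / p; have au : a = p * u by rewrite /u mulrC divfK // gt_eqF.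
have u0 : 0 <= u by rewrite divr_ge0 // ltW.
have du : 8 * (p * d) <= u.
  by rewrite -(ler_pM2l p0) -au; apply: le_trans da; rewrite le_eqVlt; apply/orP; left; apply/eqP; ring.
have h1 : u * (8 * (p * d)) <= u * u by exact: ler_wpM2l.
have h2 : 2 * d <= p * d by exact: ler_wpM2r.
have h3 : 0 <= (j - d - 2 * i) ^+ 2 by exact: sqr_ge0.
have h4 : d * (16 * d) <= d * u by apply: ler_wpM2l => //; lra.
have h5 : u * (16 * d) <= u * u by apply: ler_wpM2l => //; lra.
have h6 : j * d <= j * u by apply: ler_wpM2l => //; lra.
have h7 : 0 <= d * u by exact: mulr_ge0.
have e3 : (j - d - 2 * i) ^+ 2 = (j + d) ^+ 2 - 4 * (i * (j - i) + (j - i) * d) by ring.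
rewrite e3 in h3.
have e1 : u * (8 * (p * d)) = 8 * (a * d) by rewrite au; ring.
rewrite e1 in h1.
have e2 : (u + j) ^+ 2 = u * u + 2 * (j * u) + j * j by ring.
have e4 : (j + d) ^+ 2 = j * j + 2 * (j * d) + d * d by ring.
rewrite e2; rewrite e4 in h3; clear -h1 h3 h4 h5 h6 h7; lra.
Qed.

Section NumPsubs.
Variables (R : realType) (p : nat).
Hypothesis pr : prime p.
Let P (x : R) : R := p%:R `^ x.

Lemma card_large_le n (A : {set 'I_n}) j d : (8 * p ^ 2 * d <= #|A|)%N ->
  #|[set G in psubs p (sym_vec p A j) | (frank p (fst @* G)%g <= d)%N]|%:R <=
  P ((#|A|%:R / p%:R + j%:R) ^+ 2 / 4 + 2 * j%:R) * n.+1%:R ^+ #|A|.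
Proof.
move=> dA; have p0 := prime_gt0 pr.
have P0 x : 0 <= P x by exact: pnat_powR_ge0.
have PM x y : x <= y -> P x <= P y by exact: pnat_ler_powR.
have PD x y : P (x + y) = P x * P y by exact: pnat_powRD.
apply: le_trans (_ : (#|A|`! * p ^ (#|A| * d) * \sum_(i < j.+1) 2 ^ j * p ^ (i * (j - i)) * p ^ ((j - i) * d))%N%:R <= _).
  by rewrite ler_nat card_small_frank.
rewrite -mulnA natrM mulrC; apply: ler_pM => //; last first.
  rewrite -natrX ler_nat; apply: leq_trans (fact_le_expn _) _; apply: leq_expn2l.
  by rewrite (leq_trans (max_card _)) // card_ord.
rewrite natrM natr_sum mulr_sumr.
apply: (@le_trans _ _ (\sum_(i < j.+1) P ((#|A|%:R / p%:R + j%:R) ^+ 2 / 4 + j%:R))).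
  apply: ler_sum => i _; rewrite -natrM.
  apply: le_trans (_ : (p ^ (#|A| * d + j + (i * (j - i) + (j - i) * d)))%N%:R <= _).
    rewrite ler_nat -!mulnA !expnD -!mulnA leq_mul2l; apply/orP; right.
    by rewrite leq_mul2r leq_expn2l ?orbT // prime_gt1.
  apply: pnat_le_powR => //.
  have ij : (i <= j)%N by rewrite -ltnS.
  rewrite !natrD !natrM natrB //; apply: large_arith => //; first exact: pnat_ge2.
  by rewrite -natrX -!natrM ler_nat.
rewrite sumr_const card_ord -[leLHS]mulr_natl.
(* Of the 2 j in the exponent, one j has paid for the 2^j in the count of subspaces; the other pays
   for the j + 1 values of i. *)
have -> : (#|A|%:R / p%:R + j%:R) ^+ 2 / 4 + 2 * j%:R = j%:R + ((#|A|%:R / p%:R + j%:R) ^+ 2 / 4 + j%:R) :> R by ring.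
rewrite [leRHS]PD; apply: ler_wpM2r => //; rewrite /P pnat_powR_nat // ler_nat.
by rewrite ltn_expl // prime_gt1.
Qed.
End NumPsubs.

Section NumPsubsBound.
Variables (R : realType) (p : nat).
Hypothesis pr : prime p.
Let P (x : R) : R := p%:R `^ x.

Lemma sum_step_weight_unif (e1 : nat) : exists K : nat, forall (e n : nat) (A : {set 'I_n}) (j : nat) (W : R),
  (e < e1)%N -> 0 <= W ->
  (forall j' : nat, (num_psubs p A j')%:R <= P ((#|A|%:R / p%:R + j'%:R) ^+ 2 / 4 + 2 * j'%:R) * W) ->
  (\sum_(G1 in psubs p (sym_vec p A j)) step_weight p (logn p (p ^ e)`!) G1)%N%:R <=
  K%:R * (P ((#|A|%:R / p%:R + j%:R + (p ^ e)%N%:R) ^+ 2 / 4 + 2 * j%:R) * W).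
Proof.
elim: e1 => [|e1 [K HK]]; first by exists 0%N.
have mu0 : (0 < p ^ e1)%N by rewrite expn_gt0 prime_gt0.
have [K' HK'] := sum_step_weight_le R pr mu0.
exists (K + K')%N => e n A j W; rewrite ltnS leq_eqVlt natrD mulrDl => /predU1P[->|le] W0 H.
  rewrite -[leLHS]add0r; apply: lerD; first by rewrite !mulr_ge0 ?pnat_powR_ge0.
  by apply: HK' => //; rewrite addnC mulnC logn_fact_pow.
rewrite -[leLHS]addr0; apply: lerD; first exact: HK.
by rewrite !mulr_ge0 ?pnat_powR_ge0.
Qed.

(* Split off a fixed point or a small orbit; if all orbits are large, the
   projection to the symmetric group has small rank. *)
Theorem num_psubs_bound : exists c2 : nat, forall (n : nat) (A : {set 'I_n}) (j : nat),
  (num_psubs p A j)%:R <= P ((#|A|%:R / p%:R + j%:R) ^+ 2 / 4 + 2 * j%:R) * n.+1%:R ^+ (c2 * #|A|).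
Proof.
have [e0 He0] := frank_small_of_large_orbits (8 * p ^ 2) pr.
have [K HK] := sum_step_weight_unif e0.
set L := (p ^ e0)%N; pose K' := (2 ^ (3 * L`!) * K)%N; pose c2 := (L + 4 * K' + 3)%N.
exists c2 => n A j.
have p0 := prime_gt0 pr; have p1 := prime_gt1 pr.
have P0 x : 0 <= P x by exact: pnat_powR_ge0.
have PM x y : x <= y -> P x <= P y by exact: pnat_ler_powR.
have [m] := ubnP #|A|; elim: m A j => // m IH A j ltm.
pose X := psubs p (sym_vec p A j); pose d := (#|A| %/ (8 * p ^ 2))%N.
pose Lg := [set G in X | (frank p (fst @* G)%g <= d)%N].
pose Fx := [set G in X | [exists w in A, [forall x in G, x.1 w == w]]].
pose small (O : {set 'I_n}) := (O \subset A) && [exists e : 'I_e0, #|O| == (p ^ e.+1)%N].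
pose Ox := [set G in X | [exists O : {set 'I_n}, small O && [transitive fst @* G, on O | 'P]]].
have cover : X \subset Lg :|: Fx :|: Ox.
  apply/subsetP=> G GX; have [pG sG] := psubsP _ _ _ GX.
  set G1 := (fst @* G)%G; have pG1 : (p.-group G1)%g by exact: morphim_pgroup.
  have sG1 : G1 \subset sym_on A.
    rewrite /G1 /= morphim_fstE; apply/subsetP=> _ /imsetP[x xG ->].
    by have := subsetP sG x xG; rewrite mem_sym_vec.
  have actA : [acts G1, on A | 'P] by apply/subsetP=> x /(subsetP sG1)/sym_on_acts.
  have [/existsP[w /andP[wA small_w]]|large] := boolP [exists w in A, (#|orbit 'P G1 w| < p ^ e0)%N].
    have sOA : orbit 'P G1 w \subset A by rewrite acts_sub_orbit.
    have /p_natP[e' ce] : p.-nat #|orbit 'P G1 w| by apply: pnat_dvd pG1; exact: dvdn_orbit.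
    case: e' ce => [|e] ce.
      rewrite in_setU in_setU; apply/orP; left; apply/orP; right; rewrite inE GX /=.
      apply/existsP; exists w; rewrite wA /=; apply/forall_inP=> x xG.
      have /cards1P[y oy] : #|orbit 'P G1 w| == 1%N by rewrite ce.
      have : w \in orbit 'P G1 w by exact: orbit_refl.
      have : x.1 w \in orbit 'P G1 w by apply/orbitP; exists x.1 => //; rewrite mem_morphim ?inE.
      by rewrite oy !inE => /eqP -> /eqP ->.
    rewrite in_setU; apply/orP; right; rewrite inE GX /=; apply/existsP; exists (orbit 'P G1 w).
    rewrite /small sOA /=; apply/andP; split; last exact: (atrans_orbit 'P G1 w).
    have lt : (e < e0)%N by move: small_w; rewrite ce ltn_exp2l // => /ltnW.
    by apply/existsP; exists (Ordinal lt); rewrite ce.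
  rewrite in_setU in_setU; apply/orP; left; apply/orP; left; rewrite inE GX /=.
  rewrite leq_divRL ?muln_gt0 ?expn_gt0 ?p0 // mulnC; apply: He0 => // x xA.
  by move: large; rewrite negb_exists => /forallP/(_ x); rewrite xA /= -leqNgt.
have num_le : (num_psubs p A j <= #|Lg| + #|Fx| + #|Ox|)%N.
  apply: leq_trans (subset_leq_card cover) _; apply: leq_trans (leq_card_setU _ _) _.
  by rewrite leq_add2r leq_card_setU.
set Y := P _; have Y0 : 0 <= Y by exact: P0.
have cLg : #|Lg|%:R <= Y * n.+1%:R ^+ #|A|.
  by apply: card_large_le => //; rewrite mulnC leq_divM.
have [A0|[w0 w0A]] := set_0Vmem A.
  have Fx0 : Fx = set0.
    apply/setP=> G; rewrite !inE; apply/negP=> /andP[_ /existsP[w]].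
    by rewrite A0 inE.
  have Ox0 : Ox = set0.
    apply/setP=> G; rewrite !inE; apply/negP=> /andP[_ /existsP[O /andP[/andP[sO /existsP[e cO]] _]]].
    move: sO cO; rewrite A0 subset0 => /eqP ->; rewrite cards0 => /eqP e'.
    by have := expn_gt0 p e.+1; rewrite -e' p0.
  move: num_le cLg; rewrite Fx0 Ox0 cards0 !addn0 A0 cards0 muln0 expr0 => h1 h2.
  by apply: le_trans h2; rewrite ler_nat.
have n0 : (0 < n)%N by apply: leq_ltn_trans (leq0n w0) (ltn_ord w0).
have a0 : (0 < #|A|)%N by apply/card_gt0P; exists w0.
have NX (k l : nat) : (k <= l)%N -> n.+1%:R ^+ k <= n.+1%:R ^+ l :> R.
  by move=> kl; rewrite -!natrX ler_nat leq_exp2l.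
have N0 k : 0 <= n.+1%:R ^+ k :> R by rewrite -natrX.
have c2_ge1 : (0 < c2)%N by rewrite /c2 addn3.
have aR0 (x : nat) (A' : {set 'I_n}) : 0 <= #|A'|%:R / p%:R + x%:R :> R by rewrite addr_ge0 ?divr_ge0.
have cFx : #|Fx|%:R <= Y * (n.+1%:R * n.+1%:R ^+ (c2 * #|A|.-1)).
  apply: (@le_trans _ _ (\sum_(w in A) #|[set G in X | [forall x in G, x.1 w == w]]|)%N%:R).
    rewrite ler_nat; apply: card_bigcup_le => G; rewrite inE => /andP[GX /existsP[w /andP[wA h]]].
    by exists w => //; rewrite inE GX.
  apply: (@le_trans _ _ (\sum_(w in A) Y * n.+1%:R ^+ (c2 * #|A|.-1))).
    rewrite natr_sum; apply: ler_sum => w wA.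
    apply: le_trans (_ : (num_psubs p (A :\ w) j)%:R <= _); first by rewrite ler_nat card_fixed_point.
    have cAw : #|A :\ w| = #|A|.-1 by rewrite [in RHS](cardsD1 w) wA.
    apply: le_trans (IH _ _ _) _; first by rewrite cAw prednK // -ltnS.
    rewrite cAw; apply: ler_wpM2r => //; apply: PM; rewrite lerD2r ler_pM2r ?invr_gt0 //.
    rewrite ler_pXn2r ?nnegrE ?aR0 //; last by rewrite -cAw.
    by rewrite lerD2r ler_pM2r ?invr_gt0 ?ltr0n // ler_nat leq_pred.
  rewrite sumr_const -[leLHS]mulr_natl mulrCA; apply: ler_wpM2l => //; apply: ler_wpM2r => //.
  by rewrite ler_nat; apply: leqW; rewrite (leq_trans (max_card _)) // card_ord.
have cOx : #|Ox|%:R <= Y * (n.+1%:R ^+ L * K'%:R * n.+1%:R ^+ (c2 * #|A|.-1)).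
  apply: (@le_trans _ _ (\sum_(O | small O) #|[set G in X | [transitive fst @* G, on O | 'P]]|)%N%:R).
    rewrite ler_nat; apply: card_bigcup_le => G; rewrite inE => /andP[GX /existsP[O /andP[sm h]]].
    by exists O => //; rewrite inE GX.
  apply: (@le_trans _ _ (\sum_(O | small O) Y * (K'%:R * n.+1%:R ^+ (c2 * #|A|.-1)))).
    rewrite natr_sum; apply: ler_sum => O /andP[sOA /existsP[e /eqP cO]].
    have hs := card_orbit_split pr A j cO; rewrite -(ler_nat R) in hs; apply: (le_trans hs).
    rewrite -big_distrr /= natrM /K' natrM -!mulrA [leRHS]mulrCA; apply: ler_pM => //.
      rewrite ler_nat leq_exp2l // leq_mul2l /= leq_fact // cO /L leq_exp2l //.
    have cAO : #|A :\: O| = (#|A| - p ^ e.+1)%N by rewrite cardsD (setIidPr sOA) cO.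
    have OA : (p ^ e.+1 <= #|A|)%N by rewrite -cO subset_leq_card.
    have O0 : (0 < p ^ e.+1)%N by rewrite expn_gt0 p0.
    pose W : R := n.+1%:R ^+ (c2 * #|A :\: O|).
    have IHO j' : (num_psubs p (A :\: O) j')%:R <= P ((#|A :\: O|%:R / p%:R + j'%:R) ^+ 2 / 4 + 2 * j'%:R) * W.
      by apply: IH; rewrite cAO; move: ltm OA O0; move: (p ^ e.+1)%N #|A| => x y; lia.
    have := HK e n (A :\: O) j W (ltn_ord e) (N0 _) IHO.
    move/le_trans; apply; rewrite [leRHS]mulrCA; apply: ler_wpM2l => //.
    have -> : #|A :\: O|%:R / p%:R + j%:R + (p ^ e)%N%:R = #|A|%:R / p%:R + j%:R :> R.
      by rewrite cAO natrB // expnS natrM; field; rewrite pnatr_eq0 -lt0n.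
    apply: ler_wpM2l => //; apply: NX; rewrite leq_mul2l cAO; apply/orP; right.
    by move: OA O0 a0; move: (p ^ e.+1)%N #|A| => x y; lia.
  rewrite sumr_const -[leLHS]mulr_natl mulrCA; apply: ler_wpM2l => //.
  rewrite -[leRHS]mulrA; apply: ler_wpM2r; first by rewrite mulr_ge0.
  rewrite -natrX ler_nat; apply: leq_trans (card_small_subsets n L); rewrite -cardsE.
  apply: subset_leq_card; apply/subsetP=> O; rewrite !inE => /andP[_ /existsP[e /eqP ->]].
  by rewrite leq_exp2l.
have := num_le; rewrite -(ler_nat R) !natrD => h; apply: (le_trans h).
apply: (@le_trans _ _ (Y * (n.+1%:R * n.+1%:R ^+ (c2 * #|A|.-1) + n.+1%:R * n.+1%:R ^+ (c2 * #|A|.-1) +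
   n.+1%:R ^+ L * K'%:R * n.+1%:R ^+ (c2 * #|A|.-1)))).
  rewrite !mulrDr; apply: lerD => //; apply: lerD => //; apply: le_trans cLg _; apply: ler_wpM2l => //.
  rewrite -exprS; apply: NX; rewrite -{1}(prednK a0) ltnS leq_pmull //.
apply: ler_wpM2l => //; rewrite -!mulrDl.
rewrite -{2}(prednK a0) mulnS exprD; apply: ler_wpM2r => //.
rewrite -!natrX -natrM -!natrD ler_nat; exact: dominate_expn.
Qed.
End NumPsubsBound.

(** * Bounds uniform in the prime *)

Section Uniform.
Variables (R : realType) (p : nat).
Hypothesis pr : prime p.
Let P (x : R) : R := p%:R `^ x.

Lemma le_ln_sub1 (x : R) : 0 < x -> ln x <= x - 1.
Proof. by move=> x0; rewrite -{1}(subrK 1 x) addrC; apply: le_ln1Dx; lra. Qed.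

Lemma ln2_ge : 1 / 2 <= ln 2 :> R.
Proof.
have h : ln (2^-1) <= 2^-1 - 1 :> R by apply: le_ln_sub1; lra.
by rewrite lnV ?posrE // in h; lra.
Qed.

(** For x = q / p, ln x <= x - 1 <= (x^2 - 1) / 2 <= (x^2 - 1) ln p, as ln p >= 1/2. Hence ln q <=
    x^2 ln p, that is, ln q / q^2 <= ln p / p^2. *)
Lemma powR_prime_sq_le (q : nat) (y : R) : (p <= q)%N -> 0 <= y ->
  q%:R `^ (y / (4 * q%:R ^+ 2)) <= P (y / (4 * p%:R ^+ 2)).
Proof.
move=> pq y0.
have p2 : 2 <= p%:R :> R := pnat_ge2 R pr.
have qp : p%:R <= q%:R :> R by rewrite ler_nat.
have q2 : 2 <= q%:R :> R by exact: le_trans qp.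
rewrite /P /powR !gt_eqF ?(lt_le_trans _ p2) ?(lt_le_trans _ q2) // ler_expR.
have lnp : ln 2 <= ln p%:R :> R by rewrite ler_ln ?posrE // ?(lt_le_trans _ p2).
have lp : 1 / 2 <= ln p%:R :> R by apply: le_trans ln2_ge lnp.
pose x : R := q%:R / p%:R; have p0 : 0 < p%:R :> R by lra.
have x1 : 1 <= x by rewrite ler_pdivlMr // mul1r.
have qE : q%:R = x * p%:R :> R by rewrite divfK // gt_eqF.
have lx : ln x <= x - 1 by apply: le_ln_sub1; lra.
have lq : ln q%:R = ln x + ln p%:R :> R by rewrite qE lnM ?posrE //; lra.
have key : ln q%:R <= x ^+ 2 * ln p%:R.
  rewrite lq; have : (x ^+ 2 - 1) * (1 / 2) <= (x ^+ 2 - 1) * ln p%:R.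
    by apply: ler_wpM2l => //; nra.
  have : 2 * (x - 1) <= x ^+ 2 - 1 by nra.
  lra.
have c0 : 0 <= y / (4 * q%:R ^+ 2) by rewrite divr_ge0 // mulr_ge0 // sqr_ge0.
have -> : y / (4 * p%:R ^+ 2) * ln p%:R = y / (4 * q%:R ^+ 2) * (x ^+ 2 * ln p%:R).
  by rewrite qE; field; rewrite !gt_eqF //; lra.
exact: ler_wpM2l.
Qed.

Lemma card_psubs_sharp (q : nat) : prime q -> (p <= q)%N -> exists c : nat, forall n (A : {set 'I_n}),
  #|psubs q (sym_on A)|%:R <= P (#|A|%:R ^+ 2 / (4 * p%:R ^+ 2)) * n.+1%:R ^+ (c * #|A|).
Proof.
move=> prq pq; have [c Hc] := num_psubs_bound R prq; exists c => n A.
have := Hc n A 0%N; rewrite addr0 mulr0 addr0 => h.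
apply: le_trans (_ : (num_psubs q A 0)%:R <= _); first by rewrite ler_nat psubs_le_num_psubs.
apply: le_trans h _; apply: ler_wpM2r; first by rewrite -natrX.
apply: le_trans (powR_prime_sq_le pq (sqr_ge0 #|A|%:R)).
have -> // : (#|A|%:R / q%:R) ^+ 2 / 4 = #|A|%:R ^+ 2 / (4 * q%:R ^+ 2) :> R.
by field; rewrite pnatr_eq0 -lt0n prime_gt0.
Qed.

Lemma card_psubs_sharp_unif (Q : nat) : exists c : nat, forall q, prime q -> (p <= q < Q)%N -> forall n (A : {set 'I_n}),
  #|psubs q (sym_on A)|%:R <= P (#|A|%:R ^+ 2 / (4 * p%:R ^+ 2)) * n.+1%:R ^+ (c * #|A|).
Proof.
elim: Q => [|Q [c Hc]]; first by exists 0%N => q _; rewrite ltn0 andbF.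
have mono (c1 c2 n : nat) (A : {set 'I_n}) (x : R) : (c1 <= c2)%N ->
    x <= P (#|A|%:R ^+ 2 / (4 * p%:R ^+ 2)) * n.+1%:R ^+ (c1 * #|A|) ->
    x <= P (#|A|%:R ^+ 2 / (4 * p%:R ^+ 2)) * n.+1%:R ^+ (c2 * #|A|).
  move=> le h; apply: le_trans h _; apply: ler_wpM2l; first exact: pnat_powR_ge0.
  by rewrite -!natrX ler_nat leq_pexp2l // leq_mul2r le orbT.
have [/andP[prQ pQ]|h] := boolP (prime Q && (p <= Q)%N).
  have [c' Hc'] := card_psubs_sharp prQ pQ.
  exists (c + c')%N => q prq /andP[pq]; rewrite ltnS leq_eqVlt => /predU1P[->|lt] n A.
    by apply: (mono c'); rewrite ?leq_addl.
  by apply: (mono c); rewrite ?leq_addr //; apply: Hc; rewrite ?pq.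
exists c => q prq /andP[pq]; rewrite ltnS leq_eqVlt => /predU1P[e|lt] n A; last by apply: Hc; rewrite ?pq.
by rewrite -e prq pq in h.
Qed.

(** The constant of [num_psubs_bound] depends on q, so it serves the finitely many q below Q. Beyond
    Q, with v the q-adic valuation of |A|!, the crude count |A|! q^(v^2) suffices because v <= |A| /
    (q - 1). *)
Theorem card_psubs_unif : exists c : nat, forall q, prime q -> (p <= q)%N -> forall n (A : {set 'I_n}),
  #|psubs q (sym_on A)|%:R <= P (#|A|%:R ^+ 2 / (4 * p%:R ^+ 2)) * n.+1%:R ^+ (c * #|A|).
Proof.
(* From Q on q^(4 p^2) <= 2^q; the 3 ensures q <= (q - 1)^2. *)
have [a0 Ha0] := expn_le_exp2 (4 * p ^ 2); pose Q := (a0 + 3)%N.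
have [c Hc] := card_psubs_sharp_unif Q; exists (c + 1)%N => q prq pq n A.
have [lt|ge] := ltnP q Q.
  apply: le_trans (Hc q prq _ n A) _; first by rewrite pq.
  apply: ler_wpM2l; first exact: pnat_powR_ge0.
  by rewrite -!natrX ler_nat leq_pexp2l // leq_mul2r leq_addr orbT.
apply: le_trans (_ : (#|A|`! * q ^ (logn q #|A|`! * logn q #|A|`!))%N%:R <= _).
  by rewrite ler_nat card_psubs_crude.
rewrite natrM mulrC; apply: ler_pM => //; last first.
  rewrite -natrX ler_nat; apply: leq_trans (fact_le_expn _) _.
  apply: (@leq_trans (n.+1 ^ #|A|)); first by apply: leq_expn2l; rewrite (leq_trans (max_card _)) // card_ord.
  by rewrite leq_pexp2l // mulnDl mul1n leq_addl.
set l := logn q _; have la : (q.-1 * l <= #|A|)%N by exact: logn_fact_le.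
pose k := (4 * p ^ 2)%N; have k0 : (0 < k)%N by rewrite /k !muln_gt0 (prime_gt0 pr).
have P0 x : 0 <= P x by exact: pnat_powR_ge0.
rewrite -(@ler_pXn2r _ k) ?nnegrE ?P0 //.
have kR : k%:R = 4 * p%:R ^+ 2 :> R by rewrite /k natrM natrX.
rewrite -[P _ ^+ k]powR_mulrn ?P0 // -powRrM kR divfK; last first.
  by rewrite -kR pnatr_eq0 -lt0n.
rewrite -!natrX powR_mulrn // -natrX ler_nat.
apply: (@leq_trans (2 ^ (#|A| ^ 2))); last by apply: leq_expn2l; exact: prime_gt1.
apply: (@leq_trans (2 ^ ((q.-1 * l) ^ 2))); last by rewrite leq_exp2l // leq_expn2l.
rewrite -expnM mulnC expnM.
have -> : ((q.-1 * l) ^ 2 = q.-1 ^ 2 * (l * l))%N by rewrite expnMn.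
rewrite [X in (_ <= X)%N]expnM; apply: leq_expn2l; apply: leq_trans (Ha0 q _) _; first by apply: leq_trans ge; rewrite leq_addr.
rewrite leq_exp2l //; have : (2 < q)%N by apply: leq_trans ge; rewrite leq_addl.
by case: (q) => [|[|[|q']]] // _; rewrite !expnS expn0; nia.
Qed.
End Uniform.

Section NilpotentBound.
Variables (R : realType) (p : nat).
Hypothesis pr : prime p.
Let P (x : R) : R := p%:R `^ x.

(* Remove the primes one at a time. If a, b, c and s are the sizes of A, B, C
   and of what remains, then a + s <= c controls the quadratic exponents, and
   2b <= |T| makes s smaller than c by at least half of |T|, which pays for the
   choices made on T. *)
Theorem card_nil_subs_bound : exists k : nat, forall (n i q : nat) (C : {set 'I_n}),
  (q + i = n.+1)%N -> (p <= q)%N ->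
  #|nil_subs q C|%:R <= n.+1%:R ^+ i * (P (#|C|%:R ^+ 2 / (4 * p%:R ^+ 2)) * n.+1%:R ^+ (k * #|C|)).
Proof.
(* The choices on T cost (n + 1)^((2 + 3 + c) |T|): the coordinate maps, the triple (T, A, B) and
   the error term on A. The remaining set is smaller by at least |T| / 2, whence the factor 2. *)
have [c Hc] := card_psubs_unif R pr; pose k := (2 * (c + 5))%N; exists k => n i.
have P0 x : 0 <= P x by exact: pnat_powR_ge0.
have PM x y : x <= y -> P x <= P y by exact: pnat_ler_powR.
have PD x y : P (x + y) = P x * P y by exact: pnat_powRD.
have N0 l : 0 <= n.+1%:R ^+ l :> R by rewrite -natrX.
have N1 l : 1 <= n.+1%:R ^+ l :> R by rewrite -natrX ler1n expn_gt0.
have NX (a b : nat) : (a <= b)%N -> n.+1%:R ^+ a <= n.+1%:R ^+ b :> R.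
  by move=> ab; rewrite -!natrX ler_nat leq_pexp2l.
have p20 : 0 < 4 * p%:R ^+ 2 :> R by rewrite mulr_gt0 // exprn_gt0 // ltr0n prime_gt0.
have E0 (a : nat) : 0 <= a%:R ^+ 2 / (4 * p%:R ^+ 2) :> R by rewrite divr_ge0 ?sqr_ge0 // ltW.
elim: i => [|i IH] q C qi pq.
  rewrite addn0 in qi; rewrite expr0 mul1r; apply: (@le_trans _ _ 1).
    by rewrite lern1 nil_subs_large // qi.
  by rewrite -[leLHS]mul1r; apply: ler_pM => //; exact: pnat_powR_ge1.
have qi' : (q.+1 + i = n.+1)%N by rewrite addSnnS.
set Z := n.+1%:R ^+ i * (P (#|C|%:R ^+ 2 / (4 * p%:R ^+ 2)) * n.+1%:R ^+ (k * #|C|)).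
rewrite exprS -mulrA -/Z; have Z0 : 0 <= Z by rewrite !mulr_ge0.
have [prq|nprq] := boolP (prime q); last first.
  apply: (@le_trans _ _ Z); last by rewrite ler_peMl // ler1n.
  apply: le_trans (IH q.+1 C qi' (leqW pq)); rewrite ler_nat.
  by apply: subset_leq_card; exact: nil_subs_not_prime.
apply: le_trans (_ : (\sum_(x | nil_split C x) n.+1 ^ (2 * #|x.1.1|) *
  (#|psubs q (sym_on x.1.2)| * #|nil_subs q.+1 (C :\: x.1.1 :|: x.2)|))%N%:R <= _).
  by rewrite ler_nat card_nil_subs_step.
rewrite natr_sum; set w := (X in \sum_(x | _) X x).
have wle x : nil_split C x -> w x <= Z / n.+1%:R ^+ (3 * #|x.1.1|).
  case/and5P=> sT sA sB cAB cB; rewrite ler_pdivlMr; last by apply: lt_le_trans (N1 _).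
  set s := #|C :\: x.1.1 :|: x.2|.
  have sle : (s + #|x.1.1| <= #|C| + #|x.2|)%N.
    have h : (s <= #|C :\: x.1.1| + #|x.2|)%N by exact: leq_card_setU.
    have := cardsD C x.1.1; rewrite (setIidPr sT).
    have := subset_leq_card sT; move: h; move: s #|C :\: x.1.1| #|C| #|x.1.1| #|x.2|; clear; lia.
  apply: (@le_trans _ _ (n.+1%:R ^+ (2 * #|x.1.1|) * (P (#|x.1.2|%:R ^+ 2 / (4 * p%:R ^+ 2)) * n.+1%:R ^+ (c * #|x.1.2|) *
     (n.+1%:R ^+ i * (P (s%:R ^+ 2 / (4 * p%:R ^+ 2)) * n.+1%:R ^+ (k * s)))) * n.+1%:R ^+ (3 * #|x.1.1|))).
    apply: ler_wpM2r => //; rewrite /w !natrM natrX; apply: ler_wpM2l => //.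
    by apply: ler_pM => //; [exact: Hc | exact: IH qi' (leqW pq)].
  rewrite (_ : _ * _ = n.+1%:R ^+ i * ((P (#|x.1.2|%:R ^+ 2 / (4 * p%:R ^+ 2)) * P (s%:R ^+ 2 / (4 * p%:R ^+ 2))) *
     n.+1%:R ^+ (2 * #|x.1.1| + c * #|x.1.2| + k * s + 3 * #|x.1.1|))); last by rewrite !exprD; ring.
  apply: ler_wpM2l => //; apply: ler_pM; rewrite ?mulr_ge0 //.
    rewrite -PD; apply: PM; rewrite -mulrDl ler_pM2r ?invr_gt0 //.
    rewrite -!natrX -natrD ler_nat.
    have : (#|x.1.2| + s <= #|C|)%N by move: sle cAB; lia.
    by clearbody s; move: #|x.1.2| s {sle} #|C| => a b d; clear; nia.
  clearbody s; apply: NX; rewrite /k; move: sle cB (subset_leq_card sA); move: #|x.1.1| #|x.1.2| #|x.2| s #|C| => t a b s' d.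
  clear; nia.
(* The n + 1 possible sizes of T account for one factor n + 1 per value of q; for a fixed size the
   denominator cancels the number of triples. *)
rewrite (partition_big (fun x : {set 'I_n} * {set 'I_n} * {set 'I_n} => inord #|x.1.1| : 'I_n.+1) xpredT) //=.
apply: (@le_trans _ _ (\sum_(t < n.+1) Z)); last by rewrite sumr_const card_ord -[leLHS]mulr_natl.
apply: ler_sum => t _.
have eT (x : {set 'I_n} * {set 'I_n} * {set 'I_n}) : (inord #|x.1.1| == t) = (#|x.1.1| == t :> nat).
  by rewrite -val_eqE /= inordK // ltnS (leq_trans (max_card _)) // card_ord.
apply: (@le_trans _ _ (\sum_(x | nil_split C x && (inord #|x.1.1| == t)) Z / n.+1%:R ^+ (3 * t))).
  by apply: ler_sum => x /andP[sx]; rewrite eT => /eqP <-; exact: wle.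
rewrite sumr_const -[leLHS]mulr_natl mulrCA -[leRHS]mulr1; apply: ler_wpM2l => //.
rewrite ler_pdivrMr ?mul1r; last by apply: lt_le_trans (N1 _).
rewrite -natrX ler_nat; apply: leq_trans (card_nil_split C t); rewrite cardsE.
by apply/eq_leq/eq_card => x; rewrite !unfold_in eT.
Qed.
End NilpotentBound.

(** * Passage to the stated form *)

Lemma SubWith_nilpotent_geqE p n : SubWith (@nilpotent_geq p 'S_n) [set: 'S_n]%G = nil_subs p [set: 'I_n].
Proof.
apply/setP=> G; rewrite /SubWith !inE /nilpotent_geq; case: (nilpotent G) => //=; last by rewrite andbF.
rewrite subsetT /=; have -> // : G \subset sym_on [set: 'I_n].
by apply/subsetP=> x _; rewrite inE; apply/subsetP=> y _; rewrite inE.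
Qed.

Lemma SubWith_nilpotentE n :
  SubWith (@nilpotent_grp 'S_n) [set: 'S_n]%G = SubWith (@nilpotent_geq 2 'S_n) [set: 'S_n]%G.
Proof.
apply/setP=> G; rewrite /SubWith !inE /nilpotent_grp /nilpotent_geq.
have -> : [forall q : 'I_2, prime q ==> ~~ (q %| #|G|)%N]; last by rewrite andbT.
by apply/forallP=> -[[|[|]]].
Qed.

From mathcomp Require Import all_classical all_reals all_analysis.

Lemma powR_logb2 (R : realType) (x y : R) : 0 < x -> 2 `^ (y * logb2 x) = x `^ y.
Proof.
move=> x0; rewrite /powR !gt_eqF // /logb2 -mulrA divfK // gt_eqF // ln_gt0 //; lra.
Qed.

Lemma card_nilpotent_geq_bound (R : realType) (p : nat) : prime p -> exists gamma : R,
  forall n : nat, (0 < n)%N ->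
     #|SubWith (@nilpotent_geq p 'S_n) [set: 'S_n]%G|%:R <=
       p%:R `^ (n%:R ^+ 2 / (4 * p%:R ^+ 2)) * 2 `^ (gamma * n%:R * logb2 n%:R).
Proof.
move=> pr; have [k Hk] := card_nil_subs_bound R pr.
(* Replacing n + 1 by n^2, for n >= 2, doubles the exponent, and n + 1 - p + k n is at most (k + 2)
   n. *)
exists (2 * (k + 2)%N%:R) => n n_gt0; rewrite SubWith_nilpotent_geqE.
have nR : 0 < n%:R :> R by rewrite ltr0n.
rewrite powR_logb2 //.
have E0 : 0 <= n%:R ^+ 2 / (4 * p%:R ^+ 2) :> R by rewrite divr_ge0 ?sqr_ge0 // mulr_ge0 // sqr_ge0.
have Pge1 : 1 <= p%:R `^ (n%:R ^+ 2 / (4 * p%:R ^+ 2)) :> R by exact: pnat_powR_ge1.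
have G0 : 0 <= 2 * (k + 2)%N%:R * n%:R :> R by rewrite !mulr_ge0.
(* The case n = 1, where n log n vanishes, falls under n < p; there only the trivial subgroup is
   counted. *)
have [lt|le] := ltnP n p.
  apply: (@le_trans _ _ 1); first by rewrite lern1 nil_subs_large.
  rewrite -[leLHS]mul1r; apply: ler_pM => //.
  by rewrite -[leLHS](powRr0 n%:R); apply: ler_powR => //; rewrite ler1n.
have n2 : (2 <= n)%N := leq_trans (prime_gt1 pr) le.
have := Hk n (n.+1 - p)%N p [set: 'I_n] (subnKC (leqW le)) (leqnn p); rewrite cardsT card_ord.
move/le_trans; apply; rewrite mulrCA; apply: ler_wpM2l; first exact: le_trans Pge1.
rewrite -exprD -!natrM powR_mulrn // -!natrX ler_nat.
apply: (@leq_trans ((n ^ 2) ^ (n.+1 - p + k * n))%N).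
  apply: leq_expn2l; rewrite expnS expn1; nia.
rewrite -expnM leq_pexp2l // -mulnA leq_mul2l /=; have := prime_gt1 pr; nia.
Qed.

Theorem theorem3 (R : realType) :
  exists gamma : nat -> R,
    (forall p : nat, prime p -> forall n : nat, (0 < n)%N ->
       #|SubWith (@nilpotent_geq p 'S_n) [set: 'S_n]%G|%:R <=
         p%:R `^ (n%:R ^+ 2 / (4 * p%:R ^+ 2)) *
         2 `^ (gamma p * n%:R * logb2 n%:R) :> R) /\
    (forall n : nat, (0 < n)%N ->
       #|SubWith (@nilpotent_grp 'S_n) [set: 'S_n]%G|%:R <=
         2 `^ (n%:R ^+ 2 / 16 + gamma 2%N * n%:R * logb2 n%:R) :> R).
Proof.
have /choice[gamma Hg] : forall p, exists g : R, prime p -> forall n : nat, (0 < n)%N ->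
    #|SubWith (@nilpotent_geq p 'S_n) [set: 'S_n]%G|%:R <=
      p%:R `^ (n%:R ^+ 2 / (4 * p%:R ^+ 2)) * 2 `^ (g * n%:R * logb2 n%:R).
  move=> p; have [pr|npr] := boolP (prime p); last by exists 0.
  by have [g Hg] := card_nilpotent_geq_bound R pr; exists g.
exists gamma; split=> [p pr|n n_gt0]; first exact: Hg.
rewrite SubWith_nilpotentE powRD; last by apply/implyP => _; rewrite pnatr_eq0.
apply: le_trans (Hg 2%N isT n n_gt0) _.
by have -> : 4 * 2 ^+ 2 = 16 :> R by ring.
Qed.
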